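(* Let $\mathscr{R}$ be a noetherian Banach $K$-algebra with a triangular decomposition $(R,A,B,H,\partial)$, such that the closures $\mathscr{A},\mathscr{B}$ of $A,B$ in $\mathscr{R}$ are noetherian Banach $K$-algebras. Every object of $\widehat{\mathcal{O}}$ admits a finite Jordan–Hölder series. That is, given $M\in\widehat{\mathcal{O}}$ there is a finite filtration by objects in $\widehat{\mathcal{O}}$ $$0=M_0\subset M_1\subset\cdots\subset M_n=M$$ such that $M_i/M_{i-1}=\widehat{L}(W_i)$ for some $W_i\in\mathrm{Irr}(H)$.
   Context: $K$ is a complete discretely valued extension of $\mathbb{Q}_p$. Modules are left modules. **Algebraic triangular decomposition.** A triangular decomposition of a noetherian $\mathbb{Z}$-graded $K$-algebra $R$ is a tuple $(A,B,H,\partial)$ of graded subalgebras $A,B,H\subset R$ and an element $\partial\in R_0$ such that: (1) multiplication gives $R=A\otimes_K H\otimes_K B$ as $K$-vector spaces; (2) $B\cdot H=H\cdot B$ and $H\cdot A=A\cdot H$; (3) $A=\bigoplus_{n\ge 0}A_n$, $B=\bigoplus_{n\le 0}B_n$, $A_0=B_0=K$, $H\subset R_0$; (4) all $A_n,B_n$ are finite-dimensional; (5) $H$ is a finite-dimensional split semisimple $K$-algebra; (6) $R_n=\{x\in R\mid[\partial,x]=nx\}$. Put $B^n=B_{-n}$, $B^{>n}=\bigoplus_{m>n}B^m$, $BH^{>n}=B^{>n}\otimes_KH$. $\mathrm{Irr}(H)$ is the set of isomorphism classes of irreducible $H$-modules. **Weight spaces.** For a locally convex $K$-vector space $V$ with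 a continuous endomorphism $\partial$ and $\lambda\in K$, put $V^\lambda=\{v\mid(\partial-\lambda)^nv=0\text{ for }n\gg0\}$, $\Lambda(V)=\{\lambda\in K\mid V^\lambda\neq0\}$ and $V^{\mathrm{ws}}=\bigoplus_{\lambda\in\Lambda(V)}V^\lambda$. $V$ admits a weight space decomposition (with respect to $I\subset\Lambda(V)$) if every $v\in V$ is a convergent sum $v=\sum_{\lambda\in I}v_\lambda$ with $v_\lambda\in V^\lambda$. It is semi-simple if $\partial$ acts on $V^\lambda$ as multiplication by $\lambda$ for each $\lambda\in I$. **Banach triangular decomposition.** A triangular decomposition of a noetherian Banach $K$-algebra $\mathscr{R}$ is a tuple $(R,A,B,H,\partial)$ where $R\subset\mathscr{R}$ is a dense graded subalgebra with algebraic triangular decomposition $(A,B,H,\partial)$, such that, with $\mathscr{A},\mathscr{B}$ the closures of $A,B$ in $\mathscr{R}$ and $\mathrm{ad}(\partial)=[\partial,-]$: (1) $\mathscr{R}=\mathscr{A}\widehat{\otimes}_KH\widehat{\otimes}_K\mathscr{B}$ as Banach spaces; (2) $\mathscr{A}$ and $\mathscr{B}$ have semi-simple weight space decompositions for $\mathrm{ad}(\partial)$, with $\mathscr{A}^{\mathrm{ws}}=A$ and $\mathscr{B}^{\mathrm{ws}}=B$. **Modules.** With $\mathscr{B}H=\mathscr{B}\widehat\otimes_KH\subset\mathscr{R}$ and $\mathscr{B}H^{>0}$ its two-sided ideal generated by $BH^{>0}$, the analytic Verma module of $W\in\mathrm{Irr}(H)$ is $\widehat{\Delta}(W)=\mathscr{R}\widehat\otimes_{\mathscr{B}H}(\mathscr{B}H/\mathscr{B}H^{>0}\widehat\otimes_HW)=\mathscr{A}\widehat\otimes_KW$;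 $\widehat{L}(W)$ is its unique simple quotient. $\widehat{\mathcal{O}}$ is the full subcategory of the category of finitely generated $\mathscr{R}$-modules (with their canonical Banach topology) consisting of modules which are finite over $\mathscr{A}$ and admit a weight space decomposition with respect to the action of $\partial$. *)

(* Defs.v *)
From HB Require Import structures.
From mathcomp Require Import all_boot all_order all_algebra.
From mathcomp Require Import finmap generic_quotient ring_quotient.
From mathcomp Require Import boolp classical_sets reals.

Set Implicit Arguments.
Unset Strict Implicit.
Unset Printing Implicit Defensive.
Import Order.TTheory GRing.Theory Num.Theory.
Local Open Scope classical_set_scope.
Local Open Scope ring_scope.
Local Open Scope quotient_scope.

Record subalg (K : fieldType) (R : algType K) := Subalg {
  sa_pred :> {pred R};
  sa_closed : subalg_closed sa_pred }.

HB.instance Definition _ (K : fieldType) (R : algType K) (S : subalg R) :=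
  GRing.isSubalgClosed.Build K R (sa_pred S)
    (GRing.subalg_closed_semi (sa_closed S)).

Definition salg (K : fieldType) (R : algType K) (S : subalg R) : Type :=
  {x : R | x \in sa_pred S}.
HB.instance Definition _ (K : fieldType) (R : algType K) (S : subalg R) :=
  SubChoice.on (@salg K R S).
HB.instance Definition _ (K : fieldType) (R : algType K) (S : subalg R) :=
  [SubChoice_isSubAlgebra of @salg K R S by <:].

Record submod (A : nzRingType) (M : lmodType A) := Submod {
  sm_pred :> {pred M};
  sm_closed : submod_closed sm_pred }.

HB.instance Definition _ (A : nzRingType) (M : lmodType A) (N : submod M) :=
  GRing.isSubmodClosed.Build A M (sm_pred N)
    (GRing.submod_closed_semi (sm_closed N)).

Definition smod (A : nzRingType) (M : lmodType A) (N : submod M) : Type :=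
  {x : M | x \in sm_pred N}.
HB.instance Definition _ (A : nzRingType) (M : lmodType A) (N : submod M) :=
  SubChoice.on (@smod A M N).
HB.instance Definition _ (A : nzRingType) (M : lmodType A) (N : submod M) :=
  [SubChoice_isSubLmodule of @smod A M N by <:].

Section Quotient_module.
Context (A : nzRingType) (M : lmodType A) (N : submod M).

Definition quotmod : Type := Quotient.quot (sm_pred N : zmodClosed M).
HB.instance Definition _ := Choice.on quotmod.
HB.instance Definition _ := GRing.Zmodule.on quotmod.
HB.instance Definition _ := Quotient.on quotmod.

Definition quotmod_scale (a : A) (q : quotmod) : quotmod :=
  \pi_quotmod (a *: repr q).

Lemma quotmod_piP (x y : M) :
  \pi_quotmod x = \pi_quotmod y <-> x - y \in sm_pred N.
Proof.
rewrite (Quotient.idealrBE (sm_pred N : zmodClosed M)).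
by split=> [/eqP|/eqP].
Qed.

Lemma quotmod_piD (x y : M) :
  \pi_quotmod (x + y) = \pi_quotmod x + \pi_quotmod y.
Proof. exact: (raddfD (\pi_(Quotient.quot (sm_pred N : zmodClosed M)))). Qed.

Lemma quotmod_piZ a (x : M) :
  quotmod_scale a (\pi_quotmod x) = \pi_quotmod (a *: x).
Proof.
apply/quotmod_piP; rewrite -scalerBr rpredZ //.
by apply/quotmod_piP; rewrite reprK.
Qed.

Fact quotmod_scaleA a b (q : quotmod) :
  quotmod_scale a (quotmod_scale b q) = quotmod_scale (a * b) q.
Proof.
elim/quotW: q => x.
by rewrite (quotmod_piZ b) (quotmod_piZ a) (quotmod_piZ (a * b)) scalerA.
Qed.

Fact quotmod_scale1 : left_id 1 quotmod_scale.
Proof. by elim/quotW=> x; rewrite quotmod_piZ scale1r. Qed.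

Fact quotmod_scaleDr : right_distributive quotmod_scale +%R.
Proof.
move=> a; elim/quotW=> x; elim/quotW=> y; rewrite -quotmod_piD !quotmod_piZ.
by rewrite scalerDr quotmod_piD.
Qed.

Fact quotmod_scaleDl q : {morph quotmod_scale^~ q : a b / a + b}.
Proof.
by move=> a b; elim/quotW: q => x; rewrite !quotmod_piZ scalerDl quotmod_piD.
Qed.

HB.instance Definition _ := GRing.Zmodule_isLmodule.Build A quotmod
  quotmod_scaleA quotmod_scale1 quotmod_scaleDr quotmod_scaleDl.
End Quotient_module.

Section Subquotient.
Context (A : nzRingType) (M : lmodType A) (N N' : submod M).

Definition in_sub : {pred smod N'} := fun x => val x \in N.
Fact in_sub_closed : submod_closed in_sub.
Proof.
split=> [|a x y xN yN]; first by rewrite /in_mem /= /in_sub raddf0 rpred0.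
by rewrite /in_mem /= /in_sub linearP rpredD ?rpredZ.
Qed.

(* [N'/N], meant for [N] contained in [N'] *)
Definition subquot : Type := quotmod (Submod in_sub_closed).
HB.instance Definition _ := GRing.Lmodule.on subquot.
End Subquotient.

Definition restrict (A B : nzRingType) (f : {rmorphism A -> B})
  (M : lmodType B) : Type := M.
HB.instance Definition _ (A B : nzRingType) (f : {rmorphism A -> B})
    (M : lmodType B) := GRing.Zmodule.on (@restrict A B f M).
Section Restrict.
Context (A B : nzRingType) (f : {rmorphism A -> B}) (M : lmodType B).
Definition restrict_scale (a : A) (m : restrict f M) : restrict f M :=
  f a *: (m : M).
Fact restrict_scaleA a b m :
  restrict_scale a (restrict_scale b m) = restrict_scale (a * b) m.
Proof. by rewrite /restrict_scale scalerA rmorphM. Qed.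
Fact restrict_scale1 : left_id 1 restrict_scale.
Proof. by move=> m; rewrite /restrict_scale rmorph1 scale1r. Qed.
Fact restrict_scaleDr : right_distributive restrict_scale +%R.
Proof. by move=> a m n; exact: scalerDr. Qed.
Fact restrict_scaleDl m : {morph restrict_scale^~ m : a b / a + b}.
Proof. by move=> a b; rewrite /restrict_scale rmorphD scalerDl. Qed.
HB.instance Definition _ := GRing.Zmodule_isLmodule.Build A (restrict f M)
  restrict_scaleA restrict_scale1 restrict_scaleDr restrict_scaleDl.
End Restrict.

(* the vector space underlying a module over a K-algebra *)
Notation vsp K M := (restrict (GRing.in_alg _ : {rmorphism K -> _}) M).

Definition fin_gen (A : nzRingType) (M : lmodType A) (P : set M) : Prop :=
  exists n (g : 'I_n -> M), (forall i, P (g i)) /\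
    forall x, P x -> exists c : 'I_n -> A, x = \sum_i c i *: g i.

Definition left_noetherian (A : nzRingType) : Prop :=
  forall I : submod (A^o), fin_gen [set x | x \in I].

(* on both sides; [A^c] is the opposite ring *)
Definition noetherian (A : nzRingType) : Prop :=
  left_noetherian A /\ left_noetherian A^c.

Definition simple_mod (A : nzRingType) (M : lmodType A) : Prop :=
  (exists x : M, x != 0) /\
  forall N : submod M, (forall x, x \in N -> x = 0) \/ (forall x, x \in N).

Definition semisimple (A : nzRingType) : Prop :=
  forall I : submod (A^o), exists J : submod (A^o),
    (forall x, x \in I -> x \in J -> x = 0) /\
    (forall x, exists y z, [/\ y \in I, z \in J & x = y + z]).

Definition split_alg (K : fieldType) (H : algType K) : Prop :=
  forall W : lmodType H, simple_mod W ->
  forall f : {linear W -> W}, exists k : K, forall w, f w = k%:A *: w.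

Section Algebraic.
Context (K : fieldType) (R : algType K).

Definition prod_span (P Q : set R) : set R :=
  [set x | exists n (u v : 'I_n -> R),
     (forall i, P (u i) /\ Q (v i)) /\ x = \sum_i u i * v i].

Definition is_grading (gr : int -> submod R) : Prop :=
  [/\ 1 \in gr 0,
      forall m n x y, x \in gr m -> y \in gr n -> x * y \in gr (m + n),
      forall x, exists (s : {fset int}) (c : int -> R),
        (forall n, c n \in gr n) /\ x = \sum_(n <- s) c n
    & forall (s : {fset int}) (c : int -> R), (forall n, c n \in gr n) ->
        \sum_(n <- s) c n = 0 -> forall n, n \in s -> c n = 0].

Definition graded_subalg (gr : int -> submod R) (S : subalg R) : Prop :=
  forall x, x \in S -> exists (s : {fset int}) (c : int -> R),
    (forall n, c n \in gr n /\ c n \in S) /\ x = \sum_(n <- s) c n.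

Definition ad (d x : R) : R := d * x - x * d.

End Algebraic.

Definition trilinear (K : fieldType) (X Y Z V : lmodType K)
    (b : X -> Y -> Z -> V) : Prop :=
  [/\ forall y z, linear (fun x => b x y z),
      forall x z, linear (fun y => b x y z)
    & forall x y, linear (fun z => b x y z)].

(* [t] exhibits [T] as the tensor product of [X], [Y] and [Z] over [K] *)
Definition is_tensor3 (K : fieldType) (X Y Z T : lmodType K)
    (t : X -> Y -> Z -> T) : Prop :=
  trilinear t /\
  forall (V : lmodType K) (b : X -> Y -> Z -> V), trilinear b ->
    exists! f : T -> V,
      linear f /\ forall x y z, f (t x y z) = b x y z.

Record alg_tridec (K : fieldType) (R : algType K) (gr : int -> submod R)
    (A B H : subalg R) (d : R) : Prop := {
  atd_noetherian : noetherian R;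
  atd_grading : is_grading gr;
  atd_gradA : graded_subalg gr A;
  atd_gradB : graded_subalg gr B;
  atd_gradH : graded_subalg gr H;
  atd_tensor : is_tensor3
    (fun (a : salg A) (h : salg H) (b : salg B) => val a * val h * val b : R);
  atd_BH : prod_span [set` B] [set` H] = prod_span [set` H] [set` B];
  atd_HA : prod_span [set` H] [set` A] = prod_span [set` A] [set` H];
  atd_Apos : forall n x, n < 0 -> x \in A -> x \in gr n -> x = 0;
  atd_Bneg : forall n x, 0 < n -> x \in B -> x \in gr n -> x = 0;
  atd_A0 : forall x, (x \in A) && (x \in gr 0) <-> exists k : K, x = k%:A;
  atd_B0 : forall x, (x \in B) && (x \in gr 0) <-> exists k : K, x = k%:A;
  atd_H0 : forall x, x \in H -> x \in gr 0;
  atd_Afin : forall n, fin_gen [set x : R | x \in A /\ x \in gr n];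
  atd_Bfin : forall n, fin_gen [set x : R | x \in B /\ x \in gr n];
  atd_Hfin : fin_gen [set: salg H];
  atd_Hss : semisimple (salg H);
  atd_Hsplit : split_alg (salg H);
  atd_d0 : d \in gr 0;
  atd_gr : forall n x, x \in gr n <-> ad d x = n%:~R *: x }.

Section Valued.
Context (RT : realType).

Record is_absv (K : fieldType) (v : K -> RT) : Prop := {
  av_ge0 : forall x, 0 <= v x;
  av_eq0 : forall x, v x = 0 <-> x = 0;
  av_mul : forall x y, v (x * y) = v x * v y;
  av_ultra : forall x y, v (x + y) <= Num.max (v x) (v y) }.

Definition complete (V : zmodType) (nrm : V -> RT) : Prop :=
  forall u : nat -> V,
    (forall e, 0 < e -> exists N, forall m n, (N <= m)%N -> (N <= n)%N ->
       nrm (u m - u n) < e) ->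
    exists l, forall e, 0 < e -> exists N, forall n, (N <= n)%N ->
       nrm (u n - l) < e.

Definition dense (V : zmodType) (nrm : V -> RT) (P : set V) : Prop :=
  forall x e, 0 < e -> exists2 y, P y & nrm (x - y) < e.

Definition padic_abs (p : nat) (q : rat) : RT :=
  if q == 0 then 0
  else p%:R ^ ((logn p `|denq q|)%:Z - (logn p `|numq q|)%:Z).

(* the field of p-adic numbers, as the completion of the rationals *)
Record is_Qp (p : nat) (Qp : fieldType) (v : Qp -> RT) : Prop := {
  qp_absv : is_absv v;
  qp_complete : complete v;
  qp_padic : forall q : rat, v (ratr q) = padic_abs p q;
  qp_dense : dense v (range (ratr : rat -> Qp)) }.

Definition discretely_valued (K : fieldType) (v : K -> RT) : Prop :=
  exists2 w : K, 0 < v w < 1 &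
    forall x, x != 0 -> exists n : int, v x = v w ^ n.

Record is_cdv_ext (p : nat) (Qp K : fieldType) (vp : Qp -> RT) (v : K -> RT)
    (i : {rmorphism Qp -> K}) : Prop := {
  cdv_Qp : is_Qp p vp;
  cdv_absv : is_absv v;
  cdv_ext : forall x, v (i x) = vp x;
  cdv_complete : complete v;
  cdv_discrete : discretely_valued v }.

Context (K : fieldType) (v : K -> RT).

Record is_banach (V : lmodType K) (nrm : V -> RT) : Prop := {
  bn_ge0 : forall x, 0 <= nrm x;
  bn_eq0 : forall x, nrm x = 0 <-> x = 0;
  bn_scale : forall k x, nrm (k *: x) = v k * nrm x;
  bn_ultra : forall x y, nrm (x + y) <= Num.max (nrm x) (nrm y);
  bn_complete : complete nrm }.

Definition is_banach_alg (R : algType K) (nrm : R -> RT) : Prop :=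
  is_banach nrm /\ exists C, forall x y, nrm (x * y) <= C * nrm x * nrm y.

Definition nclosure (V : zmodType) (nrm : V -> RT) (P : set V) : set V :=
  [set x | forall e, 0 < e -> exists2 y, P y & nrm (x - y) < e].

Definition bounded_linear (T V : lmodType K) (nT : T -> RT) (nV : V -> RT)
    (f : T -> V) : Prop :=
  linear f /\ exists C, forall x, nV (f x) <= C * nT x.

Definition bounded_bilinear (X Y V : lmodType K) (nX : X -> RT) (nY : Y -> RT)
    (nV : V -> RT) (b : X -> Y -> V) : Prop :=
  [/\ forall y, linear (fun x => b x y),
      forall x, linear (fun y => b x y)
    & exists C, forall x y, nV (b x y) <= C * nX x * nY y].

Definition bounded_trilinear (X Y Z V : lmodType K) (nX : X -> RT)
    (nY : Y -> RT) (nZ : Z -> RT) (nV : V -> RT) (b : X -> Y -> Z -> V) : Prop :=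
  trilinear b /\
  exists C, forall x y z, nV (b x y z) <= C * nX x * nY y * nZ z.

(* [t] exhibits the Banach space [T] as the completed (projective) tensor
   product of [X], [Y] and [Z] over [K] *)
Definition is_ctensor3 (X Y Z T : lmodType K) (nX : X -> RT) (nY : Y -> RT)
    (nZ : Z -> RT) (nT : T -> RT) (t : X -> Y -> Z -> T) : Prop :=
  bounded_trilinear nX nY nZ nT t /\
  forall (V : lmodType K) (nV : V -> RT), is_banach nV ->
  forall b : X -> Y -> Z -> V, bounded_trilinear nX nY nZ nV b ->
    exists! f : T -> V,
      bounded_linear nT nV f /\ forall x y z, f (t x y z) = b x y z.

(* [t] exhibits [T] as the completed tensor product of [X] and [Y] over [S],
   where [S] acts on [X] on the right via [rX] and on [Y] on the left via [lY] *)
Definition is_ctensor (S : Type) (X Y T : lmodType K) (nX : X -> RT)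
    (nY : Y -> RT) (nT : T -> RT) (rX : X -> S -> X) (lY : S -> Y -> Y)
    (t : X -> Y -> T) : Prop :=
  let balanced (V : lmodType K) (b : X -> Y -> V) :=
    forall x s y, b (rX x s) y = b x (lY s y) in
  [/\ bounded_bilinear nX nY nT t, balanced T t &
    forall (V : lmodType K) (nV : V -> RT), is_banach nV ->
    forall b : X -> Y -> V, bounded_bilinear nX nY nV b -> balanced V b ->
      exists! f : T -> V,
        bounded_linear nT nV f /\ forall x y, f (t x y) = b x y].

Definition quot_norm (A : nzRingType) (M : lmodType A) (N : submod M)
    (nM : M -> RT) (q : quotmod N) : RT :=
  inf [set nM x | x in [set x | \pi_(quotmod N) x = q]].

(* Everything here is relative to a subspace [P] of [V] stable under [D]. *)
Section Weights.
Context (V : lmodType K) (nrm : V -> RT) (D : V -> V) (P : set V).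

Definition weight_space (l : K) : set V :=
  [set x | P x /\ exists N, forall n, (N <= n)%N ->
     iter n (fun y => D y - l *: y) x = 0].

Definition weights : set K :=
  [set l | exists2 x, weight_space l x & x != 0].

Definition ws_part : set V :=
  [set x | exists (s : {fset K}) (c : K -> V),
     (forall l, l \in s -> weights l /\ weight_space l (c l)) /\
     x = \sum_(l <- s) c l].

(* [x] is the sum of the family [c l], [l] in [I]: convergence along the
   finite subsets of [I] *)
Definition sums_to (I : set K) (c : K -> V) (x : V) : Prop :=
  forall e, 0 < e -> exists2 s0 : {fset K}, [set` s0] `<=` I &
    forall s : {fset K}, [set` s0] `<=` [set` s] -> [set` s] `<=` I ->
      nrm (x - \sum_(l <- s) c l) < e.

Definition weight_dec (I : set K) : Prop :=
  I `<=` weights /\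
  forall x, P x -> exists c : K -> V,
    (forall l, I l -> weight_space l (c l)) /\ sums_to I c x.

Definition has_weight_dec : Prop := exists I, weight_dec I.

Definition has_ss_weight_dec : Prop :=
  exists I, weight_dec I /\ forall l x, I l -> weight_space l x -> D x = l *: x.
End Weights.

Section Banach.
Context (cR : algType K) (nR : cR -> RT).
Context (R : subalg cR) (gr : int -> submod (salg R)).
Context (A B H : subalg (salg R)) (d : salg R).

Definition im (P : set (salg R)) : set cR := val @` P.

Record banach_tridec (cA cB : subalg cR) : Prop := {
  btd_dense : dense nR [set` R];
  btd_alg : alg_tridec gr A B H d;
  btd_cA : [set` cA] = nclosure nR (im [set` A]);
  btd_cB : [set` cB] = nclosure nR (im [set` B]);
  btd_tensor : is_ctensor3
    (fun a : salg cA => nR (val a)) (fun h : salg H => nR (val (val h)))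
    (fun b : salg cB => nR (val b)) nR
    (fun a h b => val a * val (val h) * val b);
  btd_ssA : has_ss_weight_dec nR (ad (val d)) [set` cA];
  btd_ssB : has_ss_weight_dec nR (ad (val d)) [set` cB];
  btd_wsA : ws_part (ad (val d)) [set` cA] = im [set` A];
  btd_wsB : ws_part (ad (val d)) [set` cB] = im [set` B] }.

(* The completed tensor product of [cB] and [H], seen inside [cR]: the completion
   of [B * H = H * B], which is a subalgebra of [cR]. *)
Definition is_cBH (cBH : subalg cR) : Prop :=
  [set` cBH] = nclosure nR (im (prod_span [set` B] [set` H])).

Context (cBH : subalg cR).

(* the subspace spanned by the products of [H] with the homogeneous elements of
   [B] of negative degree, that is, of positive degree for the grading [B^n] *)
Definition BHpos : set (salg R) :=
  prod_span [set b | b \in B /\ exists2 n : int, n < 0 & b \in gr n] [set` H].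

(* the two-sided ideal of [cBH] generated by [BHpos] *)
Definition cBHpos_pred : {pred (salg cBH)^o} := fun x =>
  `[< forall I : submod (salg cBH)^o,
      (forall y z : salg cBH, y \in I -> y * z \in I) ->
      (forall y : salg cBH, im BHpos (val y) -> y \in I) -> x \in I >].
Fact cBHpos_closed : submod_closed cBHpos_pred.
Proof.
split=> [|a x y /asboolP xI /asboolP yI]; apply/asboolP => I IM IP.
  exact: rpred0.
by rewrite rpredD ?rpredZ ?xI ?yI.
Qed.
Definition cBHpos : submod (salg cBH)^o := Submod cBHpos_closed.

(* [q * h] in [cBH / cBHpos]; [insubd] is harmless as [H] is inside [cBH] *)
Definition cBHquot_ract (q : quotmod cBHpos) (h : salg H) : quotmod cBHpos :=
  \pi_(quotmod cBHpos) (insubd 0 (val (repr q) * val (val h)) : salg cBH).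

(* [X] is the completed tensor product of [cBH / cBHpos] and [W] over [H], with
   its [cBH]-module structure; the norm on the finite-dimensional space [W] is
   immaterial. *)
Definition is_inflation (W : lmodType (salg H)) (X : lmodType (salg cBH))
    (nX : vsp K X -> RT) : Prop :=
  exists (nW : vsp K W -> RT) (t : quotmod cBHpos -> W -> X),
    [/\ is_banach nW, is_banach nX,
        is_ctensor (S := salg H) (X := vsp K (quotmod cBHpos)) (Y := vsp K W)
          (T := vsp K X) (quot_norm (fun x : (salg cBH)^o => nR (val x)))
          nW nX cBHquot_ract (fun h w => h *: (w : W)) t
      & forall (s : salg cBH) q w, t (s *: q) w = s *: t q w].

Definition is_verma (W : lmodType (salg H)) (D : lmodType cR) : Prop :=
  exists (X : lmodType (salg cBH)) (nX : vsp K X -> RT) (nD : vsp K D -> RT)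
         (t : cR -> X -> D),
    [/\ is_inflation W nX, is_banach nD,
        is_ctensor (S := salg cBH) (X := cR) (Y := vsp K X) (T := vsp K D)
          nR nX nD (fun r s => r * val s) (fun s x => s *: (x : X)) t
      & forall (r r' : cR) x, t (r * r') x = r *: t r' x].

(* [L] is the unique simple quotient of the analytic Verma module of [W] *)
Definition is_simple_head (W : lmodType (salg H)) (L : lmodType cR) : Prop :=
  exists D : lmodType cR, is_verma W D /\
  simple_mod L /\
  exists f : {linear D -> L}, (forall y, exists x, f x = y) /\
    forall (L' : lmodType cR) (f' : {linear D -> L'}), simple_mod L' ->
      (forall y, exists x, f' x = y) -> forall x, f' x = 0 <-> f x = 0.

(* A finitely generated module over the noetherian Banach algebra [cR] has, up
   to equivalence, a unique norm of this kind; it defines the canonical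
   topology. *)
Definition canonical_norm (M : lmodType cR) (nM : vsp K M -> RT) : Prop :=
  is_banach nM /\
  exists C, forall (r : cR) (m : M), nM (r *: m) <= C * nR r * nM m.

Record in_catO (cA : subalg cR) (M : lmodType cR) : Prop := {
  catO_fg : fin_gen [set: M];
  catO_fin : fin_gen [set: restrict (val : {rmorphism salg cA -> cR}) M];
  catO_wd : exists2 nM : vsp K M -> RT, canonical_norm nM &
    has_weight_dec nM (fun m => val d *: (m : M)) setT }.

End Banach.
End Valued.

(* Main.v *)
Require Import Defs.
From HB Require Import structures.
From mathcomp Require Import all_boot all_order all_algebra.
From mathcomp Require Import finmap generic_quotient ring_quotient.
From mathcomp Require Import boolp classical_sets reals.
From mathcomp Require Import ssrAC ring lra zify.

Set Implicit Arguments.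
Unset Strict Implicit.
Unset Printing Implicit Defensive.
Import Order.TTheory GRing.Theory Num.Theory.
Local Open Scope classical_set_scope.
Local Open Scope ring_scope.
Local Open Scope quotient_scope.

(** A module in the category is generated over [cA], the completion of [A], by
   finitely many generalised weight vectors: a small perturbation of a finite
   family of generators still generates ([perturb]), so that the generators may
   be replaced by partial sums of their weight decompositions
   ([weight_generated]). As the homogeneous elements of [cA] have natural
   numbers as weights, every vector is a convergent sum of weight components,
   with weights of the form [lam i + n], [lam i] being the weights of the
   generators. Since the natural numbers are precompact in [K], so is this set
   of weights.

   Submodules are closed because [cA] is noetherian and the module is finite
   over it ([submod_nclosed]). A closed submodule contains the weight components
   of its elements ([component_closed]): polynomials in [d] that approximate, in
   the manner of Kaplansky, the indicator function of one weight on a precompact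
   set ([kaplansky]) approximate the projection to that component. Hence
   submodules stay in the category ([sub_catO]).

   Finite length: for submodules [U1] strictly contained in [U2], lowering the
   weight as much as possible in [U2] outside [U1] leads to a vector that is
   modulo [U1] an eigenvector of [d] killed by the negative part of [B]
   ([highest_vector]). The tensor decomposition of the graded algebra shows that
   modulo the left ideal generated by the negative part of [B] the element [d] is
   in [H] ([d_decomp]), a finite-dimensional algebra, so that the weights of such
   vectors are among finitely many values. As weight spaces are
   finite-dimensional, one finite-dimensional space distinguishes [U1] from [U2]
   for all such pairs ([separating_span]), and the dimension of the trace on it
   bounds the length of chains ([module_series]).

   Factors: a composition factor [L] contains a highest weight vector, hence a
   simple [H]-module [W] of such vectors ([highest_simple]). The completion of
   [B H] is the sum of [H] and of its ideal generated by the negative part of [B]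
   ([cBH_split]), so that [W], on which this ideal acts by zero, is its own
   inflation ([inflation]). The Verma module is built as the quotient of a finite
   free module by the relations that hold under every bounded balanced map
   ([verma_ctensor]); by the decomposition of [cR] it is generated over [cA] by
   [W] ([verma_gen]), all of whose elements have the same weight. It maps onto
   [L], and its simple quotients have the same kernel, because no proper submodule
   has an element with a nonzero component of that weight ([kernel_sub],
   [simple_head_model]). *)

(** * Ultrametric norms and absolute values *)

(** Bernoulli's inequality for [r^-1] makes its powers tend to infinity. *)
Lemma geo_small (RT : realType) (r e : RT) : 0 <= r < 1 -> 0 < e ->
  exists n, r ^+ n < e.
Proof.
move=> /andP[r0 r1] e0.
have [->|rn0] := eqVneq r 0; first by exists 1%N; rewrite expr1.
have rp : 0 < r by rewrite lt_neqAle eq_sym rn0.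
pose h := r^-1 - 1.
have hp : 0 < h by rewrite subr_gt0 invf_gt1.
have bern n : 1 + h *+ n <= r^-1 ^+ n.
  elim: n => [|n IH]; first by rewrite mulr0n addr0 expr0.
  rewrite exprS; have -> : r^-1 = 1 + h by rewrite /h addrC subrK.
  have IH' : 1 + h *+ n <= (1 + h) ^+ n.
    by have <- : r^-1 = 1 + h by rewrite /h addrC subrK.
  apply: (@le_trans _ _ ((1 + h) * (1 + h *+ n))); last first.
    by rewrite ler_wpM2l // addr_ge0 ?ler01 // ltW.
  rewrite mulrS; have : 0 <= h *+ n by rewrite mulrn_wge0 // ltW.
  by nra.
have [n hn] : exists n, e^-1 < h *+ n.
  exists (Num.bound (e^-1 / h)); rewrite -mulr_natr mulrC -ltr_pdivrMr //.
  by rewrite archi_boundP // divr_ge0 ?invr_ge0 ?ltW.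
exists n; rewrite -[_ ^+ _]invrK -[e]invrK ltf_pV2 ?posrE ?invr_gt0 ?exprn_gt0 //.
rewrite -exprVn; apply: lt_le_trans (bern n); apply: lt_le_trans hn _.
by rewrite lerDr ler01.
Qed.

Lemma geo_small_mul (RT : realType) (c e : RT) : 0 <= c -> 0 < e ->
  exists N, forall k, (N <= k)%N -> c * 2^-1 ^+ k < e.
Proof.
move=> c0 e0.
have [N hN] : exists N, (2^-1 : RT) ^+ N < e / (c + 1).
  apply: geo_small; last by rewrite divr_gt0 // ltr_wpDl.
  by rewrite invr_ge0 ler0n /= invf_lt1 ?ltr0n // ltr1n.
exists N => k Nk; have c1 : 0 < c + 1 by rewrite ltr_wpDl.
apply: (@le_lt_trans _ _ ((c + 1) * 2^-1 ^+ N)); last first.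
  by rewrite mulrC -ltr_pdivlMr.
apply: ler_pM => //; first by rewrite exprn_ge0 // invr_ge0 ler0n.
  by rewrite lerDl ler01.
apply: ler_wiXn2l => //; first by rewrite invr_ge0 ler0n.
by rewrite invf_le1 ?ltr0n // ler1n.
Qed.

(** The properties of a norm that make no mention of scalars, so that the
   same lemmas serve for the field, the algebra and modules over various
   rings. *)
Record ultranorm (RT : realType) (V : zmodType) (n : V -> RT) : Prop := {
  un_ge0 : forall x, 0 <= n x;
  un_eq0 : forall x, n x = 0 <-> x = 0;
  un_opp : forall x, n (- x) = n x;
  un_add : forall x y, n (x + y) <= Num.max (n x) (n y) }.

Definition tends (RT : realType) (V : zmodType) (n : V -> RT)
    (u : nat -> V) (l : V) : Prop :=
  forall e, 0 < e -> exists N, forall k, (N <= k)%N -> n (u k - l) < e.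

Definition nclosed (RT : realType) (V : zmodType) (n : V -> RT)
    (P : set V) : Prop := forall x, nclosure n P x -> P x.

Section Ultra.
Context (RT : realType) (V : zmodType) (n : V -> RT) (hn : ultranorm n).

Lemma un0 : n 0 = 0. Proof. exact/(un_eq0 hn). Qed.
Lemma unC x y : n (x - y) = n (y - x).
Proof. by rewrite -opprB (un_opp hn). Qed.
Lemma unD_le e x y : n x <= e -> n y <= e -> n (x + y) <= e.
Proof. by move=> xe ye; apply: le_trans (un_add hn _ _) _; rewrite ge_max xe. Qed.
Lemma unD_lt e x y : n x < e -> n y < e -> n (x + y) < e.
Proof. by move=> xe ye; apply: le_lt_trans (un_add hn _ _) _; rewrite gt_max xe. Qed.
Lemma unB_le e x y : n x <= e -> n y <= e -> n (x - y) <= e.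
Proof. by move=> xe ye; apply: unD_le; rewrite ?(un_opp hn). Qed.
Lemma unB_lt e x y : n x < e -> n y < e -> n (x - y) < e.
Proof. by move=> xe ye; apply: unD_lt; rewrite ?(un_opp hn). Qed.
Lemma un_gt0 x : x != 0 -> 0 < n x.
Proof.
by move=> x0; rewrite lt_neqAle un_ge0 // andbT eq_sym; apply: contraNneq x0 => /(un_eq0 hn) ->.
Qed.
Lemma un_sum_le (I : Type) (r : seq I) (P : pred I) (F : I -> V) e : 0 <= e ->
  (forall i, P i -> n (F i) <= e) -> n (\sum_(i <- r | P i) F i) <= e.
Proof.
move=> e0 hF; elim/big_rec: _ => [|i x Pi xe]; first by rewrite un0.
by apply: unD_le => //; exact: hF.
Qed.
Lemma un_sum_lt (I : Type) (r : seq I) (P : pred I) (F : I -> V) e : 0 < e ->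
  (forall i, P i -> n (F i) < e) -> n (\sum_(i <- r | P i) F i) < e.
Proof.
move=> e0 hF; elim/big_rec: _ => [|i x Pi xe]; first by rewrite un0.
by apply: unD_lt => //; exact: hF.
Qed.
Lemma un_small0 x : (forall e, 0 < e -> n x < e) -> x = 0.
Proof.
move=> hx; apply/eqP/negP => /negP x0; have := hx _ (un_gt0 x0).
by rewrite ltxx.
Qed.

Lemma tends_le u l e : tends n u l -> (forall k, n (u k) <= e) -> n l <= e.
Proof.
move=> ul ue; rewrite leNgt; apply/negP => el.
have lp : 0 < n l by apply: le_lt_trans el; exact: le_trans (un_ge0 hn (u 0%N)) (ue _).
have [N hN] := ul _ lp; have := hN N (leqnn _).
have := un_add hn (u N) (- (u N - l)).
rewrite (un_opp hn) opprB addrCA subrr addr0 => h h2.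
have : n l < n l by apply: le_lt_trans h _; rewrite gt_max h2 andbT (le_lt_trans (ue N)).
by rewrite ltxx.
Qed.

(** A telescoping sum is at most as large as its largest term. *)
Lemma steps_cauchy u e N : (forall k, (N <= k)%N -> n (u k.+1 - u k) < e) ->
  0 < e -> forall k m, (N <= k)%N -> (N <= m)%N -> n (u k - u m) < e.
Proof.
move=> h e0.
suff h1 k : (N <= k)%N -> n (u k - u N) < e.
  move=> k m Nk Nm; have -> : u k - u m = (u k - u N) - (u m - u N).
    by rewrite opprB addrA subrK.
  by apply: unB_lt; exact: h1.
move=> /subnKC <-; elim: (k - N)%N => [|i IH]; first by rewrite addn0 subrr un0.
rewrite addnS; have -> : u (N + i).+1 - u N =
    (u (N + i).+1 - u (N + i)%N) + (u (N + i)%N - u N) by rewrite addrA subrK.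
by apply: unD_lt => //; apply: h; exact: leq_addr.
Qed.

Lemma complete_steps u : complete n ->
  (forall e, 0 < e -> exists N, forall k, (N <= k)%N -> n (u k.+1 - u k) < e) ->
  exists l, tends n u l.
Proof.
move=> hc h; apply: hc => e e0; have [N hN] := h e e0.
by exists N => m k Nm Nk; apply: (steps_cauchy hN).
Qed.

Lemma nclosure_sub (P : set V) x : P x -> nclosure n P x.
Proof. by move=> Px e e0; exists x => //; rewrite subrr un0. Qed.

Lemma tends_closed (P : set V) u l : nclosed n P -> (forall k, P (u k)) ->
  tends n u l -> P l.
Proof.
move=> cP Pu ul; apply: cP => e e0; have [N hN] := ul e e0.
by exists (u N) => //; rewrite unC hN.
Qed.

Lemma nclosure_tends (P : set V) l : nclosure n P l ->
  exists2 u, (forall k, P (u k)) & tends n u l.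
Proof.
move=> hl; have /choice[u hu] : forall k : nat, exists y, P y /\ n (l - y) < 2^-1 ^+ k.
  move=> k; have [|y Py ly] := hl (2^-1 ^+ k); last by exists y.
  by rewrite exprn_gt0 // invr_gt0 ltr0n.
exists u; first by move=> k; case: (hu k).
move=> e e0; have [N hN] := @geo_small_mul RT 1 e ler01 e0.
exists N => k Nk; rewrite unC; apply: lt_trans (hu k).2 _.
by have := hN k Nk; rewrite mul1r.
Qed.
End Ultra.

Section Absv.
Context (RT : realType) (K : fieldType) (v : K -> RT) (hv : is_absv v).

Lemma av0 : v 0 = 0. Proof. exact/(av_eq0 hv). Qed.
Lemma av_neq0 x : x != 0 -> 0 < v x.
Proof.
by move=> x0; rewrite lt_neqAle av_ge0 // andbT eq_sym; apply: contraNneq x0 => /(av_eq0 hv) ->.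
Qed.
Lemma av1 : v 1 = 1.
Proof.
have h : v 1 * v 1 = v 1 * 1 by rewrite -av_mul // !mulr1.
by apply: mulfI h; rewrite gt_eqF // av_neq0 ?oner_eq0.
Qed.
Lemma avX x k : v (x ^+ k) = v x ^+ k.
Proof. by elim: k => [|k IH]; rewrite ?expr0 ?av1 // !exprS av_mul // IH. Qed.
Lemma avN x : v (- x) = v x.
Proof.
have h1 : v (-1) = 1.
  apply/eqP; rewrite -(@pexpr_eq1 _ _ 2) ?av_ge0 //.
  by rewrite -avX sqrrN expr1n av1.
by rewrite -mulN1r av_mul // h1 mul1r.
Qed.
Lemma absv_ultra : ultranorm v.
Proof.
split; [exact: av_ge0|exact: av_eq0|exact: avN|exact: av_ultra].
Qed.
Lemma avV x : v x^-1 = (v x)^-1.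
Proof.
have [->|x0] := eqVneq x 0; first by rewrite invr0 av0 invr0.
apply: (mulfI (_ : v x != 0)); first by rewrite gt_eqF // av_neq0.
by rewrite -av_mul // !divff ?av1 // gt_eqF // av_neq0.
Qed.
Lemma av_nat k : v k%:R <= 1.
Proof.
elim: k => [|k IH]; first by rewrite av0 ler01.
by rewrite -addn1 natrD (unD_le absv_ultra) // av1.
Qed.

Lemma banach_ultra (V : lmodType K) (n : V -> RT) : is_banach v n -> ultranorm n.
Proof.
case=> h1 h2 h3 h4 _; split=> // x.
by rewrite -scaleN1r h3 avN av1 mul1r.
Qed.
End Absv.

(** * The open mapping theorem for finitely generated modules *)

Section Approx.
Context (RT : realType) (S : nzRingType) (nS : S -> RT).
Context (hS : ultranorm nS) (cS : complete nS).
Context (M : lmodType S) (nM : M -> RT) (hM : ultranorm nM).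
Context (CM : RT) (CM0 : 0 < CM).
Context (hCM : forall s m, nM (s *: m) <= CM * nS s * nM m).
Context (T : finType).

(** One step of approximation with a fixed loss in the coefficients is enough:
   the errors are corrected one after the other, and the corrections form a
   geometric series. *)
Lemma succ_approx (g : T -> M) (C : RT) : 0 <= C ->
  (forall y, exists a : T -> S, (forall i, nS (a i) <= C * nM y) /\
     nM (y - \sum_i a i *: g i) <= nM y / 2) ->
  forall y, exists a : T -> S, (forall i, nS (a i) <= C * nM y) /\
     y = \sum_i a i *: g i.
Proof.
move=> C0 /choice[f hf] y.
pose step z := z - \sum_i f z i *: g i.
pose Y k := iter k step y.
have Yk k : nM (Y k) <= nM y * 2^-1 ^+ k.
  elim: k => [|k IH]; first by rewrite expr0 mulr1.
  apply: le_trans (hf (Y k)).2 _; rewrite exprSr mulrA.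
  by rewrite ler_wpM2r // invr_ge0 ler0n.
pose A k i := \sum_(j < k) f (Y j) i.
have A1 k i : A k.+1 i - A k i = f (Y k) i.
  by rewrite /A big_ord_recr /= addrAC subrr add0r.
have fY k i : nS (f (Y k) i) <= C * nM y * 2^-1 ^+ k.
  by apply: le_trans ((hf (Y k)).1 i) _; rewrite -mulrA ler_wpM2l.
have half01 k : (2^-1 : RT) ^+ k <= 1.
  by rewrite exprn_ile1 // ?invr_ge0 ?ler0n // invf_le1 ?ltr0n // ler1n.
have Cy0 : 0 <= C * nM y by rewrite mulr_ge0 // un_ge0.
have Ale k i : nS (A k i) <= C * nM y.
  apply: (un_sum_le hS) => // j _; apply: le_trans (fY _ _) _.
  by rewrite ler_piMr.
have /choice[a ha] i : exists a, tends nS (A^~ i) a.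
  apply: (complete_steps hS cS) => e e0.
  have [N hN] := geo_small_mul Cy0 e0; exists N => k Nk.
  by rewrite A1; apply: le_lt_trans (fY _ _) _; exact: hN.
exists a; split=> [i|]; first exact: (tends_le hS (ha i) (fun k => Ale k i)).
have YE k : Y k = y - \sum_i A k i *: g i.
  elim: k => [|k IH].
    by rewrite big1 ?subr0 // => i _; rewrite /A big_ord0 scale0r.
  rewrite /Y iterS -/(Y k) {1}/step {1}IH -addrA -opprD -big_split /=.
  congr (_ - _); apply: eq_bigr => i _.
  by rewrite -scalerDl -A1 addrC subrK.
apply/eqP; rewrite -subr_eq0; apply/eqP; apply: (un_small0 hM) => e e0.
pose G := \sum_i nM (g i) + 1.
have Gi i : nM (g i) <= G.
  rewrite /G (bigD1 i) //= -addrA lerDl addr_ge0 ?ler01 //.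
  by apply: sumr_ge0 => j _; exact: un_ge0.
have G0 : 0 < G.
  by rewrite ltr_wpDl ?ltr01 //; apply: sumr_ge0 => j _; exact: un_ge0.
have /choice[N hN] i := ha i (e / (CM * G)) (divr_gt0 e0 (mulr_gt0 CM0 G0)).
have [N' hN'] := geo_small_mul (un_ge0 hM y) e0.
pose k := maxn N' (\max_i N i).
have -> : y - \sum_i a i *: g i = Y k + \sum_i (A k i - a i) *: g i.
  under [in RHS]eq_bigr do rewrite scalerBl.
  by rewrite sumrB YE addrA subrK.
apply: (unD_lt hM).
  by apply: le_lt_trans (Yk _) _; apply: hN'; exact: leq_maxl.
apply: (un_sum_lt hM) => // i _; apply: le_lt_trans (hCM _ _) _.
have h : nS (A k i - a i) < e / (CM * G).
  by apply: hN; rewrite /k leq_max (leq_bigmax i) orbT.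
apply: (@le_lt_trans _ _ (CM * nS (A k i - a i) * G)).
  by rewrite ler_wpM2l // mulr_ge0 ?(ltW CM0) ?un_ge0.
by rewrite mulrAC mulrC -ltr_pdivlMr ?mulr_gt0.
Qed.

(** Replacing [g] by [g'] in an expansion makes an error of at most half the
   vector, which successive approximation corrects. *)
Lemma perturb (g g' : T -> M) (C : RT) : 0 <= C ->
  (forall y, exists a : T -> S, (forall i, nS (a i) <= C * nM y) /\
     y = \sum_i a i *: g i) ->
  (forall i, CM * C * nM (g i - g' i) <= 2^-1) ->
  forall y, exists a : T -> S, (forall i, nS (a i) <= C * nM y) /\
     y = \sum_i a i *: g' i.
Proof.
move=> C0 hg hgg'; apply: succ_approx => // y.
have [a [ha ya]] := hg y; exists a; split=> //.
rewrite {1}ya -sumrB; apply: (un_sum_le hM) => [|i _].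
  by rewrite divr_ge0 ?ler0n ?(un_ge0 hM).
rewrite -scalerBr; apply: le_trans (hCM _ _) _.
apply: (@le_trans _ _ (CM * (C * nM y) * nM (g i - g' i))).
  by rewrite ler_wpM2r ?un_ge0 // ler_wpM2l // ltW.
by rewrite mulrA mulrAC mulrC ler_wpM2l ?un_ge0.
Qed.
End Approx.

Section Baire.
Context (RT : realType) (V : zmodType) (n : V -> RT).
Context (hn : ultranorm n) (cn : complete n).

(** Otherwise there are balls inside one another whose radii tend to zero,
   the [k]-th one disjoint from [G k], and their common point lies in no [G
   k]. *)
Lemma baire (G : nat -> set V) : (forall x, exists k, G k x) ->
  exists k x0 r, 0 < r /\ forall x, n (x - x0) < r -> nclosure n (G k) x.
Proof.
move=> hG; apply: contrapT => hno.
have step (k : nat) (p : V * RT) : exists q : V * RT, 0 < p.2 ->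
  [/\ 0 < q.2, q.2 <= p.2 / 2, n (q.1 - p.1) < p.2 &
     forall y, n (y - q.1) < q.2 -> ~ G k y].
  case: p => x r /=; have [r0|r0] := ltP 0 r; last first.
    by exists (x, r).
  have [y [yr hy]] : exists y, n (y - x) < r /\ ~ nclosure n (G k) y.
    apply: contrapT => h; apply: hno; exists k, x, r; split=> // y yr.
    by apply: contrapT => hy; apply: h; exists y.
  have [e [e0 he]] : exists e, 0 < e /\ forall z, G k z -> ~ n (y - z) < e.
    apply: contrapT => h; apply: hy => e e0.
    apply: contrapT => h2; apply: h; exists e; split=> // z Gz yz.
    by apply: h2; exists z.
  exists (y, Num.min e (r / 2)) => _; split => //=.
  - by rewrite lt_min e0 divr_gt0.
  - by rewrite ge_min lexx orbT.
  by move=> z; rewrite lt_min unC // => /andP[h _] Gz; exact: he Gz h.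
have /choice[f hf] (kp : nat * (V * RT)) := step kp.1 kp.2.
pose s := fix s k := if k is k'.+1 then f (k', s k') else (0, 1) : V * RT.
have s0 k : 0 < (s k).2.
  elim: k => [|k IH] /=; first exact: ltr01.
  by case: (hf (k, s k) IH).
have hs k := hf (k, s k) (s0 k).
have sle k : (s k).2 <= 2^-1 ^+ k.
  elim: k => [|k IH]; first by rewrite expr0.
  case: (hs k) => _ h _ _; apply: le_trans h _.
  by rewrite exprSr ler_wpM2r // invr_ge0 ler0n.
have smon k i : (s (k + i)%N).2 <= (s k).2.
  elim: i => [|i IH]; rewrite ?addn0 // addnS; case: (hs (k + i)%N) => _ h _ _.
  apply: le_trans h _; apply: le_trans IH.
  by have := s0 (k + i)%N; lra.
have sd k m : (k <= m)%N -> n ((s m.+1).1 - (s m).1) < (s k).2.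
  move=> km; case: (hs m) => _ _ h _; apply: lt_le_trans h _.
  by rewrite -(subnKC km) smon.
have [l hl] : exists l, tends n (fun k => (s k).1) l.
  apply: complete_steps => // e e0.
  have [N hN] := geo_small_mul (ler01 : 0 <= 1 :> RT) e0.
  exists N => k Nk; apply: lt_trans (sd k k (leqnn _)) _.
  by apply: le_lt_trans (sle k) _; have := hN _ Nk; rewrite mul1r.
have [k Gl] := hG l; case: (hs k) => _ _ _ /(_ l); apply => //.
have [N hN] := hl _ (s0 k.+1).
pose m := maxn N k.+1.
have -> : l - (s k.+1).1 = ((s m).1 - (s k.+1).1) - ((s m).1 - l).
  by rewrite opprB [RHS]addrC addrA subrK.
apply: unB_lt => //; last by apply: hN; exact: leq_maxl.
apply: (@steps_cauchy _ _ _ hn (fun k => (s k).1) _ k.+1 _ (s0 k.+1)) => //.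
  by move=> j kj; exact: (sd k.+1 j kj).
exact: leq_maxr.
Qed.
End Baire.

Section OpenGen.
Context (RT : realType) (K : fieldType) (v : K -> RT) (hv : is_absv v).
Context (w : K) (hw : 0 < v w < 1).
Context (S : algType K) (nS : S -> RT) (hS : is_banach v nS).
Context (M : lmodType S) (nM : M -> RT) (hM : ultranorm nM) (cM : complete nM).
Context (scM : forall (k : K) m, nM (k%:A *: m) = v k * nM m).
Context (CM : RT) (CM0 : 0 < CM).
Context (hCM : forall s m, nM (s *: m) <= CM * nS s * nM m).

(** Consecutive powers of [w] have a fixed ratio, so that a vector can be
   scaled into a ball without becoming much smaller than needed. *)
Lemma scale_into (r : RT) : 0 < r -> exists D, 0 < D /\ forall y, y != 0 ->
  exists k : K, [/\ k != 0, nM (k%:A *: y) < r & v k^-1 <= D * nM y].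
Proof.
move=> r0; have /andP[w0 w1] := hw.
exists ((v w * r)^-1); split; first by rewrite invr_gt0 mulr_gt0.
move=> y y0; have wn0 : w != 0 by apply: contraTneq w0 => ->; rewrite av0 ?ltxx.
have yp := un_gt0 hM y0.
have P1 : exists N, nM y < r * v w ^- N.
  have [N hN] : exists N, v w ^+ N < r / nM y.
    by apply: geo_small; rewrite ?(ltW w0) ?divr_gt0.
  exists N; rewrite ltr_pdivlMr ?exprn_gt0 //.
  by rewrite mulrC -ltr_pdivlMr.
have P2 : exists N, r * v w ^+ N <= nM y.
  have [N hN] : exists N, v w ^+ N < nM y / r.
    by apply: geo_small; rewrite ?(ltW w0) ?divr_gt0.
  by exists N; rewrite mulrC -ler_pdivlMr // ltW.
have [N1 hN1] := P1; have [N2 hN2] := P2.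
(* The scalar is [w ^ (j - N2)] for the least [j] that brings [y] into the ball. *)
pose Q j := nM y * v w ^+ j < r * v w ^+ N2.
have exQ : exists j, Q j.
  exists (N1 + N2)%N; rewrite /Q exprD mulrA ltr_pM2r ?exprn_gt0 //.
  by rewrite -ltr_pdivlMr ?exprn_gt0.
case: (ex_minnP exQ) => j Qj jmin.
have j0 : (0 < j)%N.
  by rewrite lt0n; apply: contraTneq Qj => ->; rewrite /Q expr0 mulr1 -leNgt.
have Qj1 : r * v w ^+ N2 <= nM y * v w ^+ j.-1.
  rewrite leNgt; apply/negP => /jmin; rewrite leqNgt; case/negP.
  by rewrite prednK.
have vk : v (w ^+ j / w ^+ N2) = v w ^+ j / v w ^+ N2.
  by rewrite (av_mul hv) (avV hv) !(avX hv).
exists (w ^+ j / w ^+ N2); split.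
- by rewrite mulf_neq0 ?invr_eq0 ?expf_neq0.
- by rewrite scM vk mulrAC ltr_pdivrMr ?exprn_gt0 // mulrC.
rewrite (avV hv) vk invf_div ler_pdivrMr ?exprn_gt0 //.
rewrite -(prednK j0) exprSr.
rewrite [leRHS](_ : _ = r^-1 * (nM y * v w ^+ j.-1)).
  by rewrite mulrC ler_pdivlMr // mulrC.
by field; rewrite !gt_eqF.
Qed.

(** The open mapping theorem. By Baire's theorem, the vectors with
   coefficients bounded by some [k] are dense in a ball around 0; scaling
   gives an approximation of every vector, and successive approximation
   makes it exact. *)
Lemma open_gen (T : finType) (g : T -> M) :
  (forall y, exists a : T -> S, y = \sum_i a i *: g i) ->
  exists C, 0 <= C /\ forall y, exists a : T -> S,
    (forall i, nS (a i) <= C * nM y) /\ y = \sum_i a i *: g i.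
Proof.
move=> hg; have uS := banach_ultra hv hS.
pose G k : set M := [set y | exists a : T -> S,
  (forall i, nS (a i) <= k%:R) /\ y = \sum_i a i *: g i].
have GB k x y : G k x -> G k y -> G k (x - y).
  move=> [a [ha ->]] [b [hb ->]]; exists (fun i => a i - b i).
  split=> [i|]; first exact: unB_le.
  by rewrite -sumrB; apply: eq_bigr => i _; rewrite scalerBl.
have [k [x0 [r [r0 hx0]]]] : exists k x0 r, 0 < r /\
    forall x, nM (x - x0) < r -> nclosure nM (G k) x.
  apply: baire => // y; have [a ->] := hg y.
  exists (\max_i Num.bound (nS (a i))), a; split=> // i.
  apply: le_trans (ltW (archi_boundP (un_ge0 uS _))) _.
  by rewrite ler_nat (leq_bigmax i).
have ball0 x : nM x < r -> nclosure nM (G k) x.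
  move=> xr e e0.
  have hx1 : nM (x + x0 - x0) < r by rewrite addrK.
  have hx2 : nM (x0 - x0) < r by rewrite subrr un0.
  have [y1 Gy1 h1] := hx0 _ hx1 _ e0.
  have [y2 Gy2 h2] := hx0 _ hx2 _ e0.
  exists (y1 - y2); first exact: GB.
  have -> : x - (y1 - y2) = (x + x0 - y1) - (x0 - y2).
  by rewrite !opprB [RHS](AC (3*2) ((1*(4*3))*(2*5))) /= subrr addr0.
  exact: unB_lt.
have [D [D0 hD]] := scale_into r0.
exists (D * k%:R); split; first by rewrite mulr_ge0 // ltW.
apply: (succ_approx uS (bn_complete hS) hM CM0 hCM) => [|y].
  by rewrite mulr_ge0 // ltW.
have [->|y0] := eqVneq y 0.
  exists (fun=> 0); split=> [i|]; first by rewrite (un0 uS) (un0 hM) mulr0.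
  by rewrite big1 ?subrr ?(un0 hM) ?mul0r // => i _; rewrite scale0r.
have [c [c0 cr cD]] := hD y y0.
have yp := un_gt0 hM y0.
have hc2 : 0 < v c * nM y / 2 by rewrite !mulr_gt0 ?invr_gt0 ?ltr0n ?(av_neq0 hv).
have [y' [a [ha y'a]] hy'] := ball0 _ cr _ hc2.
exists (fun i => c^-1 *: a i); split=> [i|].
  rewrite (bn_scale hS) mulrAC; apply: ler_pM => //; rewrite ?av_ge0 ?un_ge0 //.
have -> : y - \sum_i (c^-1 *: a i) *: g i = c^-1%:A *: (c%:A *: y - y').
  rewrite scalerBr scalerA -scalerAl mul1r scalerA mulVf // !scale1r y'a.
  rewrite scaler_sumr; congr (_ - _); apply: eq_bigr => i _.
  by rewrite scalerA -scalerAl mul1r.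
rewrite scM avV // mulrC ler_pdivrMr ?av_neq0 // ltW //.
by rewrite mulrAC [nM y * _]mulrC.
Qed.
End OpenGen.

(** * Submodules over a noetherian Banach algebra are closed *)

Section MkSub.
Context (S : nzRingType) (M : lmodType S) (P : set M).
Context (P0 : P 0) (PD : forall x y, P x -> P y -> P (x + y)).
Context (PZ : forall a x, P x -> P (a *: x)).
Definition mksub_pred : {pred M} := fun x => `[< P x >].
Fact mksub_closed : submod_closed mksub_pred.
Proof.
split=> [|a x y /asboolP Px /asboolP Py]; apply/asboolP => //.
by apply: PD => //; exact: PZ.
Qed.
Definition mksub : submod M := Submod mksub_closed.
Lemma mksubP x : x \in mksub <-> P x.
Proof. by split=> [/asboolP//|Px]; apply/asboolP. Qed.
End MkSub.

Lemma submod_set (S : nzRingType) (M : lmodType S) (N : submod M) :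
  [/\ 0 \in N, forall x y, x \in N -> y \in N -> x + y \in N &
      forall a x, x \in N -> a *: x \in N].
Proof. by split=> [|x y|a x]; [exact: rpred0|exact: rpredD|exact: rpredZ]. Qed.

Lemma submod_sum (S : nzRingType) (M : lmodType S) (N : submod M) (I : Type)
    (r : seq I) (P : pred I) (F : I -> M) :
  (forall i, P i -> F i \in N) -> \sum_(i <- r | P i) F i \in N.
Proof. by move=> h; apply: rpred_sum. Qed.

Lemma smod_valZ (S : nzRingType) (M : lmodType S) (N : submod M) a (x : smod N) :
  val (a *: x) = a *: val x.
Proof. by []. Qed.
Lemma smod_val_sum (S : nzRingType) (M : lmodType S) (N : submod M)
  (I : finType) (c : I -> S) (F : I -> smod N) :
  val (\sum_i c i *: F i) = \sum_i c i *: val (F i).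
Proof. by rewrite raddf_sum. Qed.

Lemma fin_gen_finType (S : nzRingType) (M : lmodType S) (P : set M)
    (T : finType) (g : T -> M) : (forall i, P (g i)) ->
  (forall x, P x -> exists c : T -> S, x = \sum_i c i *: g i) -> fin_gen P.
Proof.
move=> Pg hg; exists #|T|, (fun i => g (enum_val i)); split=> // x /hg[c ->].
exists (fun i => c (enum_val i)).
by rewrite (reindex _ (onW_bij _ (@enum_val_bij T))).
Qed.

Section Noeth.
Context (S : nzRingType) (hS : left_noetherian S) (M : lmodType S).

(** Induction on the number of generators: the leading coefficients of the
   elements of [P] form a left ideal, and those with leading coefficient 0
   are combinations of one generator less. *)
Lemma noeth_sub_ord r (g : 'I_r -> M) (P : submod M) :
  (forall x, x \in P -> exists a : 'I_r -> S, x = \sum_i a i *: g i) ->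
  fin_gen [set x | x \in P].
Proof.
elim: r g P => [|r IH] g P hP.
  exists 0%N, g; split=> [[]//|x /= xP].
  by have [a ->] := hP x xP; exists a.
have [P0 PD PZ] := submod_set P.
pose L : set S^o := [set s | exists a : 'I_r -> S,
  s *: g ord_max + \sum_i a i *: g (widen_ord (leqnSn r) i) \in P].
have L0 : L 0.
  exists (fun=> 0); rewrite scale0r add0r big1 // => i _; exact: scale0r.
have LD x y : L x -> L y -> L (x + y).
  move=> [a ha] [b hb]; exists (fun i => a i + b i).
  have := PD _ _ ha hb; rewrite addrACA -big_split /= scalerDl.
  by under eq_bigr do rewrite -scalerDl.
have LZ s x : L x -> L (s *: x).
  move=> [a ha]; exists (fun i => s * a i); have := PZ s _ ha.
  rewrite scalerDr scalerA scaler_sumr.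
  by under eq_bigr do rewrite scalerA.
have [k [l [Ll genL]]] := hS (mksub L0 LD LZ).
have /choice[b hb] : forall j, exists b : 'I_r -> S,
    l j *: g ord_max + \sum_i b i *: g (widen_ord (leqnSn r) i) \in P.
  by move=> j; have /mksubP := Ll j.
pose Q : set M := [set x | x \in P /\ exists a : 'I_r -> S,
  x = \sum_i a i *: g (widen_ord (leqnSn r) i)].
have Q0 : Q 0.
  by split=> //; exists (fun=> 0); rewrite big1 // => i _; exact: scale0r.
have QD x y : Q x -> Q y -> Q (x + y).
  move=> [xP [a xa]] [yP [c yc]]; split; first exact: PD.
  exists (fun i => a i + c i); rewrite xa yc -big_split.
  by apply: eq_bigr => i _; rewrite scalerDl.
have QZ s x : Q x -> Q (s *: x).
  move=> [xP [a xa]]; split; first exact: PZ.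
  exists (fun i => s * a i); rewrite xa scaler_sumr.
  by apply: eq_bigr => i _; rewrite scalerA.
have [m [q [Qq genQ]]] : fin_gen [set x | x \in mksub Q0 QD QZ].
  by apply: (IH (fun i => g (widen_ord (leqnSn r) i))) => x /mksubP[].
pose p j := l j *: g ord_max + \sum_i b j i *: g (widen_ord (leqnSn r) i).
pose G (i : 'I_k + 'I_m) : M := match i with inl j => p j | inr j => q j end.
apply: (@fin_gen_finType _ _ _ _ G) => [[j|j]|x xP] /=; first exact: hb.
  by have /mksubP[] := Qq j.
have [a xa] := hP x xP.
have /genL[c hc] : (a ord_max : S^o) \in mksub L0 LD LZ.
  apply/mksubP; exists (fun i => a (widen_ord (leqnSn r) i)).
  by rewrite addrC; rewrite xa big_ord_recr in xP.
have /genQ[e he] : x - \sum_j c j *: p j \in mksub Q0 QD QZ.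
  apply/mksubP; split.
    by rewrite rpredB // rpred_sum // => j _; rewrite rpredZ //; exact: hb.
  exists (fun i => a (widen_ord (leqnSn r) i) - \sum_j c j * b j i).
  under [in RHS]eq_bigr do rewrite scalerBl.
  rewrite sumrB xa big_ord_recr /=.
  have -> : \sum_j c j *: p j = a ord_max *: g ord_max +
      \sum_i (\sum_j c j * b j i) *: g (widen_ord (leqnSn r) i).
    rewrite /p; under eq_bigr do rewrite scalerDr scaler_sumr scalerA.
    rewrite big_split /= -scaler_suml; congr (_ *: _ + _); first by rewrite hc.
    rewrite exchange_big /=; apply: eq_bigr => i _; rewrite scaler_suml.
    by apply: eq_bigr => j _; rewrite scalerA.
  by rewrite opprD addrA addrK.
exists (fun i => match i with inl j => c j | inr j => e j end).
by rewrite big_sumType /= -he addrC subrK.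
Qed.

Lemma noeth_sub (P : submod M) : fin_gen [set: M] -> fin_gen [set x | x \in P].
Proof.
by case=> r [g [_ hg]]; apply: (@noeth_sub_ord r g) => x _; exact: hg.
Qed.
End Noeth.

Section SubNorm.
Context (RT : realType) (S : nzRingType) (M : lmodType S) (n : M -> RT).
Context (hn : ultranorm n) (cn : complete n) (P : submod M).

Lemma sub_ultra : ultranorm (fun x : smod P => n (val x)).
Proof.
split=> [x|x|x|x y]; first exact: un_ge0.
- split=> [/(un_eq0 hn) h|->]; first exact/val_inj.
  exact: (un0 hn).
- exact: (un_opp hn).
exact: (un_add hn).
Qed.

Lemma sub_complete : nclosed n [set` P] -> complete (fun x : smod P => n (val x)).
Proof.
move=> cP u hu; have [l hl] := cn hu.
have lP : l \in P by apply: (tends_closed hn cP (u := fun k => val (u k))) hl => k; exact: valP.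
by exists (exist _ l lP).
Qed.
End SubNorm.

Section ClosedSub.
Context (RT : realType) (K : fieldType) (v : K -> RT) (hv : is_absv v).
Context (w : K) (hw : 0 < v w < 1).
Context (S : algType K) (nS : S -> RT) (hS : is_banach v nS).
Context (noethS : left_noetherian S).
Context (M : lmodType S) (nM : M -> RT) (hM : ultranorm nM) (cM : complete nM).
Context (scM : forall (k : K) m, nM (k%:A *: m) = v k * nM m).
Context (CM : RT) (CM0 : 0 < CM).
Context (hCM : forall s m, nM (s *: m) <= CM * nS s * nM m).

Lemma act_small s e : 0 < e -> exists d, 0 < d /\
  forall m, nM m < d -> nM (s *: m) < e.
Proof.
move=> e0; pose c := CM * nS s + 1.
have c0 : 0 < c.
  by rewrite ltr_wpDl ?ltr01 // mulr_ge0 ?(ltW CM0) // (un_ge0 (banach_ultra hv hS)).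
exists (e / c); split; first exact: divr_gt0.
move=> m hm; apply: le_lt_trans (hCM _ _) _.
apply: (@le_lt_trans _ _ (c * nM m)).
  by rewrite ler_wpM2r ?(un_ge0 hM) // lerDl ler01.
by rewrite mulrC -ltr_pdivlMr.
Qed.

(** The closure of a submodule is finitely generated, hence generated by
   small perturbations of its generators, and these can be taken in the
   submodule. *)
Lemma submod_nclosed (P : submod M) : fin_gen [set: M] -> nclosed nM [set` P].
Proof.
move=> fgM; pose Q : set M := nclosure nM [set` P].
have Q0 : Q 0 by apply: nclosure_sub => //=; exact: rpred0.
have QD x y : Q x -> Q y -> Q (x + y).
  move=> hx hy e e0; have [x' x'P xx'] := hx e e0; have [y' y'P yy'] := hy e e0.
  exists (x' + y'); first exact: rpredD.
  by rewrite opprD addrACA; exact: unD_lt.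
have QZ s x : Q x -> Q (s *: x).
  move=> hx e e0; have [d [d0 hd]] := act_small s e0.
  have [x' x'P xx'] := hx d d0; exists (s *: x'); first exact: rpredZ.
  by rewrite -scalerBr; exact: hd.
pose Qs := mksub Q0 QD QZ.
have cQ : nclosed nM [set` Qs].
  move=> x hx; apply/mksubP => e e0; have [y /mksubP Qy xy] := hx e e0.
  have [z Pz yz] := Qy e e0; exists z => //.
  by rewrite -(subrK y x) -addrA; exact: unD_lt.
have [r [g [gQ hg]]] := noeth_sub noethS Qs fgM.
pose g1 i : smod Qs := exist _ (g i) (gQ i).
have [|C [C0 hC]] := @open_gen _ _ _ hv _ hw _ _ hS _ _ (sub_ultra hM Qs)
  (sub_complete hM cM cQ) (fun k m => scM k (val m)) _ CM0
  (fun s m => hCM s (val m)) _ g1.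
  move=> y; have [c hc] := hg _ (valP y); exists c; apply: val_inj.
  by rewrite hc smod_val_sum.
have e0 : 0 < (CM * (C + 1))^-1 / 2.
  by rewrite divr_gt0 ?invr_gt0 ?mulr_gt0 ?ltr0n // ltr_wpDl.
have /choice[g' hg'] i : exists y, y \in P /\ nM (g i - y) < (CM * (C + 1))^-1 / 2.
  by have /mksubP/(_ _ e0)[y ? ?] := gQ i; exists y.
have PQ y : y \in P -> y \in Qs.
  by move=> yP; apply/mksubP; exact: nclosure_sub.
pose g1' i : smod Qs := exist _ (g' i) (PQ _ (hg' i).1).
have H y := perturb (banach_ultra hv hS) (bn_complete hS) (sub_ultra hM Qs)
  CM0 (fun s m => hCM s (val m)) C0 hC (g' := g1') _ y.
move=> x Qx; have xQ : x \in Qs by apply/mksubP.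
have [i|a [_ /(congr1 val)]] := H _ (exist _ x xQ).
  apply: (@le_trans _ _ (CM * C * ((CM * (C + 1))^-1 / 2))).
    by rewrite ler_wpM2l ?mulr_ge0 ?(ltW CM0) // ltW // (hg' i).2.
  have -> : CM * C * ((CM * (C + 1))^-1 / 2) = C / (C + 1) / 2.
    by field; rewrite !gt_eqF // ltr_wpDl.
  rewrite ler_piMl ?invr_ge0 ?ler0n // ler_pdivrMr ?mul1r ?lerDl ?ler01 //.
  by rewrite ltr_wpDl.
rewrite smod_val_sum /= => ->; apply: rpred_sum => i _.
by apply: rpredZ; exact: (hg' i).1.
Qed.
End ClosedSub.

(** * Polynomials separating one weight from the others *)

Section Kaplansky.
Context (RT : realType) (K : fieldType) (v : K -> RT) (hv : is_absv v).
Context (w : K) (hw : 0 < v w < 1).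
Context (hdisc : forall x, x != 0 -> exists n : int, v x = v w ^ n).
Let uv := absv_ultra hv.

(** The polynomial whose coefficients are those of the Taylor expansion of
   [P] at [mu]. *)
Definition taylor (mu : K) (P : {poly K}) : {poly K} := P \Po ('X + mu%:P).

(** Only the first [N] coefficients are bounded: by [horner_taylor], they
   determine the action of [P] at [d] on the vectors killed by [(d - mu) ^
   N]. *)
Definition tbound (N : nat) (mu : K) (P : {poly K}) (c : RT) : Prop :=
  forall j, (j < N)%N -> v (taylor mu P)`_j <= c.

Lemma taylorM mu P Q : taylor mu (P * Q) = taylor mu P * taylor mu Q.
Proof. exact: comp_polyM. Qed.
Lemma taylorD mu P Q : taylor mu (P + Q) = taylor mu P + taylor mu Q.
Proof. exact: comp_polyD. Qed.
Lemma taylorN mu P : taylor mu (- P) = - taylor mu P.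
Proof. by rewrite /taylor raddfN. Qed.
Lemma taylor1 mu : taylor mu 1 = 1.
Proof. by rewrite /taylor -polyC1 comp_polyC. Qed.
Lemma taylor0E mu P : (taylor mu P)`_0 = P.[mu].
Proof. by rewrite -horner_coef0 horner_comp !hornerE. Qed.

Section Bounds.
Context (N : nat) (mu : K).
Local Notation bd := (tbound N mu).

Lemma tboundW P a b : a <= b -> bd P a -> bd P b.
Proof. by move=> ab h j /h /le_trans; apply. Qed.
Lemma tbound1 : bd 1 1.
Proof.
move=> j _; rewrite taylor1 coef1; case: (j == 0%N); first by rewrite av1.
by rewrite av0 ?ler01.
Qed.
Lemma tboundD P Q c : bd P c -> bd Q c -> bd (P + Q) c.
Proof. by move=> h1 h2 j jN; rewrite taylorD coefD (unD_le uv) ?h1 ?h2. Qed.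
Lemma tboundN P c : bd P c -> bd (- P) c.
Proof. by move=> h1 j jN; rewrite taylorN coefN (avN hv) h1. Qed.
Lemma tboundB P Q c : bd P c -> bd Q c -> bd (P - Q) c.
Proof. by move=> h1 h2; apply: tboundD => //; exact: tboundN. Qed.
Lemma tboundM P Q a b : 0 <= a -> 0 <= b -> bd P a -> bd Q b -> bd (P * Q) (a * b).
Proof.
move=> a0 b0 h1 h2 j jN; rewrite taylorM coefM.
apply: (un_sum_le uv) => [|i _]; first exact: mulr_ge0.
rewrite (av_mul hv); apply: ler_pM; rewrite ?(av_ge0 hv) //.
  by apply: h1; apply: leq_ltn_trans jN; rewrite -ltnS.
by apply: h2; apply: leq_ltn_trans jN; exact: leq_subr.
Qed.
Lemma tboundX P B m : 1 <= B -> bd P B -> bd (P ^+ m) (B ^+ m).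
Proof.
move=> B1 hP; have B0 := le_trans ler01 B1.
elim: m => [|m IH]; first exact: tbound1.
by rewrite !exprS; apply: tboundM => //; exact: exprn_ge0.
Qed.
Lemma tboundX1 P m : bd P 1 -> bd (P ^+ m) 1.
Proof. by move=> hP; have := tboundX m (lexx _) hP; rewrite expr1n. Qed.

(** In each term of the [j]-th Taylor coefficient of [P ^ m], at least [m -
   j] of the factors are evaluated at [mu]. *)
Lemma tbound_pow P r B m : 0 <= r <= 1 -> 1 <= B -> v P.[mu] <= r -> bd P B ->
  forall j, (j < N)%N -> v (taylor mu (P ^+ m))`_j <= r ^+ (m - j) * B ^+ j.
Proof.
move=> /andP[r0 r1] B1 hr hP; have B0 := le_trans ler01 B1.
elim: m => [|m IH] j jN.
  rewrite expr0 sub0n expr0 mul1r; apply: le_trans (tbound1 jN) _.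
  exact: exprn_ege1.
rewrite exprS taylorM coefM; apply: (un_sum_le uv) => [|i _].
  by rewrite mulr_ge0 ?exprn_ge0.
rewrite (av_mul hv).
have ij : (i <= j)%N by rewrite -ltnS.
have jiN : (j - i < N)%N by apply: leq_ltn_trans jN; exact: leq_subr.
have [i0|i0] := posnP i.
  rewrite i0 taylor0E subn0.
  apply: le_trans (ler_pM (av_ge0 hv _) (av_ge0 hv _) hr (IH j jN)) _.
  rewrite mulrA ler_wpM2r ?exprn_ge0 // -exprS.
  by apply: ler_wiXn2l => //; lia.
have hPi : v (taylor mu P)`_i <= B by apply: hP; exact: leq_ltn_trans jN.
apply: le_trans (ler_pM (av_ge0 hv _) (av_ge0 hv _) hPi (IH _ jiN)) _.
rewrite mulrCA -exprS; apply: ler_pM; rewrite ?exprn_ge0 //.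
  by apply: ler_wiXn2l => //; lia.
by apply: ler_weXn2l => //; lia.
Qed.
End Bounds.

Lemma tbound_small N r B eta : 0 <= r < 1 -> 1 <= B -> 0 < eta -> exists m,
  forall mu P, v P.[mu] <= r -> tbound N mu P B -> tbound N mu (P ^+ m) eta.
Proof.
move=> /andP[r0 r1] B1 e0; have B0 : 0 < B by apply: lt_le_trans B1; exact: ltr01.
have [m hm] : exists m, r ^+ m < eta / B ^+ N.
  by apply: geo_small; rewrite ?r0 // divr_gt0 // exprn_gt0.
exists (m + N)%N => mu P hr hP j jN.
apply: le_trans (tbound_pow (m + N) _ B1 hr hP jN) _; first by rewrite r0 ltW.
apply: (@le_trans _ _ (r ^+ m * B ^+ N)).
  apply: ler_pM; rewrite ?exprn_ge0 ?(ltW B0) //.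
    by apply: ler_wiXn2l; rewrite ?(ltW r1) //; lia.
  by apply: ler_weXn2l => //; exact: ltnW.
by rewrite -ler_pdivlMr ?exprn_gt0 // ltW.
Qed.

Context (L : set K).

(** If [S] separates two sets of points modulo the maximal ideal, then [1 -
   (1 - S ^ n) ^ m] is close to 0 on the first and close to 1 on the second,
   for [n] and then [m] large. *)
Lemma sharpen N S r B eta (L0 L1 : set K) : 0 <= r < 1 -> 1 <= B -> 0 < eta ->
  (forall mu, L mu -> tbound N mu S B) ->
  (forall mu, L mu -> L0 mu -> v S.[mu] <= r) ->
  (forall mu, L mu -> L1 mu -> v (1 - S.[mu]) <= r) ->
  exists T, [/\ exists B', 1 <= B' /\ forall mu, L mu -> tbound N mu T B',
    forall mu, L mu -> L0 mu -> tbound N mu T eta &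
    forall mu, L mu -> L1 mu -> tbound N mu (T - 1) eta].
Proof.
move=> r01 B1 e0 hS hS0 hS1; have /andP[r0 r1] := r01.
have e10 : 0 < Num.min eta 1 by rewrite lt_min e0 ltr01.
have [n hn] := tbound_small N r01 B1 e10.
have Bn1 : 1 <= B ^+ n by exact: exprn_ege1.
have hSn mu : L mu -> tbound N mu (1 - S ^+ n) (B ^+ n).
  move=> Lmu; apply: tboundB; first exact: tboundW Bn1 (@tbound1 _ _).
  by apply: tboundX => //; exact: hS.
have [m hm] := tbound_small N r01 Bn1 e0.
exists (1 - (1 - S ^+ n) ^+ m); split.
- have Bnm : 1 <= (B ^+ n) ^+ m by exact: exprn_ege1.
  exists ((B ^+ n) ^+ m); split=> // mu Lmu; apply: tboundB.
    exact: tboundW Bnm (@tbound1 _ _).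
  by apply: tboundX => //; exact: hSn.
- move=> mu Lmu L0mu; have hU := hn mu S (hS0 _ Lmu L0mu) (hS _ Lmu).
  set U := S ^+ n in hU *; apply: (@tboundW _ _ _ (Num.min eta 1)).
    by rewrite ge_min lexx.
  have U1 : tbound N mu (1 - U) 1.
    apply: tboundB; first exact: tbound1.
    by apply: tboundW hU; rewrite ge_min lexx orbT.
  elim: m {hm} => [|m IH].
    rewrite expr0 subrr => j _; rewrite /taylor comp_poly0 coef0 av0 //; exact: ltW.
  have -> : 1 - (1 - U) ^+ m.+1 = (1 - (1 - U) ^+ m) + U * (1 - U) ^+ m.
    by rewrite exprS; ring.
  apply: tboundD => //; rewrite -[Num.min _ _]mulr1.
  by apply: tboundM => //; [exact: ltW|exact: tboundX1].
move=> mu Lmu L1mu; rewrite addrAC subrr add0r; apply: tboundN.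
apply: hm; last exact: hSn.
have h1 := hS1 _ Lmu L1mu; rewrite !hornerE.
have hs : v S.[mu] <= 1.
  have -> : S.[mu] = 1 - (1 - S.[mu]) by rewrite opprB addrC subrK.
  by apply: (unB_le uv); rewrite ?av1 // (le_trans h1) // ltW.
elim: n {hn Bn1 hSn} => [|n IH]; first by rewrite expr0 subrr av0.
have -> : 1 - S.[mu] ^+ n.+1 = (1 - S.[mu]) + S.[mu] * (1 - S.[mu] ^+ n).
  by rewrite exprS; ring.
apply: (unD_le uv) => //; rewrite (av_mul hv) -[r]mul1r.
by apply: ler_pM; rewrite ?(av_ge0 hv).
Qed.

Context (precpt : forall e, 0 < e -> exists s : seq K,
  forall mu, L mu -> exists2 c, c \in s & v (mu - c) < e).

Lemma precpt_bounded lam : exists2 R, 0 < R & forall mu, L mu -> v (mu - lam) <= R.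
Proof.
have [s hs] := precpt ltr01.
exists (1 + \sum_(c <- s) v (c - lam)) => [|mu Lmu].
  by rewrite ltr_pwDl ?ltr01 // sumr_ge0 // => c _; exact: av_ge0.
have [c cs hc] := hs _ Lmu.
have -> : mu - lam = (mu - c) + (c - lam) by rewrite addrA subrK.
have h0 : 0 <= \sum_(c <- s) v (c - lam) by rewrite sumr_ge0 // => ? _; exact: av_ge0.
apply: (unD_le uv); first by rewrite (le_trans (ltW hc)) // lerDl.
have : v (c - lam) <= \sum_(c <- s) v (c - lam).
  rewrite (big_rem c) //= lerDl sumr_ge0 // => ? _; exact: av_ge0.
by move=> /le_trans; apply; rewrite lerDr ler01.
Qed.

Lemma tbound_unif N P : exists B, 1 <= B /\ forall mu, L mu -> tbound N mu P B.
Proof.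
have [R R0 hR] := precpt_bounded 0.
elim/poly_ind: P => [|P c [B [B1 hB]]].
  exists 1; split=> // mu _ j _; rewrite /taylor comp_poly0 coef0 av0 // ler01.
pose R1 := Num.max R 1; pose C := Num.max (B * R1) (v c).
have R11 : 1 <= R1 by rewrite le_max lexx orbT.
have BR1 : 1 <= B * R1 by rewrite -[1]mulr1 ler_pM // ler01.
exists C; split=> [|mu Lmu]; first by rewrite le_max BR1.
apply: tboundD.
  apply: (@tboundW _ _ _ (B * R1)); first by rewrite le_max lexx.
  apply: tboundM; rewrite ?(le_trans ler01) //; first exact: hB.
  move=> j _; rewrite /taylor comp_polyX coefD coefX coefC.
  apply: (unD_le uv).
    case: (j == 1%N); rewrite ?av1 ?av0 //; exact: le_trans ler01 R11.
  case: (j == 0%N); last by rewrite av0 // (le_trans ler01).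
  by have := hR _ Lmu; rewrite subr0 => /le_trans; apply; rewrite le_max lexx.
move=> j _; rewrite /taylor comp_polyC coefC; case: (j == 0%N).
  by rewrite le_max lexx orbT.
by rewrite av0 // (le_trans ler01) // le_max BR1.
Qed.

Lemma disc_gap x t : v x < v t -> v x <= v t * v w.
Proof.
have /andP[w0 w1] := hw => xt.
have [->|x0] := eqVneq x 0; first by rewrite av0 // mulr_ge0 // (av_ge0 hv).
have t0 : t != 0 by apply: contraTneq xt => ->; rewrite av0 // -leNgt (av_ge0 hv).
have vt := av_neq0 hv t0.
have [|n hn] := hdisc (x := x / t); first by rewrite mulf_neq0 ?invr_eq0.
have : v (x / t) <= v w.
  have : v (x / t) < 1 by rewrite (av_mul hv) (avV hv) ltr_pdivrMr // mul1r.
  rewrite hn; case: n {hn} => [[|n]|n] /=.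
  - by rewrite -exprnP expr0 ltxx.
  - by move=> _; rewrite -exprnP exprS ler_piMr ?(ltW w0) // exprn_ile1 // ltW.
  rewrite NegzE -exprnN invf_lt1 ?exprn_gt0 // ltNge.
  by rewrite exprn_ile1 // ltW.
by rewrite (av_mul hv) (avV hv) ler_pdivrMr // mulrC.
Qed.

(** Induction on [k]: once the ball of radius [v (t * w ^ k)] around [lam]
   is separated from its complement, there remains to separate the sphere
   bounding it from the next smaller ball. As [L] is precompact, finitely
   many linear factors vanish modulo the maximal ideal on that sphere. *)
Lemma kaplansky_level lam N t : t != 0 -> (forall mu, L mu -> v (mu - lam) <= v t) ->
  forall k eta, 0 < eta -> exists P, forall mu, L mu ->
   (v (mu - lam) <= v (t * w ^+ k) -> tbound N mu (P - 1) eta) /\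
   (v (t * w ^+ k) < v (mu - lam) -> tbound N mu P eta).
Proof.
move=> t0 hR; have /andP[w0 w1] := hw.
have wn0 : w != 0 by apply: contraTneq w0 => ->; rewrite av0 ?ltxx.
elim=> [|k IH] eta e0.
  exists 1 => mu Lmu; rewrite expr0 mulr1; split=> [_|].
    by rewrite subrr => j _; rewrite /taylor comp_poly0 coef0 av0 // ltW.
  by move/lt_le_trans => /(_ _ (hR _ Lmu)); rewrite ltxx.
set u := t * w ^+ k; have u0 : u != 0 by rewrite mulf_neq0 ?expf_neq0.
have vu := av_neq0 hv u0.
have vuw : v (t * w ^+ k.+1) = v u * v w by rewrite exprSr mulrA (av_mul hv).
have [s hs] := precpt (mulr_gt0 vu w0).
(* Modulo the maximal ideal, [S] is 0 on the sphere and 1 inside it. *)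
pose S : {poly K} := \prod_(c <- s | v (c - lam) == v u)
   (1 - (c - lam)^-1 *: ('X - lam%:P)).
have SE mu : S.[mu] = \prod_(c <- s | v (c - lam) == v u) (1 - (mu - lam) / (c - lam)).
  rewrite /S horner_prod; apply: eq_bigr => c _.
  by rewrite !hornerE mulrC.
have [B [B1 hB]] := tbound_unif N S.
pose L' : set K := [set mu | L mu /\ v (mu - lam) <= v u].
have r01 : 0 <= v w < 1 by rewrite (ltW w0).
have [T [[B' [B'1 hB']] hT0 hT1]] : exists T,
   [/\ exists B', 1 <= B' /\ forall mu, L mu -> tbound N mu T B',
    forall mu, L mu -> v (mu - lam) = v u -> tbound N mu T eta &
    forall mu, L mu -> v (mu - lam) < v u -> tbound N mu (T - 1) eta].
  apply: (@sharpen N S (v w) B eta [set mu | v (mu - lam) = v u]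
    [set mu | v (mu - lam) < v u]) => //= mu Lmu hmu.
    have [c cs hc] := hs _ Lmu; rewrite SE.
    have hcu : v (c - lam) = v u.
      have h1 : v (mu - c) < v u.
        by apply: lt_le_trans hc _; rewrite ler_piMr ?ltW.
      apply/eqP; rewrite eq_le; apply/andP; split.
        have -> : c - lam = (mu - lam) - (mu - c) by rewrite opprB [RHS]addrC addrA subrK.
        by apply: (unB_le uv); rewrite ?hmu // ltW.
      rewrite leNgt; apply/negP => h2.
      have : v (mu - lam) < v u.
        have -> : mu - lam = (mu - c) + (c - lam) by rewrite addrA subrK.
        exact: (unD_lt uv).
      by rewrite hmu ltxx.
    rewrite (big_rem c) //= hcu eqxx (av_mul hv) -[leRHS]mulr1.
    apply: ler_pM; rewrite ?(av_ge0 hv) //.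
      have cl0 : c - lam != 0.
        by apply: contraTneq vu => h; rewrite -hcu h av0 // ltxx.
      have -> : 1 - (mu - lam) / (c - lam) = (c - mu) / (c - lam) by field.
      rewrite (av_mul hv) (avV hv) hcu ler_pdivrMr // mulrC (unC uv) ltW //.
    elim/big_rec: _ => [|c' x hc' xe]; first by rewrite av1.
    rewrite (av_mul hv) -[leRHS]mulr1; apply: ler_pM; rewrite ?(av_ge0 hv) //.
    apply: (unB_le uv); rewrite ?av1 // (av_mul hv) (avV hv) (eqP hc') hmu.
    by rewrite divff // gt_eqF.
  rewrite SE; have hmu' := disc_gap hmu.
  suff : v (1 - \prod_(c <- s | v (c - lam) == v u) (1 - (mu - lam) / (c - lam)))
      <= v w /\ v (\prod_(c <- s | v (c - lam) == v u) (1 - (mu - lam) / (c - lam))) <= 1.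
    by case.
  elim/big_rec: _ => [|c x hc [x1 x2]]; first by rewrite subrr av0 // av1 // ltW.
  set q := (mu - lam) / (c - lam).
  have hq : v q <= v w.
    by rewrite /q (av_mul hv) (avV hv) (eqP hc) ler_pdivrMr // mulrC.
  split.
    have -> : 1 - (1 - q) * x = (1 - x) + q * x by ring.
    apply: (unD_le uv) => //; rewrite (av_mul hv) -[leRHS]mulr1.
    by apply: ler_pM; rewrite ?(av_ge0 hv).
  rewrite (av_mul hv) -[leRHS]mulr1; apply: ler_pM; rewrite ?(av_ge0 hv) //.
  by apply: (unB_le uv); rewrite ?av1 // (le_trans hq) // ltW.
have B'0 : 0 < B' by apply: lt_le_trans B'1; exact: ltr01.
have [P hP] := IH (eta / B') (divr_gt0 e0 B'0).
exists (T * P) => mu Lmu; have [hP1 hP0] := hP _ Lmu.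
have eB : eta = B' * (eta / B') by rewrite mulrC divfK // gt_eqF.
have eB0 : 0 <= eta / B' by rewrite divr_ge0 // ltW.
have TP1 Q : tbound N mu Q (eta / B') -> tbound N mu (T * Q) eta.
  by move=> hQ; rewrite eB; apply: tboundM => //; [exact: ltW|exact: hB'].
rewrite vuw; split=> hmu.
  have hmu' : v (mu - lam) < v u by apply: le_lt_trans hmu _; rewrite gtr_pMr.
  have -> : T * P - 1 = T * (P - 1) + (T - 1) by ring.
  apply: tboundD; last exact: hT1.
  by apply: TP1; apply: hP1; exact: ltW.
have [h|h|h] := ltgtP (v (mu - lam)) (v u).
- by have := disc_gap h; rewrite leNgt hmu.
- by apply: TP1; exact: hP0.
have -> : T * P = T * (P - 1) + T by ring.
apply: tboundD; last exact: hT0.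
by apply: TP1; apply: hP1; rewrite h.
Qed.

(** A polynomial approximation on [L] of the indicator function of [lam]. *)
Lemma kaplansky lam N d eta : 0 < d -> 0 < eta -> exists P, forall mu, L mu ->
  [/\ tbound N mu P 1, mu = lam -> tbound N mu (P - 1) eta &
      d <= v (mu - lam) -> tbound N mu P eta].
Proof.
move=> d0 e0; have /andP[w0 w1] := hw.
have wn0 : w != 0 by apply: contraTneq w0 => ->; rewrite av0 ?ltxx.
have [R R0 hR] := precpt_bounded lam.
have [m hm] : exists m, v w ^+ m < R^-1 by apply: geo_small; rewrite ?invr_gt0 ?(ltW w0).
pose t := w ^- m; have t0 : t != 0 by rewrite invr_eq0 expf_neq0.
have vt : R <= v t.
  rewrite (avV hv) (avX hv) -[R]invrK lef_pV2 ?posrE ?invr_gt0 ?exprn_gt0 //.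
  exact: ltW.
have [k hk] : exists k, v w ^+ k < d / v t.
  by apply: geo_small; rewrite ?(ltW w0) // divr_gt0 // (av_neq0 hv).
have e10 : 0 < Num.min eta 1 by rewrite lt_min e0 ltr01.
have hRt mu : L mu -> v (mu - lam) <= v t by move/hR/le_trans; apply.
have [P hP] := kaplansky_level N t0 hRt k e10.
have vtk : v (t * w ^+ k) < d.
  by rewrite (av_mul hv) (avX hv) mulrC -ltr_pdivlMr // (av_neq0 hv).
have min1 : Num.min eta 1 <= eta by rewrite ge_min lexx.
have min2 : Num.min eta 1 <= 1 by rewrite ge_min lexx orbT.
exists P => mu Lmu; have [h1 h0] := hP mu Lmu; split.
- have [h|h] := leP (v (mu - lam)) (v (t * w ^+ k)).
    rewrite -(subrK 1 P); apply: tboundD; last exact: tbound1.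
    by apply: tboundW min2 _; exact: h1.
  by apply: tboundW min2 _; exact: h0.
- by move=> ml; apply: tboundW min1 _; apply: h1; rewrite ml subrr av0 // (av_ge0 hv).
by move=> h; apply: tboundW min1 _; apply: h0; exact: lt_le_trans h.
Qed.
End Kaplansky.

(** * Finite-dimensional subspaces *)

Section Lin.
Context (K : fieldType) (V : lmodType K).

Definition lin_indep m (e : 'I_m -> V) : Prop :=
  forall c : 'I_m -> K, \sum_i c i *: e i = 0 -> forall i, c i = 0.

Definition span m (e : 'I_m -> V) : set V :=
  [set x | exists c : 'I_m -> K, x = \sum_i c i *: e i].

Definition subspace (P : set V) : Prop :=
  P 0 /\ forall (k : K) x y, P x -> P y -> P (k *: x + y).

(** A spanning family of least size is independent. *)
Lemma basis_extract r (g : 'I_r -> V) : exists m (e : 'I_m -> V),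
  [/\ lin_indep e, forall i, exists j, e i = g j &
      forall x, span g x -> span e x].
Proof.
pose Q m := `[< exists e : 'I_m -> V, (forall i, exists j, e i = g j) /\
  forall x, span g x -> span e x >].
have exQ : exists m, Q m.
  by exists r; apply/asboolP; exists g; split=> // i; exists i.
case: (ex_minnP exQ) => m /asboolP[e [eg he]] mmin.
exists m, e; split=> // c hc i; apply/eqP/negP => /negP ci.
case: m e eg he mmin c hc i ci => [|m] e eg he mmin c hc i ci; first by case: (i).
suff /mmin : Q m by rewrite ltnn.
apply/asboolP; exists (fun j => e (lift i j)); split=> [j|x /he[b ->]]; first exact: eg.
exists (fun j => b (lift i j) - b i * (c i)^-1 * c (lift i j)).
move: hc; rewrite (bigD1_ord i) //= => /eqP; rewrite addr_eq0 => /eqP hc.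
rewrite (bigD1_ord i) //=.
under [in RHS]eq_bigr do rewrite scalerBl -scalerA.
rewrite sumrB -scaler_sumr -[X in _ - _ *: X]opprK -hc scalerN opprK.
by rewrite scalerA mulfVK // addrC.
Qed.

(** A matrix of greatest rank among those whose rows lie in [P]. *)
Lemma row_space_of d (P : set 'rV[K]_d) : P 0 ->
  (forall k x y, P x -> P y -> P (k *: x + y)) ->
  exists A : 'M[K]_d, forall c, (c <= A)%MS <-> P c.
Proof.
move=> P0 PD.
have PL m (B : 'M[K]_(m, d)) (c : 'rV_m) : (forall i, P (row i B)) -> P (c *m B).
  move=> hB; rewrite mulmx_sum_row.
  elim/big_rec: _ => // i x _ Px; exact: PD.
pose Q k := `[< exists A : 'M[K]_d, (forall c, (c <= A)%MS -> P c) /\ \rank A = k >].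
have exQ : exists k, Q k.
  exists 0%N; apply/asboolP; exists 0; split=> [c|]; last by rewrite mxrank0.
  by rewrite submx0 => /eqP ->.
have bQ k : Q k -> (k <= d)%N by move=> /asboolP[A [_ <-]]; exact: rank_leq_row.
case: (ex_maxnP exQ bQ) => k /asboolP[A [hA rA]] kmax.
exists A => c; split=> [|Pc]; first exact: hA.
apply: contrapT => /negP cA.
have /kmax : Q (\rank (A + c)%MS).
  apply/asboolP; exists (A + c)%MS; split=> // c' /sub_addsmxP[[a b] /= ->].
  rewrite -[_ *m A]scale1r; apply: PD; first by apply: hA; exact: submxMl.
  by apply: PL => i; rewrite row_id.
rewrite -rA leqNgt rank_ltmx // ltmxE addsmxSl /=.
by apply: contra cA => /(submx_trans (addsmxSr _ _)).
Qed.

(** The dimension of the trace of a subspace on the span of [e]. *)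
Lemma dim_fun d (e : 'I_d -> V) : exists h : set V -> nat,
  (forall N, h N <= d)%N /\
  forall N N', subspace N -> subspace N' -> N `<=` N' ->
    (exists2 x, span e x & N' x /\ ~ N x) -> (h N < h N')%N.
Proof.
pose lc (c : 'rV[K]_d) := \sum_i c 0 i *: e i.
have lcP k x y : lc (k *: x + y) = k *: lc x + lc y.
  rewrite /lc scaler_sumr -big_split /=; apply: eq_bigr => i _.
  by rewrite !mxE scalerDl scalerA.
have lc0 : lc 0 = 0 by rewrite /lc big1 // => i _; rewrite mxE scale0r.
have /choice[A hA] : forall N : set V, exists A : 'M[K]_d,
    subspace N -> forall c, (c <= A)%MS <-> N (lc c).
  move=> N; have [[N0 ND]|hN] := pselect (subspace N); last by exists 0.
  have [||A hA] := @row_space_of d (fun c => N (lc c)); last by exists A.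
    by rewrite lc0.
  by move=> k x y Nx Ny; rewrite lcP; exact: ND.
exists (fun N => \rank (A N)); split=> [N|N N' sN sN' NN' [x [c xc] [N'x Nx]]].
  exact: rank_leq_row.
have xE : x = lc (\row_i c i).
  by rewrite xc; apply: eq_bigr => i _; rewrite mxE.
apply: rank_ltmx; rewrite ltmxE; apply/andP; split.
  apply/row_subP => i; apply/(hA _ sN'); apply: NN'; apply/(hA _ sN).
  exact: row_sub.
apply/negP => h; apply: Nx; rewrite xE; apply/(hA _ sN).
by apply: submx_trans h; apply/(hA _ sN'); rewrite -xE.
Qed.
End Lin.

Section FinDim.
Context (RT : realType) (K : fieldType) (v : K -> RT) (hv : is_absv v).
Context (cv : complete v).
Context (V : lmodType K) (n : V -> RT) (hn : ultranorm n).
Context (scn : forall k x, n (k *: x) = v k * n x).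

(** The coordinates of a convergent sequence of the span form Cauchy
   sequences, and their limits are the coordinates of the limit. *)
Lemma span_limit m (e : 'I_m -> V) C :
  (forall (c : 'I_m -> K) i, v (c i) <= C * n (\sum_j c j *: e j)) ->
  forall x, nclosure n (span e) x -> span e x.
Proof.
move=> hC x /(nclosure_tends hn)[u /choice[a ua] ux].
have C1 : 0 < Num.max C 1 by rewrite lt_max ltr01 orbT.
have ha i : exists l, tends v (a^~ i) l.
  apply: (complete_steps (absv_ultra hv) cv) => d d0.
  have [N hN] := ux _ (divr_gt0 d0 C1); exists N => k Nk.
  apply: le_lt_trans (hC (fun i => a k.+1 i - a k i) i) _.
  have -> : \sum_j (a k.+1 j - a k j) *: e j = (u k.+1 - x) - (u k - x).
    rewrite opprB addrA subrK !ua -sumrB.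
    by apply: eq_bigr => j _; rewrite scalerBl.
  apply: (@le_lt_trans _ _ (Num.max C 1 * n (u k.+1 - x - (u k - x)))).
    by rewrite ler_wpM2r ?(un_ge0 hn) // le_max lexx.
  rewrite mulrC -ltr_pdivlMr //; apply: (unB_lt hn); apply: hN => //.
  exact: leqW.
have /choice[l hl] := ha; exists l.
apply/eqP; rewrite -subr_eq0; apply/eqP; apply: (un_small0 hn) => d d0.
have [N0 hN0] := ux _ d0.
pose G := \sum_i n (e i) + 1.
have Gi i : n (e i) <= G.
  rewrite /G (bigD1 i) //= -addrA lerDl addr_ge0 ?ler01 //.
  by apply: sumr_ge0 => j _; exact: un_ge0.
have G0 : 0 < G.
  by rewrite ltr_wpDl ?ltr01 //; apply: sumr_ge0 => j _; exact: un_ge0.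
have /choice[N hN] i := hl i (d / G) (divr_gt0 d0 G0).
pose k := maxn N0 (\max_i N i).
have -> : x - \sum_i l i *: e i = \sum_i (a k i - l i) *: e i - (u k - x).
  under [in RHS]eq_bigr do rewrite scalerBl.
  by rewrite sumrB -ua opprB [RHS]addrC addrA subrK.
apply: (unB_lt hn); last by apply: hN0; exact: leq_maxl.
apply: (un_sum_lt hn) => // i _; rewrite scn.
have h : v (a k i - l i) < d / G.
  by apply: hN; rewrite /k leq_max (leq_bigmax i) orbT.
apply: (@le_lt_trans _ _ (v (a k i - l i) * G)).
  by rewrite ler_wpM2l ?(av_ge0 hv).
by rewrite -ltr_pdivlMr.
Qed.

(** Induction on the dimension: the span of all but one of the vectors is
   closed by [span_limit], so that the translates of the remaining vector by
   it keep away from 0. *)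
Lemma coord_bound m (e : 'I_m -> V) : lin_indep e ->
  exists C, 0 <= C /\ forall (c : 'I_m -> K) i, v (c i) <= C * n (\sum_j c j *: e j).
Proof.
elim: m e => [|m IH] e he; first by exists 0; split=> // c [].
pose e' i := e (widen_ord (leqnSn m) i).
have [|C [C0 hC]] := IH e'.
  move=> c hc i; pose c' (j : 'I_m.+1) := if unlift ord_max j is Some k then c k else 0.
  have c'w k : c' (widen_ord (leqnSn m) k) = c k.
    have -> : widen_ord (leqnSn m) k = lift ord_max k.
      by apply: val_inj; symmetry; exact: lift_max.
    by rewrite /c' liftK.
  have c'm : c' ord_max = 0 by rewrite /c' unlift_none.
  have := he c' _ (widen_ord (leqnSn m) i); rewrite c'w; apply.
  rewrite big_ord_recr /= c'm scale0r addr0.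
  by under eq_bigr do rewrite c'w.
have [d [d0 hd]] : exists d, 0 < d /\ forall x, span e' x -> d <= n (e ord_max + x).
  apply: contrapT => h.
  have : span e' (e ord_max).
    apply: (span_limit hC) => d d0; apply: contrapT => h2; apply: h.
    exists d; split=> // x [c xc]; rewrite leNgt; apply/negP => hx; apply: h2.
    exists (- x); last by rewrite opprK.
    exists (fun i => - c i); rewrite xc -sumrN.
    by apply: eq_bigr => i _; rewrite scaleNr.
  case=> c hc; pose c' (j : 'I_m.+1) := if unlift ord_max j is Some k then - c k else 1.
  have := he c' _ ord_max; rewrite {2}/c' unlift_none => H.
  suff /H/eqP : \sum_i c' i *: e i = 0 by rewrite oner_eq0.
  rewrite big_ord_recr /= {2}/c' unlift_none scale1r hc -big_split big1 // => k _ /=.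
  have -> : c' (widen_ord (leqnSn m) k) = - c k.
    have -> : widen_ord (leqnSn m) k = lift ord_max k.
      by apply: val_inj; symmetry; exact: lift_max.
    by rewrite /c' liftK.
  by rewrite scaleNr addNr.
have hmax (c : 'I_m.+1 -> K) : v (c ord_max) <= d^-1 * n (\sum_j c j *: e j).
  have [->|c0] := eqVneq (c ord_max) 0.
    by rewrite av0 // mulr_ge0 ?(un_ge0 hn) // invr_ge0 ltW.
  have -> : \sum_j c j *: e j = c ord_max *: (e ord_max +
      \sum_i ((c ord_max)^-1 * c (widen_ord (leqnSn m) i)) *: e' i).
    rewrite big_ord_recr /= scalerDr addrC; congr (_ + _).
    rewrite scaler_sumr; apply: eq_bigr => i _.
    by rewrite scalerA mulrA divff // mul1r.
  rewrite scn mulrCA ler_peMr ?(av_ge0 hv) // mulrC ler_pdivlMr // mul1r.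
  by apply: hd; exists (fun i => (c ord_max)^-1 * c (widen_ord (leqnSn m) i)).
pose G := n (e ord_max).
have G0 : 0 <= G by exact: un_ge0.
have dG : 0 <= d^-1 by rewrite invr_ge0 ltW.
exists (Num.max d^-1 (C * Num.max 1 (d^-1 * G))); split.
  by rewrite le_max dG.
move=> c i; set x := \sum_j _.
have x0 : 0 <= n x by exact: un_ge0.
have [->|im] := eqVneq i ord_max.
  by apply: le_trans (hmax c) _; rewrite ler_wpM2r // le_max lexx.
have [k ->] : exists k, i = widen_ord (leqnSn m) k.
  have im' : (i < m)%N.
    rewrite ltn_neqAle -ltnS ltn_ord andbT; apply: contra im => /eqP h.
    by apply/eqP/val_inj.
  by exists (Ordinal im'); apply: val_inj.
apply: le_trans (hC (fun k => c (widen_ord (leqnSn m) k)) k) _.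
apply: (@le_trans _ _ (C * Num.max 1 (d^-1 * G) * n x)); last first.
  by rewrite ler_wpM2r // le_max lexx orbT.
rewrite -mulrA ler_wpM2l //.
have -> : \sum_j c (widen_ord (leqnSn m) j) *: e' j = x - c ord_max *: e ord_max.
  by rewrite /x big_ord_recr /= addrK.
apply: (unB_le hn); first by rewrite ler_peMl // le_max lexx.
rewrite scn; apply: (@le_trans _ _ (d^-1 * n x * G)).
  by rewrite ler_wpM2r //; exact: hmax.
by rewrite mulrAC ler_wpM2r // le_max lexx orbT.
Qed.

Lemma span_closed m (e : 'I_m -> V) : lin_indep e -> nclosed n (span e).
Proof. by move=> /coord_bound[C [_ hC]]; exact: span_limit hC. Qed.
End FinDim.

(** * Weight expansions in modules generated by weight vectors *)

(** Convergence along the finite subsets of [K]. Unlike in [sums_to], the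
   family is indexed by all of [K], with components 0 where there is no
   weight. *)
Definition nsum (RT : realType) (K : fieldType) (V : zmodType) (n : V -> RT)
    (c : K -> V) (x : V) : Prop :=
  forall e, 0 < e -> exists s0 : {fset K}, forall s : {fset K}, (s0 `<=` s)%fset ->
    n (x - \sum_(l <- s) c l) < e.

Section Nsum.
Context (RT : realType) (K : fieldType) (V : zmodType) (n : V -> RT) (hn : ultranorm n).

Lemma nsumD (c c' : K -> V) x x' : nsum n c x -> nsum n c' x' ->
  nsum n (fun l => c l + c' l) (x + x').
Proof.
move=> h h' e e0; have [s hs] := h e e0; have [s' hs'] := h' e e0.
exists (s `|` s')%fset => t; rewrite fsubUset => /andP[st s't].
rewrite big_split opprD addrACA; apply: (unD_lt hn); [exact: hs|exact: hs'].
Qed.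

Lemma nsum0 : nsum n (fun _ : K => 0) 0.
Proof. by move=> e e0; exists fset0 => s _; rewrite big1 // subrr (un0 hn). Qed.

Lemma nsum_sum (I : Type) (r : seq I) (c : I -> K -> V) x :
  (forall i, nsum n (c i) (x i)) ->
  nsum n (fun l => \sum_(i <- r) c i l) (\sum_(i <- r) x i).
Proof.
move=> h; elim: r => [|i r IH].
  have -> : (fun l : K => \sum_(i <- [::]) c i l) = fun=> 0.
    by apply/funext => l; rewrite big_nil.
  by rewrite big_nil; exact: nsum0.
have -> : (fun l : K => \sum_(j <- i :: r) c j l) =
    fun l => c i l + \sum_(j <- r) c j l by apply/funext => l; rewrite big_cons.
by rewrite big_cons; exact: nsumD.
Qed.

Lemma nsum_small (c : K -> V) x : nsum n c x -> forall e, 0 < e ->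
  exists s : {fset K}, forall l, l \notin s -> n (c l) < e.
Proof.
move=> h e e0; have [s hs] := h e e0; exists s => l ls.
have -> : c l = (x - \sum_(k <- s) c k) - (x - \sum_(k <- (l |` s)%fset) c k).
  by rewrite big_fsetU1 // opprB addrC addrA subrK addrK.
by apply: (unB_lt hn); apply: hs; rewrite ?fsubsetU1.
Qed.

Lemma nsum_shift (c : K -> V) x t : nsum n c x -> nsum n (fun l => c (l - t)) x.
Proof.
move=> h e e0; have [s hs] := h e e0.
exists [fset (l + t)%R | l in s]%fset => s' ss'.
have -> : \sum_(l <- s') c (l - t) = \sum_(l <- [fset (l - t)%R | l in s']%fset) c l.
  by rewrite big_imfset //= => x1 x2 _ _; apply: addIr.
apply: hs; apply/fsubsetP => l ls; apply/imfsetP; exists (l + t); rewrite ?addrK //.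
by apply: (fsubsetP ss'); apply/imfsetP; exists l.
Qed.

Lemma nsum_map (W : zmodType) (n' : W -> RT) (f : V -> W) (c : K -> V) x :
  {morph f : x y / x + y} ->
  (forall e, 0 < e -> exists2 d, 0 < d & forall y, n y < d -> n' (f y) < e) ->
  nsum n c x -> nsum n' (fun l => f (c l)) (f x).
Proof.
move=> fD hf h e e0; have [d d0 hd] := hf e e0; have [s hs] := h d d0.
have f0 : f 0 = 0 by apply: (addrI (f 0)); rewrite -fD !addr0.
exists s => t st; rewrite -(big_morph f fD f0).
set y := \sum_(l <- t) c l; have -> : f x - f y = f (x - y).
  by apply: (addIr (f y)); rewrite -fD !subrK.
by apply: hd; exact: hs.
Qed.
End Nsum.

(** The consequences for the base field of being a complete discretely
   valued extension of the [p]-adic numbers. By [pv_prec], the natural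
   numbers are precompact. *)
Record pvalued (RT : realType) (K : fieldType) (v : K -> RT) (w : K) : Prop := {
  pv_abs : is_absv v;
  pv_w : 0 < v w < 1;
  pv_disc : forall x, x != 0 -> exists n : int, v x = v w ^ n;
  pv_complete : complete v;
  pv_prec : forall e, 0 < e -> exists2 q, (0 < q)%N & v q%:R < e;
  pv_char0 : forall n, n%:R = 0 :> K -> n = 0%N }.

Lemma pv_natrI (RT : realType) (K : fieldType) (v : K -> RT) (w : K) :
  pvalued v w -> injective (fun n : nat => n%:R : K).
Proof.
move=> hp; have h m n : (m <= n)%N -> m%:R = n%:R :> K -> m = n.
  move=> mn e; have : (n - m)%:R = 0 :> K by rewrite natrB // e subrr.
  by move/(pv_char0 hp)/eqP; rewrite subn_eq0 => nm; apply/eqP; rewrite eqn_leq mn.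
move=> m n e; have [mn|/ltnW nm] := leqP m n; first exact: h.
by apply/esym/h.
Qed.

Section GradedAlg.
Context (RT : realType) (K : fieldType) (v : K -> RT) (w : K).
Context (cR : algType K) (nR : cR -> RT) (d : cR).

(** The weights of [ad d] on [cA] are natural numbers, and every element of
   [cA] is the convergent sum of its weight components. *)
Record weight_graded (cA : set cR) (An : nat -> set cR) : Prop := {
  ga_pv : pvalued v w;
  ga_banach : is_banach v nR;
  ga_ad : forall n a, An n a -> d * a = a * d + n%:R *: a;
  ga_exp : forall a, cA a -> exists c : K -> cR, nsum nR c a /\
    forall l, c l != 0 -> exists2 n, l = n%:R & An n (c l) }.

(** A Banach module over [cR], with a chosen bound for the action. *)
Record banach_mod (M : lmodType cR) (n : M -> RT) (C : RT) : Prop := {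
  bm_ultra : ultranorm n;
  bm_complete : complete n;
  bm_scale : forall (k : K) m, n (k%:A *: m) = v k * n m;
  bm_C0 : 0 < C;
  bm_C : forall r m, n (r *: m) <= C * nR r * n m }.

Definition shift (l : K) (j : nat) : cR := (d - l%:A) ^+ j.

Record weight_gens (cA : set cR) (M : lmodType cR) (T : finType) (lam : T -> K)
    (m : T -> M) (N : nat) : Prop := {
  wg_nil : forall i, shift (lam i) N *: m i = 0;
  wg_gen : forall x, exists a : T -> cR,
     (forall i, cA (a i)) /\ x = \sum_i a i *: m i }.

Lemma shiftD l j k : shift l (j + k) = shift l j * shift l k.
Proof. exact: exprD. Qed.

Lemma shift_horner l j : shift l j = horner_alg d (('X - l%:P) ^+ j).
Proof. by rewrite rmorphXn rmorphB /= horner_algX horner_algC. Qed.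

Lemma horner_algM P Q : horner_alg d (P * Q) = horner_alg d P * horner_alg d Q.
Proof. exact: rmorphM. Qed.

Lemma horner_taylor P l : horner_alg d P =
  \sum_(j < size (taylor l P)) (taylor l P)`_j *: shift l j.
Proof.
have {1}-> : P = taylor l P \Po ('X - l%:P).
  by rewrite /taylor -comp_polyA comp_polyD comp_polyX comp_polyC subrK comp_polyXr.
rewrite comp_polyE rmorph_sum /=; apply: eq_bigr => j _.
by rewrite -mul_polyC horner_algM horner_algC -scalerAl mul1r shift_horner.
Qed.

Context (cA : set cR) (An : nat -> set cR) (hA : weight_graded cA An).
Let hv := pv_abs (ga_pv hA).

Section Module.
Context (M : lmodType cR) (nM : M -> RT) (CM : RT) (hM : banach_mod nM CM).
Context (T : finType) (lam : T -> K) (m : T -> M) (N : nat).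
Let uM := bm_ultra hM.

Lemma bmod_act (r : cR) e : 0 < e ->
  exists2 d, 0 < d & forall y, nM y < d -> nM (r *: y) < e.
Proof.
move=> e0; have [d' [d0 h]] := act_small hv (ga_banach hA) uM (bm_C0 hM) (bm_C hM) r e0.
by exists d'.
Qed.

Lemma nil_ge l (y : M) j : shift l N *: y = 0 -> (N <= j)%N -> shift l j *: y = 0.
Proof. by move=> h Nj; rewrite -(subnK Nj) shiftD -scalerA h scaler0. Qed.

(** [P] at [d] acts on a vector of weight [l] through the Taylor expansion
   of [P] at [l], of which the first [N] terms remain. *)
Lemma horner_bound P l (y : M) c e : 0 <= c -> 0 <= e -> shift l N *: y = 0 ->
  (forall j, (j < N)%N -> nM (shift l j *: y) <= e) ->
  tbound v N l P c -> nM (horner_alg d P *: y) <= c * e.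
Proof.
move=> c0 e0 ly ye Pc; rewrite (horner_taylor P l) scaler_suml.
apply: (un_sum_le uM) => [|j _]; first exact: mulr_ge0.
have [jN|Nj] := ltnP j N; last first.
  by rewrite -mulr_algl -scalerA (nil_ge ly Nj) scaler0 (un0 uM) mulr_ge0.
rewrite -mulr_algl -scalerA (bm_scale hM).
by apply: ler_pM; rewrite ?(av_ge0 hv) ?(un_ge0 uM) ?Pc ?ye.
Qed.

Definition wset : set K := [set l | exists i n, l = lam i + n%:R].

(** If [q] is a small natural number, then [n] may be replaced by its
   remainder modulo [q]. *)
Lemma wset_precpt e : 0 < e -> exists s : seq K,
  forall mu, wset mu -> exists2 c, c \in s & v (mu - c) < e.
Proof.
move=> e0; have [q q0 hq] := pv_prec (ga_pv hA) e0.
exists [seq lam i + k%:R | i <- enum T, k <- iota 0 q] => mu [i [n ->]].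
exists (lam i + (n %% q)%:R).
  by apply: allpairs_f; rewrite ?mem_enum // mem_iota add0n ltn_mod.
rewrite opprD addrACA subrr add0r {1}(divn_eq n q) natrD addrK natrM (av_mul hv).
apply: le_lt_trans hq; rewrite ler_piMl ?(av_ge0 hv) //; exact: av_nat.
Qed.

(** [x] is the sum of generalised weight vectors [c l] with a common
   exponent [N]. The decay of [(d - l) ^ j] on the components bounds,
   uniformly in [l], the action of a polynomial on them. *)
Record expands (x : M) (c : K -> M) : Prop := {
  ex_nsum : nsum nM c x;
  ex_nil : forall l, shift l N *: c l = 0;
  ex_decay : forall j e, 0 < e -> exists s : {fset K}, forall l, l \notin s ->
    nM (shift l j *: c l) < e;
  ex_supp : forall l, c l != 0 -> wset l }.

Lemma expandsD x x' c c' : expands x c -> expands x' c' ->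
  expands (x + x') (fun l => c l + c' l).
Proof.
move=> [h1 h2 h3 h4] [h1' h2' h3' h4']; split.
- exact: nsumD.
- by move=> l; rewrite scalerDr h2 h2' addr0.
- move=> j e e0; have [s hs] := h3 j e e0; have [s' hs'] := h3' j e e0.
  exists (s `|` s')%fset => l; rewrite in_fsetU negb_or => /andP[ls ls'].
  by rewrite scalerDr; apply: (unD_lt uM); [exact: hs|exact: hs'].
move=> l; have [->|c0 _] := eqVneq (c l) 0; last exact: h4.
by rewrite add0r; exact: h4'.
Qed.

Lemma expands_act r x c : r * d = d * r -> expands x c ->
  expands (r *: x) (fun l => r *: c l).
Proof.
move=> rd [h1 h2 h3 h4].
have rs l j : r * shift l j = shift l j * r.
  apply: commrX; rewrite /GRing.comm mulrBr mulrBl rd.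
  by rewrite -scalerAl -scalerAr mul1r mulr1.
split.
- apply: (nsum_map (scalerDr r) _ h1) => e e0; exact: bmod_act.
- by move=> l; rewrite scalerA -rs -scalerA h2 scaler0.
- move=> j e e0; have [e' e'0 he'] := bmod_act r e0.
  have [s hs] := h3 j _ e'0; exists s => l ls.
  by rewrite scalerA -rs -scalerA; apply: he'; exact: hs.
by move=> l rc; apply: h4; apply: contraNneq rc => ->; rewrite scaler0.
Qed.

Lemma fset_gap (s : seq K) l : exists2 e, 0 < e &
  forall k, k \in s -> k != l -> e <= v (k - l).
Proof.
elim: s => [|k s [e e0 he]]; first by exists 1; rewrite ?ltr01.
have [kl|kl] := eqVneq k l.
  by exists e => // k'; rewrite inE => /predU1P[->|/he//]; rewrite kl eqxx.
exists (Num.min e (v (k - l))).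
  by rewrite lt_min e0 (av_neq0 hv) // subr_eq0.
move=> k'; rewrite inE => /predU1P[-> _|k's k'l].
  by rewrite ge_min lexx orbT.
by rewrite ge_min he.
Qed.

(** A polynomial in [d] that is close to 1 at [l], and to 0 at the finitely
   many other weights with a large component, sends [x] close to its
   component of weight [l]. *)
Lemma component_closed (U : submod M) x c l : nclosed nM [set` U] -> x \in U ->
  expands x c -> c l \in U.
Proof.
move=> cU xU [h1 h2 h3 h4].
have [->|cl0] := eqVneq (c l) 0; first exact: rpred0.
apply: cU => e e0; have e2 : 0 < e / 2 by rewrite divr_gt0.
have [s0 hs0] : exists s0 : {fset K}, forall k j, k \notin s0 -> (j < N)%N ->
    nM (shift k j *: c k) < e / 2.
  have /choice[s hs] := fun j => h3 j _ e2.
  exists (\bigcup_(j <- iota 0 N) s j)%fset => k j ks jN; apply: hs.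
  apply: contra ks => ks; apply/bigfcupP; exists j => //.
  by rewrite mem_iota add0n jN.
pose B := \sum_(k <- (l |` s0)%fset) \sum_(j < N) nM (shift k j *: c k).
have B0 : 0 <= B by apply: sumr_ge0 => k _; apply: sumr_ge0 => j _; exact: un_ge0.
have hB k j : k \in (l |` s0)%fset -> (j < N)%N -> nM (shift k j *: c k) <= B.
  move=> ks jN; rewrite /B (big_fsetD1 k) //= (bigD1 (Ordinal jN)) //= -addrA lerDl.
  by rewrite addr_ge0 //; repeat (apply: sumr_ge0 => ? _); exact: un_ge0.
have [g g0 hg] := fset_gap s0 l.
pose eta := e / 2 / (B + 1).
have B1 : 0 < B + 1 by rewrite ltr_wpDl.
have eta0 : 0 < eta by rewrite divr_gt0.
have etaB : eta * B <= e / 2.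
  by rewrite mulrAC ler_pdivrMr // ler_wpM2l ?(ltW e2) // lerDl ler01.
have [P hP] := kaplansky hv (pv_w (ga_pv hA)) (pv_disc (ga_pv hA)) wset_precpt l N g0 eta0.
pose Q := horner_alg d P.
have [g' g'0 hg'] := bmod_act Q e2.
have [s1 hs1] := h1 _ g'0.
pose s := (s1 `|` (l |` s0))%fset.
have hs : nM (x - \sum_(k <- s) c k) < g' by apply: hs1; exact: fsubsetUl.
exists (Q *: x); first exact: rpredZ.
rewrite (unC uM); have -> : Q *: x - c l = Q *: (x - \sum_(k <- s) c k) +
    \sum_(k <- s) (Q *: c k - if k == l then c k else 0).
  rewrite sumrB scalerBr scaler_sumr addrA subrK; congr (_ - _).
  rewrite (big_fsetD1 l) /=; last by rewrite !inE eqxx orbT.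
  rewrite eqxx big_seq big1 ?addr0 // => k; rewrite !inE.
  by case: (k == l).
apply: (le_lt_trans (y := e / 2)); last by rewrite ltr_pdivrMr ?ltr0n // ltr_pMr // ltr1n.
apply: (unD_le uM); first by apply: ltW; exact: hg'.
apply: (un_sum_le uM) => [|k _]; first exact: ltW.
have [->|kl] := eqVneq k l.
  have [_ /(_ erefl) hl _] := hP l (h4 _ cl0).
  have -> : Q *: c l - c l = horner_alg d (P - 1) *: c l.
    by rewrite rmorphB rmorph1 scalerBl scale1r.
  apply: le_trans etaB; apply: (horner_bound (ltW eta0) B0 (h2 l) _ hl) => j jN.
  by apply: hB => //; rewrite !inE eqxx.
rewrite subr0; have [->|ck0] := eqVneq (c k) 0.
  by rewrite scaler0 (un0 uM) ltW.
have [hP1 _ hPg] := hP k (h4 _ ck0).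
have [ks|ks] := boolP (k \in s0); last first.
  rewrite -[e / 2]mul1r; apply: (horner_bound ler01 (ltW e2) (h2 k) _ hP1) => j jN.
  by apply: ltW; exact: hs0.
apply: le_trans etaB; apply: (horner_bound (ltW eta0) B0 (h2 k) _ (hPg (hg _ ks kl))) => j jN.
by apply: hB => //; rewrite !inE ks orbT.
Qed.

(** Powers of distinct linear polynomials generate the unit ideal. *)
Lemma coprime_shift (U : submod M) l mu k (y : M) : l != mu ->
  shift l N *: y = 0 -> shift mu k *: y \in U -> y \in U.
Proof.
move=> lmu ly muy.
have : coprimep (('X - l%:P) ^+ N) (('X - mu%:P) ^+ k).
  apply: coprimep_expl; apply: coprimep_expr.
  by rewrite coprimep_XsubC root_XsubC eq_sym.
case/Bezout_eq1_coprimepP => -[p q] /= pq.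
rewrite -[y]scale1r -(rmorph1 (horner_alg d)) -pq rmorphD /= !horner_algM.
rewrite -!shift_horner scalerDl -!scalerA ly scaler0 add0r.
exact: rpredZ.
Qed.

Lemma shift_comm mu k : shift mu k * d = d * shift mu k.
Proof.
by apply/esym/commrX; rewrite /GRing.comm mulrBr mulrBl -scalerAl -scalerAr mul1r mulr1.
Qed.

(** If [x] is modulo [U] a generalised eigenvector of [d], then all of its
   components of other weights vanish modulo [U]. *)
Lemma expands_shift (U : submod M) x c mu k : nclosed nM [set` U] ->
  expands x c -> shift mu k *: x \in U -> forall l, l != mu -> c l \in U.
Proof.
move=> cU xc xU l lmu; apply: (coprime_shift (k := k) lmu (ex_nil xc l)).
exact: (component_closed l cU xU (expands_act (shift_comm mu k) xc)).
Qed.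

Lemma expands_in (U : submod M) x c : nclosed nM [set` U] -> expands x c ->
  (forall l, c l \in U) -> x \in U.
Proof.
move=> cU xc hc; apply: cU => e e0; have [s hs] := ex_nsum xc e0.
by exists (\sum_(l <- s) c l); [exact: rpred_sum|exact: hs].
Qed.

Fact zero_submod_closed : submod_closed (pred1 (0 : M)).
Proof.
split=> [|a x y /eqP-> /eqP->]; first exact: eqxx.
by rewrite scaler0 addr0; exact: eqxx.
Qed.
Definition zero_submod : submod M := Submod zero_submod_closed.
Lemma zero_submodP x : x \in zero_submod <-> x = 0.
Proof. by split=> /eqP. Qed.
Lemma zero_submod_nclosed : nclosed nM [set` zero_submod].
Proof.
move=> x hx; apply/zero_submodP/(un_small0 uM) => e e0.
by have [y /zero_submodP-> ] := hx e e0; rewrite subr0.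
Qed.

(** The zero submodule is closed. *)
Lemma expands0 c : expands 0 c -> forall l, c l = 0.
Proof.
move=> h l; apply/zero_submodP.
by apply: (component_closed l zero_submod_nclosed _ h); apply/zero_submodP.
Qed.

Lemma expands_uniq x c c' : expands x c -> expands x c' -> c = c'.
Proof.
move=> h h'; apply/funext => l; apply/eqP; rewrite -subr_eq0; apply/eqP.
have hm : expands (- x) (fun l => - c' l).
  have := @expands_act (-1) _ _ _ h'; rewrite mulrN1 mulN1r scaleN1r => /(_ erefl).
  by under eq_fun do rewrite scaleN1r.
by have := expandsD h hm; rewrite subrr => /expands0/(_ l).
Qed.

(** The span of the homogeneous multiples of the generators that have weight
   [l]. It contains the component of weight [l] of every vector, and is
   finite-dimensional as soon as the [An n] are. *)
Definition wspace (l : K) : set M := [set y | exists2 u : T -> cR,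
  y = \sum_i u i *: m i &
  forall i, u i != 0 -> exists2 n, l = lam i + n%:R & An n (u i)].

Lemma shift_ad t a mu j : d * a = a * d + t *: a ->
  shift (mu + t) j * a = a * shift mu j.
Proof.
move=> ha; have h1 : (d - (mu + t)%:A) * a = a * (d - mu%:A).
  rewrite mulrBl mulrBr ha -scalerAl -scalerAr mul1r mulr1.
  by rewrite scalerDl opprD addrA addrAC addrK.
elim: j => [|j IH]; first by rewrite /shift !expr0 mul1r mulr1.
by rewrite /shift exprSr -mulrA h1 mulrA -/(shift _ _) IH -mulrA -exprSr.
Qed.

Lemma shift_mul n a mu j : An n a -> shift (mu + n%:R) j * a = a * shift mu j.
Proof.
by move=> /(ga_ad hA); exact: shift_ad.
Qed.

Lemma wspace_supp l y : wspace l y -> y != 0 -> wset l.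
Proof.
move=> [u -> hu] y0; apply: contrapT => hl; move/eqP: y0; apply.
apply: big1 => i _; have [->|/hu[n ln _]] := eqVneq (u i) 0; first by rewrite scale0r.
by case: hl; exists i, n.
Qed.

Context (hW : weight_gens cA lam m N).

(** Expand the coefficients of [x] on the generators by degree: a component
   of degree [n] raises the weight of a generator by [n]. *)
Lemma expands_ex x : exists2 c, expands x c & forall l, wspace l (c l).
Proof.
have [a [ha ->]] := wg_gen hW x.
have /choice[c hc] := fun i => ga_exp hA (ha i).
pose f i l := c i (l - lam i) *: m i.
have Anc i l : c i (l - lam i) != 0 ->
    exists2 n, l = lam i + n%:R & An n (c i (l - lam i)).
  move=> c0; have [n ln hn] := (hc i).2 _ c0; exists n => //.
  by rewrite -ln addrC subrK.
have fs i l j : shift l j *: f i l = c i (l - lam i) *: (shift (lam i) j *: m i).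
  rewrite /f !scalerA; congr (_ *: _).
  have [->|/Anc[n ln hn]] := eqVneq (c i (l - lam i)) 0; first by rewrite mulr0 mul0r.
  by rewrite {1}ln (shift_mul _ _ hn).
have nsf i y : nsum nM (fun l => c i (l - lam i) *: y) (a i *: y).
  have hc1 := nsum_shift (lam i) (hc i).1.
  apply: (nsum_map (f := fun r => r *: y) _ _ hc1) => [r r'|e e0]; first exact: scalerDl.
  pose b := CM * (nM y + 1).
  have b0 : 0 < b by rewrite mulr_gt0 ?(bm_C0 hM) // ltr_wpDl ?(un_ge0 uM).
  exists (e / b); first exact: divr_gt0.
  move=> r; rewrite ltr_pdivlMr // => hr; apply: le_lt_trans (bm_C hM _ _) _.
  apply: le_lt_trans hr; rewrite /b.
  have r0 := un_ge0 (banach_ultra hv (ga_banach hA)) r.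
  by have := mulr_ge0 (ltW (bm_C0 hM)) r0; lra.
exists (fun l => \sum_i f i l).
  split.
  - by apply: nsum_sum => // i; exact: nsf.
  - by move=> l; rewrite scaler_sumr big1 // => i _; rewrite fs (wg_nil hW) scaler0.
  - move=> j e e0.
    have [s hs] : exists s : {fset K}, forall l, l \notin s -> forall i,
        nM (shift l j *: f i l) < e.
      have /choice[s hs] := fun i => nsum_small uM (nsf i (shift (lam i) j *: m i)) e0.
      exists (\bigcup_(i <- enum T) s i)%fset => l ls i; rewrite fs; apply: hs.
      by apply: contra ls => ls; apply/bigfcupP; exists i; rewrite ?mem_enum.
    exists s => l ls; rewrite scaler_sumr; apply: (un_sum_lt uM) => // i _.
    exact: hs.
  move=> l; apply: (@wspace_supp l); exists (fun i => c i (l - lam i)) => // i; exact: Anc.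
by move=> l; exists (fun i => c i (l - lam i)) => // i; exact: Anc.
Qed.
End Module.
End GradedAlg.

(** * Consequences of the triangular decomposition *)

(** On the natural numbers the absolute value is the [p]-adic one, for which
   the powers of [p] tend to 0. *)
Lemma cdv_pvalued (RT : realType) (p : nat) (p_prime : prime p)
    (Qp K : fieldType) (vp : Qp -> RT) (v : K -> RT)
    (iota : {rmorphism Qp -> K}) : is_cdv_ext p vp v iota ->
  exists w, pvalued v w.
Proof.
case=> hQp hv hext cv [w hw hdisc]; exists w.
have vn n : v n%:R = padic_abs RT p n%:R.
  by rewrite -(rmorph_nat iota) hext -(qp_padic hQp) ratr_nat.
have p1 := prime_gt1 p_prime.
have p0 : (0 : RT) < p%:R by rewrite ltr0n prime_gt0.
split=> //.
- move=> e e0; have vp1 : v p%:R = p%:R^-1.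
    rewrite vn /padic_abs pnatr_eq0 (gtn_eqF (prime_gt0 p_prime)).
    rewrite (pmulrn (1 : rat) p) denq_int numq_int !absz_nat logn1.
    by rewrite logn_prime // eqxx sub0r exprN1.
  have [m hm] : exists m, v p%:R ^+ m < e.
    apply: geo_small => //; rewrite vp1 invr_ge0 (ltW p0) invf_lt1 //.
    by rewrite ltr1n.
  exists (p ^ m)%N; first by rewrite expn_gt0 prime_gt0.
  by rewrite natrX (avX hv).
move=> n n0; apply/eqP; apply: contraT => nn0.
have := vn n; rewrite n0 (av0 hv) /padic_abs pnatr_eq0 (negbTE nn0).
by move/esym/eqP; rewrite expfz_eq0 (gt_eqF p0) andbF.
Qed.

Lemma nclosure_nclosed (RT : realType) (V : zmodType) (n : V -> RT)
  (hn : ultranorm n) (P : set V) : nclosed n (nclosure n P).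
Proof.
move=> x hx e e0; have [y hy xy] := hx e e0; have [z Pz yz] := hy e e0.
by exists z => //; rewrite -(subrK y x) -addrA; exact: (unD_lt hn).
Qed.

Section Subalg.
Context (K : fieldType) (R : algType K) (S : subalg R).
Lemma subalg_valM (x y : salg S) : val (x * y) = val x * val y.
Proof. by []. Qed.
Lemma subalg_valZ (k : K) (x : salg S) : val (k *: x) = k *: val x.
Proof. by []. Qed.
Lemma subalg_valD (x y : salg S) : val (x + y) = val x + val y.
Proof. by []. Qed.
Lemma subalg_sum (I : Type) (r : seq I) (P : pred I) (F : I -> salg S) :
  val (\sum_(i <- r | P i) F i) = \sum_(i <- r | P i) val (F i).
Proof. exact: raddf_sum. Qed.
End Subalg.

Section GradedPart.
Context (RT : realType) (K : fieldType) (v : K -> RT) (w : K) (hp : pvalued v w).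
Context (cR : algType K) (nR : cR -> RT) (hcR : is_banach_alg v nR).
Context (R : subalg cR) (gr : int -> submod (salg R)).
Context (A B H : subalg (salg R)) (d : salg R) (cA cB : subalg cR).
Context (htri : banach_tridec v nR gr A B H d cA cB).
Let hv := pv_abs hp.
Let uR := banach_ultra hv hcR.1.
Let halg := btd_alg htri.
Let hgr := atd_grading halg.

Lemma closed_subalg_banach (C : subalg cR) : nclosed nR [set` C] ->
  is_banach_alg v (fun x : salg C => nR (val x)).
Proof.
have [[h1 h2 h3 h4 h5] [c hc]] := hcR.
move=> cC; split; last by exists c => x y; exact: hc.
split=> //.
- move=> x; split=> [/h2 x0|->]; first exact: val_inj.
  exact: (un0 uR).
- move=> k x; exact: h3.
- by move=> x y; exact: h4.
move=> u hu; have [l hl] := h5 (fun k => val (u k)) hu.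
have lC : l \in C.
  by apply: (tends_closed uR cC (u := fun k => val (u k))) hl => k; exact: valP.
by exists (exist _ l lC).
Qed.

Definition hompart (P : subalg (salg R)) (n : int) : set cR :=
  [set x | exists a : salg R, [/\ a \in P, a \in gr n & x = val a]].

(** By uniqueness of homogeneous components, a nonzero component of an
   eigenvector of [ad d] has the same eigenvalue, which is its degree. *)
Lemma weight_homogeneous (P : subalg (salg R)) a l : graded_subalg gr P ->
  a \in P -> ad d a = l *: a -> a != 0 -> exists2 n : int, l = n%:~R & a \in gr n.
Proof.
move=> hP aP al a0; have [s [c [hc ac]]] := hP _ aP.
have [_ _ _ huniq] := hgr.
have dc n : ad d (c n) = n%:~R *: c n by apply/(atd_gr halg); case: (hc n).
have h0 : \sum_(n <- s) (n%:~R - l) *: c n = 0.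
  under eq_bigr do rewrite scalerBl -dc.
  rewrite sumrB -scaler_sumr -ac -al ac /ad mulr_sumr mulr_suml -sumrB.
  by rewrite subrr.
have hz : forall n, n \in s -> (n%:~R - l) *: c n = 0.
  apply: huniq h0 => n.
  apply/(atd_gr halg); rewrite /ad -scalerAr -scalerAl -scalerBr -/(ad d (c n)) dc.
  by rewrite !scalerA mulrC.
have [n ns cn] : exists2 n, n \in s & c n != 0.
  apply: contrapT => h; case/eqP: a0; rewrite ac big_seq big1 // => n ns.
  by apply: contrapT => /eqP cn; apply: h; exists n.
have ln : l = n%:~R.
  have /eqP := hz n ns; rewrite scaler_eq0 (negbTE cn) orbF subr_eq0.
  by move/eqP.
by exists n => //; apply/(atd_gr halg); rewrite al ln.
Qed.

(** By the equality of [ws_part] with the algebraic part, the components of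
   the weight decomposition are homogeneous elements of [P]. *)
Lemma hom_expand (S : subalg cR) (P : subalg (salg R)) : graded_subalg gr P ->
  has_ss_weight_dec nR (ad (val d)) [set` S] ->
  ws_part (ad (val d)) [set` S] = im [set` P] ->
  forall a, a \in S -> exists c : K -> cR, nsum nR c a /\
    forall l, c l != 0 -> exists2 n : int, l = n%:~R & hompart P n (c l).
Proof.
move=> hP [I [[Iw hI] Iss]] hws a aS; have [c [hc hs]] := hI _ aS.
exists (fun l => if `[< I l >] then c l else 0); split.
  move=> e e0; have [s0 s0I hs0] := hs e e0; exists s0 => s s0s.
  have -> : \sum_(l <- s) (if `[< I l >] then c l else 0) =
      \sum_(l <- [fset l in s | `[< I l >]]%fset) c l.
    by rewrite -big_mkcond big_fset.
  apply: hs0 => l /=; last by rewrite !inE => /andP[_ /asboolP].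
  move=> ls; rewrite !inE; apply/andP; split; first exact: (fsubsetP s0s).
  by apply/asboolP/s0I.
move=> l; case: asboolP => [Il cl0|]; last by rewrite eqxx.
have [a' /= a'P ca'] : im [set` P] (c l).
  rewrite -hws; exists [fset l]%fset, c; split; last by rewrite big_seq_fset1.
  by move=> k; rewrite inE => /eqP->; split; [exact: Iw|exact: hc].
have al : ad d a' = l *: a'.
  by apply: val_inj; have := Iss l _ Il (hc l Il); rewrite -ca'.
have a'0 : a' != 0 by apply: contraNneq cl0 => h; rewrite -ca' h.
have [n ln a'n] := weight_homogeneous hP a'P al a'0.
by exists n => //; exists a'.
Qed.

Lemma closure_banach (S : subalg cR) (P : set (salg R)) :
  [set` S] = nclosure nR (im P) -> nclosed nR [set` S].
Proof. by move=> ->; exact: (nclosure_nclosed uR). Qed.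

Definition Apart (n : nat) : set cR := hompart A n%:Z.

Lemma cA_galg : weight_graded v w nR (val d) [set` cA] Apart.
Proof.
split=> //; first exact: hcR.1.
  move=> n _ [a [_ /(atd_gr halg) an ->]].
  by apply/eqP; rewrite addrC -subr_eq; apply/eqP; exact: (congr1 val an).
move=> a aA; have [c [h1 h2]] :=
  hom_expand (atd_gradA halg) (btd_ssA htri) (btd_wsA htri) aA.
exists c; split=> // l cl0; have [[n|n] ln hn] := h2 l cl0; first by exists n.
case: hn cl0 => a' [a'A a'n ->].
by rewrite (atd_Apos halg _ a'A a'n) // eqxx.
Qed.

Lemma cB_expand b : b \in cB -> exists c : K -> cR, nsum nR c b /\
  forall l, c l != 0 ->
    (l = 0 /\ exists k : K, c l = k%:A) \/
    (l != 0 /\ exists2 b' : salg R, (b' \in B /\ exists2 n : int, n < 0 & b' \in gr n) &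
       c l = val b').
Proof.
move=> bB; have [c [h1 h2]] :=
  hom_expand (atd_gradB halg) (btd_ssB htri) (btd_wsB htri) bB.
exists c; split=> // l cl0; have [n ln [b' [b'B b'n cb']]] := h2 l cl0.
have [n0|n0|n0] := ltgtP n 0.
- right; split; last by exists b' => //; split=> //; exists n.
  case: n ln n0 {b'n} => // n -> _; rewrite NegzE mulrNz oppr_eq0.
  by apply/eqP => /(pv_char0 hp).
- by move: cl0; rewrite cb' (atd_Bneg halg n0 b'B b'n) eqxx.
left; split; first by rewrite ln n0.
have /(atd_B0 halg)[k hk] : (b' \in B) && (b' \in gr 0) by rewrite b'B -n0.
by exists k; rewrite cb' hk.
Qed.

(** The projection to the quotient by [N] extends the zero trilinear map,
   hence is zero by uniqueness. *)
Lemma tensor_ind (N : submod (salg R : lmodType K)) :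
  (forall (a : salg A) (h : salg H) (b : salg B), val a * val h * val b \in N) ->
  forall x, x \in N.
Proof.
move=> hN x; have [_ hT] := atd_tensor halg.
have h0 : trilinear (fun (_ : salg A) (_ : salg H) (_ : salg B) => 0 : quotmod N).
  by split=> ? ? k ? ?; rewrite scaler0 addr0.
have [f [_ fu]] := hT _ _ h0.
have f1 : f = fun=> 0.
  by apply: fu; split=> // k y z; rewrite scaler0 addr0.
have f2 : f = \pi_(quotmod N).
  apply: fu; split.
    by move=> k y z; rewrite quotmod_piD -quotmod_piZ.
  move=> a h b; have -> : 0 = \pi_(quotmod N) 0 :> quotmod N.
    by apply: (addrI (\pi_(quotmod N) 0)); rewrite -quotmod_piD !addr0.
  by apply/quotmod_piP; rewrite subr0.
rewrite -[x]subr0; apply/quotmod_piP.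
by rewrite -f2 f1.
Qed.

Definition Bneg : set (salg R) :=
  [set b | b \in B /\ exists2 n : int, n < 0 & b \in gr n].
(** The left ideal generated by [Bneg], as the intersection of the left
   ideals containing it. *)
Definition LBneg : set (salg R) :=
  [set t | forall J : submod (salg R)^o, (forall b, Bneg b -> b \in J) -> t \in J].

(** Expand [d] into products [a * h * b] of homogeneous elements. In degree
   0, either [b] has negative degree and the product is in the left ideal,
   or [a] and [b] are scalars and the product is in [H]. *)
Lemma d_decomp : exists d0 : salg R, d0 \in H /\ LBneg (d - d0).
Proof.
have [g1 gM gS gU] := hgr.
have LB0 : LBneg 0 by move=> J _; exact: rpred0.
pose G0 : set (salg R) := [set x | exists2 h, h \in H & LBneg (x - h)].
have G00 : G0 0 by exists 0; rewrite ?rpred0 // subr0.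
have G0D (k : K) x y : G0 x -> G0 y -> G0 (k *: x + y).
  move=> [h hH xh] [h' hH' yh']; exists (k *: h + h'); first by rewrite rpredD ?rpredZ.
  move=> J hJ; rewrite opprD addrACA -scalerBr; apply: rpredD; last exact: yh'.
  by rewrite -mulr_algl; apply: (rpredZ k%:A); exact: xh.
(* Sums of homogeneous elements whose component of degree 0 is in [G0]. *)
pose Q : set (salg R) := [set x | exists (s : {fset int}) (c : int -> salg R),
  [/\ forall n, c n \in gr n, forall n, n \notin s -> c n = 0,
      x = \sum_(n <- s) c n & G0 (c 0)]].
have Qhom n x : x \in gr n -> (n = 0 -> G0 x) -> Q x.
  move=> xn x0; exists [fset n]%fset, (fun k => if k == n then x else 0); split.
  - by move=> k; case: eqP => [->|_] //; exact: rpred0.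
  - by move=> k; rewrite inE => /negbTE->.
  - by rewrite big_seq_fset1 eqxx.
  by case: eqP => // /esym /x0.
have grZ n (k : K) x : x \in gr n -> k *: x \in gr n.
  move=> /(atd_gr halg) h; apply/(atd_gr halg).
  by rewrite /ad -scalerAr -scalerAl -scalerBr -/(ad d x) h !scalerA mulrC.
have Q0 : Q 0 by apply: (Qhom 0) => //; exact: rpred0.
have QD' (k : K) x y : Q x -> Q y -> Q (k *: x + y).
  move=> [s [c [h1 h2 xc h4]]] [s' [c' [h1' h2' xc' h4']]].
  exists (s `|` s')%fset, (fun n => k *: c n + c' n); split.
  - by move=> n; rewrite rpredD // grZ.
  - by move=> n; rewrite inE negb_or => /andP[ns ns']; rewrite h2 // h2' // scaler0 addr0.
  - rewrite big_split -scaler_sumr; congr (_ *: _ + _).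
      rewrite xc; apply: big_fset_incl; first exact: fsubsetUl.
      by move=> n _ ns; exact: h2.
    rewrite xc'; apply: big_fset_incl; first exact: fsubsetUr.
    by move=> n _ ns; exact: h2'.
  exact: G0D.
have QD x y : Q x -> Q y -> Q (x + y).
  by move=> Qx Qy; rewrite -[x]scale1r; exact: QD'.
have QZ (k : K) x : Q x -> Q (k *: x).
  by move=> Qx; rewrite -[_ *: _]addr0; exact: QD'.
have Qsum (s : seq int) (F : int -> salg R) : (forall n, Q (F n)) -> Q (\sum_(n <- s) F n).
  move=> hF; elim/big_rec: _ => // n x _ Qx; exact: QD.
have all_Q x : Q x.
  apply/(mksubP Q0 QD QZ); apply: tensor_ind => a h b; apply/mksubP.
  have [s [c [hc ->]]] := atd_gradA halg (valP a).
  have [s' [c' [hc' ->]]] := atd_gradB halg (valP b).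
  rewrite !mulr_suml; apply: (Qsum) => m; rewrite mulr_sumr; apply: Qsum => n.
  have [cm cA'] := hc m; have [cn cB'] := hc' n.
  have hH : val h \in gr 0 by apply: (atd_H0 halg); exact: valP.
  apply: (Qhom (m + n)).
    apply: (gM) => //; have := gM _ _ _ _ cm hH; rewrite addr0; exact.
  move=> mn0.
  have Gz z : z = 0 -> G0 (c m * val h * z).
    by move=> ->; rewrite mulr0.
  have [n0|n0|n0] := ltgtP n 0.
  - exists 0; first exact: rpred0.
    rewrite subr0 => J hJ; apply: (rpredZ (c m * val h)).
    by apply: hJ; split=> //; exists n.
  - by apply: Gz; exact: (atd_Bneg halg n0).
  have m0 : m = 0 by rewrite -mn0 n0 addr0.
  have /(atd_A0 halg)[k ->] : (c m \in A) && (c m \in gr 0) by rewrite cA' -m0.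
  have /(atd_B0 halg)[k' ->] : (c' n \in B) && (c' n \in gr 0) by rewrite cB' -n0.
  exists (k%:A * val h * k'%:A); last by rewrite subrr.
  by rewrite mulr_algr mulr_algl !rpredZ //; exact: valP.
have [s [c [h1 h2 dc [h0 h0H hd]]]] := all_Q d.
exists h0; split=> //; suff -> : d = c 0 by [].
have dE : \sum_(n <- (0 |` s)%fset) (if n == 0 then d else 0) = d.
  rewrite (big_fsetD1 0) ?inE ?eqxx //= big_seq big1 ?addr0 // => n.
  by rewrite !inE => /andP[/negbTE->].
have : \sum_(n <- (0 |` s)%fset) (c n - if n == 0 then d else 0) = 0.
  rewrite sumrB dE; apply/eqP; rewrite subr_eq0 eq_sym; apply/eqP; rewrite {1}dc.
  apply: big_fset_incl; first exact: fsubsetU1.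
  by move=> n _ ns; exact: h2.
move/gU => /(_ _ 0); rewrite !inE eqxx => h; apply/eqP; rewrite eq_sym -subr_eq0.
apply/eqP; apply: h => // n; case: eqP => [->|_]; last by rewrite subr0.
by rewrite rpredB // (atd_d0 halg).
Qed.
End GradedPart.

(** * The completion of [B H] modulo the negative part of [B] *)

Section BorelPart.
Context (RT : realType) (K : fieldType) (v : K -> RT) (w : K) (hp : pvalued v w).
Context (cR : algType K) (nR : cR -> RT) (hcR : is_banach_alg v nR).
Context (R : subalg cR) (gr : int -> submod (salg R)).
Context (A B H : subalg (salg R)) (d : salg R) (cA cB : subalg cR).
Context (htri : banach_tridec v nR gr A B H d cA cB).
Context (cB_noeth : noetherian (salg cB)).
Context (cBH : subalg cR) (hcBH : is_cBH nR B H cBH).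
Let hv := pv_abs hp.
Let uR := banach_ultra hv hcR.1.
Let halg := btd_alg htri.

Lemma mul_bound : exists2 C, 0 < C & forall x y : cR, nR (x * y) <= C * nR x * nR y.
Proof.
have [_ [C hC]] := hcR; exists (Num.max C 1); first by rewrite lt_max ltr01 orbT.
move=> x y; apply: le_trans (hC x y) _; rewrite -!mulrA.
by rewrite ler_wpM2r ?mulr_ge0 ?(un_ge0 uR) // le_max lexx.
Qed.

Lemma lin_small (V : zmodType) (nV : V -> RT) (f : cR -> V) C e : 0 < e ->
  (forall x, nV (f x) <= C * nR x) -> exists2 e', 0 < e' &
  forall x, nR x < e' -> nV (f x) < e.
Proof.
move=> e0 hC; have C0 : 0 < Num.max C 1 by rewrite lt_max ltr01 orbT.
exists (e / Num.max C 1); first exact: divr_gt0.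
move=> x; rewrite ltr_pdivlMr // => hx; apply: le_lt_trans (hC x) _.
apply: le_lt_trans hx; rewrite mulrC ler_wpM2l ?(un_ge0 uR) //.
by rewrite le_max lexx.
Qed.

Lemma val2_sum (I : finType) (c : I -> K) (e : I -> salg H) :
  val (val (\sum_i c i *: e i)) = \sum_i c i *: val (val (e i)).
Proof.
rewrite (subalg_sum (S := H)) (subalg_sum (S := R)); apply: eq_bigr => i _.
transitivity (val (c i *: val (e i)));
  [congr (val _); exact: subalg_valZ|exact: subalg_valZ].
Qed.

Lemma H_basis : exists m (e : 'I_m -> salg H), lin_indep e /\ forall h, span e h.
Proof.
have [r [g [_ hg]]] := atd_Hfin halg.
have [m [e [he _ hs]]] := basis_extract g.
by exists m, e; split=> // h; apply: hs; exact: hg.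
Qed.

Lemma in_cBH x : im (prod_span [set` B] [set` H]) x -> x \in cBH.
Proof. by move=> hx; have : [set` cBH] x by rewrite hcBH; exact: (nclosure_sub uR). Qed.

Lemma prod_span1 (P Q : set (salg R)) x y : P x -> Q y -> prod_span P Q (x * y).
Proof.
move=> Px Qy; exists 1%N, (fun=> x), (fun=> y); split=> //.
by rewrite big_ord1.
Qed.

Lemma H_sub_cBH (h : salg R) : h \in H -> val h \in cBH.
Proof.
move=> hH; apply: in_cBH; exists h => //; rewrite -[h]mul1r.
by apply: prod_span1 => //=; exact: rpred1.
Qed.

Lemma B_sub_cBH (b : salg R) : b \in B -> val b \in cBH.
Proof.
move=> bB; apply: in_cBH; exists b => //; rewrite -[b]mulr1.
by apply: prod_span1 => //=; exact: rpred1.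
Qed.

Lemma cBH_closed : nclosed nR [set` cBH].
Proof. by rewrite hcBH; exact: (nclosure_nclosed uR). Qed.

Lemma cB_closed : nclosed nR [set` cB].
Proof. exact: (closure_banach hp hcR (btd_cB htri)). Qed.

Lemma cB_sub_cBH x : x \in cB -> x \in cBH.
Proof.
move=> xB; apply: cBH_closed.
have : [set` cB] x by [].
rewrite (btd_cB htri) => h e e0; have [_ [y yB <-] xy] := h e e0.
by exists (val y) => //; exact: B_sub_cBH.
Qed.

Definition H_cBH (h : salg H) : salg cBH := exist _ (val (val h)) (H_sub_cBH (valP h)).
Definition cB_cBH (b : salg cB) : salg cBH := exist _ (val b) (cB_sub_cBH (valP b)).

Local Notation J := (cBHpos gr B H cBH).

Lemma cBHpos_mulr y z : y \in J -> y * z \in J.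
Proof.
by move=> /asboolP hy; apply/asboolP => I IM IP; apply: (IM); exact: hy.
Qed.
Lemma cBHpos_mull y z : y \in J -> z * y \in J.
Proof. by move=> hy; exact: (rpredZ z hy). Qed.
Lemma cBHpos_gen y : im (BHpos gr B H) (val y) -> y \in J.
Proof. by move=> hy; apply/asboolP => I IM IP; exact: IP. Qed.

Lemma cBHpos_Bneg y b : Bneg gr B b -> val y = val b -> y \in J.
Proof.
move=> hb yb; apply: cBHpos_gen; exists b => //; rewrite -[b]mulr1.
by apply: prod_span1 => //=; exact: rpred1.
Qed.

Definition cBpos_pred : {pred (salg cB)^o} := fun b => cB_cBH b \in J.
Fact cBpos_closed : submod_closed cBpos_pred.
Proof.
split=> [|a x y xJ yJ].
  rewrite /in_mem /= /cBpos_pred; have -> : cB_cBH 0 = 0 by exact: val_inj.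
  exact: rpred0.
rewrite /in_mem /= /cBpos_pred.
have -> : cB_cBH (a *: x + y) = cB_cBH a * cB_cBH x + cB_cBH y by exact: val_inj.
by have [_ JD _] := submod_set J; apply: JD => //; exact: cBHpos_mull.
Qed.
Definition cBpos : submod (salg cB)^o := Submod cBpos_closed.

(** The ideal meets the completion of [B] in a left ideal, which is closed
   since that algebra is noetherian; it contains the homogeneous components
   of [b] of nonzero degree, and the component of degree 0 is a scalar. *)
Lemma cB_split (b : salg cB) : exists k : K, cB_cBH (b - k%:A) \in J.
Proof.
have [c [bc hc]] := cB_expand hp htri (valP b).
have c0 : exists k : K, c 0 = k%:A.
  have [->|c00] := eqVneq (c 0) 0; first by exists 0; rewrite scale0r.
  by case: (hc 0 c00) => [[_ //]|[]]; rewrite eqxx.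
have [k ck] := c0.
exists k; have fg1 : fin_gen [set: (salg cB)^o].
  exists 1%N, (fun=> 1); split=> // x _; exists (fun=> x).
  by rewrite big_ord1 /GRing.scale /= mulr1.
have bcB := closed_subalg_banach hp hcR cB_closed.
have ub := banach_ultra hv bcB.1.
have [C C0 hC] := mul_bound.
suff : b - k%:A \in cBpos by [].
have cl : nclosed (fun x : (salg cB)^o => nR (val x)) [set` cBpos].
  apply: (@submod_nclosed _ _ v hv w (pv_w hp) _ _ bcB.1 cB_noeth.1 (salg cB)^o
    _ ub (bn_complete bcB.1) _ C C0 _ cBpos fg1).
  - by move=> k' x; rewrite -(bn_scale bcB.1) /GRing.scale /= mulr_algl.
  - by move=> x y; exact: hC.
apply: cl.
move=> e e0; have [s0 hs0] := bc e e0; have hs := hs0 _ (fsubsetU1 0 s0).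
have /choice[f hf] l : exists y : salg cB, l != 0 -> val y = c l /\ y \in cBpos.
  have [->|l0] := eqVneq l 0; first by exists 0.
  have [cl0|cl0] := eqVneq (c l) 0; first by exists 0; rewrite cl0; have [h _ _] := submod_set cBpos.
  case: (hc l cl0) => [[l0']|[_ [b' hb' cb']]]; first by rewrite l0' eqxx in l0.
  have b'B : c l \in cB.
    have : [set` cB] (c l); last by [].
    rewrite (btd_cB htri); apply: (nclosure_sub uR); exists b' => //.
    by case: hb'.
  exists (exist _ (c l) b'B) => _; split=> //.
  by apply: (cBHpos_Bneg hb').
exists (\sum_(l <- ((0 |` s0) `\ 0)%fset) f l).
  rewrite /= big_seq; apply: (submod_sum (N := cBpos)) => l; rewrite in_fsetD1 => /andP[l0 _].
  exact: (hf l l0).2.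
have -> : val (b - k%:A - \sum_(l <- ((0 |` s0) `\ 0)%fset) f l) =
    val b - \sum_(l <- (0 |` s0)%fset) c l.
  rewrite [in RHS](big_fsetD1 0) ?inE ?eqxx //= opprD addrA ck; congr (_ - _ - _).
  rewrite subalg_sum big_seq [RHS]big_seq; apply: eq_bigr => l; rewrite !inE => /andP[l0 _].
  exact: (hf l l0).1.
exact: hs.
Qed.

Lemma bounded_coord m (e : 'I_m -> salg H) : lin_indep e -> (forall h, span e h) ->
  exists phi : 'I_m -> salg H -> K, [/\ forall i, linear (phi i : salg H -> K^o),
    forall h, h = \sum_i phi i h *: e i &
    exists2 C, 0 <= C & forall i h, v (phi i h) <= C * nR (val (val h))].
Proof.
move=> he /choice[phi hphi]; exists (fun i h => phi h i); split=> //.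
  move=> i k x y; apply/eqP; rewrite -subr_eq0; apply/eqP; move: i.
  apply: he; under eq_bigr do rewrite scalerBl scalerDl -scalerA.
  by rewrite sumrB big_split /= -scaler_sumr -!hphi subrr.
have [|C [C0 hC]] := coord_bound hv (pv_complete hp) uR (bn_scale hcR.1)
    (e := fun i => val (val (e i)) : cR).
  move=> c hc; apply: he; apply: val_inj; apply: val_inj.
  by rewrite val2_sum; exact: hc.
exists C => // i h; have -> : val (val h) = \sum_j phi h j *: val (val (e j)).
  by rewrite {1}(hphi h) val2_sum.
exact: hC.
Qed.

(** By the universal property of the decomposition of [cR], there are
   continuous maps [f i] with [f i (a * h * b) = phi i h *: (a * b)], [phi
   i] being the coordinates of [H]. The expansion [s = \sum_i e i * f i s]
   holds for [s] in [H B], and extends by continuity. *)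
Lemma cBH_coord m (e : 'I_m -> salg H) : lin_indep e -> (forall h, span e h) ->
  forall s, s \in cBH -> exists b : 'I_m -> salg cB, s = \sum_i val (val (e i)) * val (b i).
Proof.
move=> he hs; have [phi [phiL phiE [Cp Cp0 hCp]]] := bounded_coord he hs.
have [C C0 hC] := mul_bound.
have [_ hT] := btd_tensor htri.
have /choice[f hf] (i : 'I_m) : exists f : cR -> cR, bounded_linear nR nR f /\
    forall (a : salg cA) (h : salg H) (b : salg cB),
      f (val a * val (val h) * val b) = phi i h *: (val a * val b).
  have tri : bounded_trilinear (fun a : salg cA => nR (val a))
     (fun h : salg H => nR (val (val h))) (fun b : salg cB => nR (val b)) nR
     (fun a h b => phi i h *: (val a * val b)).
    split; first split.
    - by move=> y z k x x'; rewrite subalg_valD mulrDl -scalerAl scalerDr !scalerA mulrC.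
    - by move=> y z k x x'; rewrite phiL scalerDl scalerA.
    - by move=> y z k x x'; rewrite subalg_valD mulrDr -scalerAr scalerDr !scalerA mulrC.
    exists (Cp * C) => x y z; rewrite (bn_scale hcR.1).
    have -> : Cp * C * nR (val x) * nR (val (val y)) * nR (val z) =
      (Cp * nR (val (val y))) * (C * nR (val x) * nR (val z)) by ring.
    by apply: ler_pM; rewrite ?(av_ge0 hv) ?(un_ge0 uR).
  by have [f [h _]] := hT _ _ hcR.1 _ tri; exists f.
have fL i x y : f i (x + y) = f i x + f i y.
  by have [[fl _] _] := hf i; rewrite -[x in LHS]scale1r fl scale1r.
have f0 i : f i 0 = 0 by apply: (addrI (f i 0)); rewrite -fL !addr0.
have fB i x y : f i (x - y) = f i x - f i y.
  by apply: (addIr (f i y)); rewrite -fL !subrK.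
have B_cB (b : salg R) : b \in B -> val b \in cB.
  move=> bB; have : [set` cB] (val b); last by [].
  by rewrite (btd_cB htri); apply: (nclosure_sub uR); exists b.
pose E i : cR := val (val (e i)).
have good y : im (prod_span [set` B] [set` H]) y ->
    y = \sum_i E i * f i y /\ forall i, f i y \in cB.
  rewrite (atd_BH halg) => -[_ [k [u [b [ub ->]]]] <-].
  have -> : val (\sum_j u j * b j) = \sum_j val (u j) * val (b j).
    by rewrite subalg_sum; apply: eq_bigr => j _; rewrite subalg_valM.
  have fE i : f i (\sum_j val (u j) * val (b j)) =
      \sum_j phi i (exist _ (u j) (ub j).1) *: val (b j).
    rewrite (big_morph (f i) (fL i) (f0 i)); apply: eq_bigr => j _.
    have := (hf i).2 1 (exist _ (u j) (ub j).1) (exist _ (val (b j)) (B_cB _ (ub j).2)).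
    by rewrite /= !mul1r.
  split=> [|i]; last first.
    by rewrite fE; apply: rpred_sum => j _; apply: rpredZ; apply: B_cB; case: (ub j).
  under [RHS]eq_bigr do rewrite fE mulr_sumr.
  rewrite exchange_big; apply: eq_bigr => j _ /=.
  have := congr1 (fun h => val (val h)) (phiE (exist _ (u j) (ub j).1)).
  rewrite val2_sum /= => {1}->; rewrite mulr_suml; apply: eq_bigr => i _.
  by rewrite -scalerAl -scalerAr.
have fcont i e0 : 0 < e0 -> exists2 e1, 0 < e1 & forall x, nR x < e1 -> nR (f i x) < e0.
  by move=> h; have [[_ [C1 hC1]] _] := hf i; exact: (lin_small (f := f i) h hC1).
move=> s sBH; have hs' : nclosure nR (im (prod_span [set` B] [set` H])) s.
  by have : [set` cBH] s by []; rewrite hcBH.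
have fs i : f i s \in cB.
  apply: cB_closed => r r0; have [r1 r10 hr1] := fcont i r r0.
  have [y hy sy] := hs' _ r10; exists (f i y); first by have [_] := good y hy; apply.
  by rewrite -fB; exact: hr1.
exists (fun i => exist _ (f i s) (fs i)).
rewrite /= -/(E _); apply/eqP; rewrite -subr_eq0; apply/eqP; apply: (un_small0 uR) => r r0.
have /choice[r1 hr1] i : exists r1, 0 < r1 /\ forall x, nR x < r1 -> nR (E i * f i x) < r.
  have [r1 r10 h1] := @lin_small _ nR (fun x => E i * x) (C * nR (E i)) r r0 (fun x => hC _ x).
  by have [r2 r20 h2] := fcont i _ r10; exists r2; split=> // x /h2/h1.
have [r2 r20 hr2] : exists2 r2, 0 < r2 & forall i, r2 <= r1 i.
  exists (\big[Num.min/1]_i r1 i).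
    by elim/big_rec: _ => [|i x _ x0]; rewrite ?ltr01 // lt_min x0 andbT; case: (hr1 i).
  by move=> i; rewrite (bigD1 i) //= ge_min lexx.
have [|y hy sy] := hs' (Num.min r r2); first by rewrite lt_min r0.
have -> : s - \sum_i E i * f i s = (s - y) - \sum_i E i * f i (s - y).
  under [in RHS]eq_bigr do rewrite fB mulrBr.
  by rewrite sumrB -(good y hy).1 opprB addrA subrK.
have [h1 h2] : nR (s - y) < r /\ nR (s - y) < r2.
  by move: sy; rewrite lt_min => /andP.
apply: (unB_lt uR) => //; apply: (un_sum_lt uR) => // i _.
by apply: (hr1 i).2; exact: lt_le_trans (hr2 i).
Qed.

(** Expand [s] along a basis of [H], and reduce the coefficients to scalars
   by [cB_split]. *)
Lemma cBH_split (s : salg cBH) : exists h : salg H, s - H_cBH h \in J.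
Proof.
have [m [e [he hs]]] := H_basis.
have [b sb] := cBH_coord he hs (valP s).
have /choice[k hk] i := cB_split (b i).
exists (\sum_i k i *: e i).
have -> : s - H_cBH (\sum_i k i *: e i) =
    \sum_i H_cBH (e i) * cB_cBH (b i - (k i)%:A).
  apply: val_inj; rewrite [RHS]subalg_sum /= val2_sum sb -sumrB.
  apply: eq_bigr => i _; rewrite /= mulrBr.
  by rewrite mulr_algr.
by apply: (submod_sum (N := J)) => i _; exact: cBHpos_mull.
Qed.
End BorelPart.

(** * The category and its subobjects *)

Lemma iter_shift (K : fieldType) (cR : algType K) (M : lmodType cR) (d : cR)
    (l : K) n (x : vsp K M) :
  iter n (fun y : vsp K M => (d *: (y : M) : vsp K M) - l *: y) x = shift d l n *: (x : M).
Proof.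
elim: n => [|n IH]; first by rewrite /shift expr0 scale1r.
rewrite iterS IH /shift exprS -scalerA scalerBl.
by [].
Qed.

Lemma banach_vsp (RT : realType) (K : fieldType) (v : K -> RT) (hv : is_absv v)
    (S : algType K) (M : lmodType S) (n : M -> RT) :
  is_banach v (n : vsp K M -> RT) <->
  [/\ ultranorm n, complete n & forall (k : K) m, n (k%:A *: m) = v k * n m].
Proof.
split=> [hb|[[h1 h2 h3 h4] hc hs]].
  by split; [exact: (banach_ultra hv hb)|exact: (bn_complete hb)|exact: (bn_scale hb)].
by split.
Qed.

Lemma bmod_sub (RT : realType) (K : fieldType) (v : K -> RT) (cR : algType K)
    (nR : cR -> RT) (M : lmodType cR) (nM : M -> RT) C (U : submod M) :
  banach_mod v nR nM C -> nclosed nM [set` U] ->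
  banach_mod v nR (fun x : smod U => nM (val x)) C.
Proof.
move=> hM cU; split.
- exact: (sub_ultra (bm_ultra hM)).
- exact: (sub_complete (bm_ultra hM) (bm_complete hM) cU).
- by move=> k m; exact: (bm_scale hM).
- exact: (bm_C0 hM).
by move=> r m; exact: (bm_C hM).
Qed.

Section CatO.
Context (RT : realType) (K : fieldType) (v : K -> RT) (w : K) (hp : pvalued v w).
Context (cR : algType K) (nR : cR -> RT) (hcR : is_banach_alg v nR).
Context (R : subalg cR) (d : salg R) (cA : subalg cR).
Context (An : nat -> set cR) (hA : weight_graded v w nR (val d) [set` cA] An).
Context (cA_closed : nclosed nR [set` cA]).
Context (cA_noeth : left_noetherian (salg cA)).
Let hv := pv_abs hp.
Let uR := banach_ultra hv hcR.1.
Let bcA : is_banach_alg v (fun x : salg cA => nR (val x)).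
Proof. exact: (closed_subalg_banach hp hcR cA_closed). Qed.

Lemma bmod_canonical (M : lmodType cR) (nM : vsp K M -> RT) :
  canonical_norm v nR nM <-> exists C, banach_mod v nR (nM : M -> RT) C.
Proof.
split=> [[/(banach_vsp hv)[h1 h2 h3] [C hC]]|[C [h1 h2 h3 C0 hC]]]; last first.
  by split; [exact/(banach_vsp hv)|exists C].
exists (Num.max C 1); split=> //; first by rewrite lt_max ltr01 orbT.
move=> r m; apply: le_trans (hC r m) _; rewrite -!mulrA.
by rewrite ler_wpM2r ?mulr_ge0 ?(un_ge0 h1) ?(un_ge0 uR) // le_max lexx.
Qed.

Section Mod.
Context (M : lmodType cR) (nM : M -> RT) (C : RT) (hM : banach_mod v nR nM C).
Let uM := bm_ultra hM.
Local Notation rM := (restrict (val : {rmorphism salg cA -> cR}) M).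
Context (fgM : fin_gen [set: rM]).

Lemma rM_scale (k : K) (m : rM) : nM ((k%:A : salg cA) *: m) = v k * nM m.
Proof. by rewrite -(bm_scale hM). Qed.
Lemma rM_C (s : salg cA) (m : rM) : nM (s *: m) <= C * nR (val s) * nM m.
Proof. exact: (bm_C hM). Qed.

Lemma rsub (U : submod M) : submod_closed (sm_pred U : {pred rM}).
Proof.
by split=> [|a x y xU yU]; [exact: rpred0|apply: rpredD => //; exact: (rpredZ (val a))].
Qed.

(** Closedness is a matter of the structure over [cA], for which [M] is
   finite. *)
Lemma sub_nclosed (U : submod M) : nclosed nM [set` U].
Proof.
exact: (@submod_nclosed _ _ v hv w (pv_w hp) _ _ bcA.1 cA_noeth rM nM uM
  (bm_complete hM) rM_scale C (bm_C0 hM) rM_C (Submod (rsub U)) fgM).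
Qed.

Lemma sub_fin_gen (U : submod M) :
  fin_gen [set: restrict (val : {rmorphism salg cA -> cR}) (smod U)].
Proof.
have [n [g [gU hg]]] := noeth_sub cA_noeth (Submod (rsub U)) fgM.
exists n, (fun i => exist _ (g i) (gU i) : smod U); split=> // x _.
have [c hc] := hg _ (valP (x : smod U)); exists c.
apply: (val_inj : injective (val : smod U -> M)).
by rewrite [RHS](smod_val_sum (N := U) (fun i => val (c i))).
Qed.

(** Replace the generators over [cA] by finite partial sums of their weight
   decompositions. *)
Lemma weight_generated : has_weight_dec (nM : vsp K M -> RT)
    (fun m : vsp K M => val d *: (m : M)) setT ->
  exists (T : finType) (lam : T -> K) (m : T -> M) (N : nat),
    weight_gens (val d) [set` cA] lam m N.
Proof.
move=> [I [Iw hI]]; have [r [g [_ hg]]] := fgM.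
have [|C0 [C00 hC0]] := @open_gen _ _ v hv w (pv_w hp) _ _ bcA.1 rM nM uM
  (bm_complete hM) rM_scale C (bm_C0 hM) rM_C _ g.
  by move=> y; exact: hg.
have C0' : 0 < C0 + 1 by rewrite ltr_wpDl.
pose e := (C * (C0 + 1))^-1 / 2.
have e0 : 0 < e by rewrite divr_gt0 ?invr_gt0 ?mulr_gt0 ?(bm_C0 hM).
have /choice[cs hcs] (i : 'I_r) : exists cs : (K -> M) * {fset K},
    [/\ forall l, I l -> exists N, shift (val d) l N *: cs.1 l = 0,
      [set` cs.2] `<=` I & forall s : {fset K}, (cs.2 `<=` s)%fset ->
      [set` s] `<=` I -> nM (g i - \sum_(l <- s) cs.1 l) < e].
  have [c [hc hs]] := hI (g i) Logic.I; have [s0 s0I hs0] := hs e e0.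
  exists (c, s0); split=> //=.
    move=> l /hc[_ [N hN]]; exists N; have := hN N (leqnn _).
    by rewrite iter_shift.
  by move=> s /fsubsetP ss sI; exact: hs0.
pose s := (\bigcup_(i <- enum 'I_r) (cs i).2)%fset.
have sI : [set` s] `<=` I.
  move=> l /bigfcupP[i _ li]; have [_ h _] := hcs i; exact: h.
pose g' i : rM := \sum_(l <- s) (cs i).1 l.
have gg' i : nM (g i - g' i) < e.
  have [_ _ h] := hcs i; apply: h => //; apply/fsubsetP => l ls.
  by apply/bigfcupP; exists i; rewrite ?mem_enum.
have Hgen := perturb (banach_ultra hv bcA.1) (bn_complete bcA.1)
  (uM : @ultranorm _ rM nM) (bm_C0 hM) rM_C C00 hC0 (g' := g').
have /choice[N hN] (il : 'I_r * s) : exists N,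
    shift (val d) (val il.2) N *: (cs il.1).1 (val il.2) = 0.
  have [h _ _] := hcs il.1; apply: h; apply: sI; exact: valP.
exists ('I_r * s)%type, (fun il => val il.2), (fun il => (cs il.1).1 (val il.2)),
  (\max_il N il)%N.
split=> [il|x].
  rewrite -(subnK (leq_bigmax il)) shiftD -scalerA hN; exact: scaler0.
have [i|a [_ ->]] := Hgen _ x.
  apply: (@le_trans _ _ (C * C0 * e)).
    by rewrite ler_wpM2l ?mulr_ge0 ?(ltW (bm_C0 hM)) // ltW.
  have -> : C * C0 * e = C0 / (C0 + 1) / 2.
    by rewrite /e; field; rewrite !gt_eqF // (bm_C0 hM).
  rewrite ler_piMl ?invr_ge0 ?ler0n // ler_pdivrMr ?mul1r ?lerDl ?ler01 //.
exists (fun il => val (a il.1)); split=> [il|]; first exact: valP.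
rewrite -(pair_bigA _ (fun i (l : s) => val (a i) *: (cs i).1 (val l))) /=.
apply: eq_bigr => i _; rewrite -scaler_sumr /g'.
by rewrite big_seq_fsetE.
Qed.

Context (T : finType) (lam : T -> K) (m : T -> M) (N : nat).
Context (hW : weight_gens (val d) [set` cA] lam m N).

(** The weight components of a vector of [U] lie in [U], which is closed. *)
Lemma sub_catO (U : submod M) : in_catO v nR d cA (smod U).
Proof.
have cU := sub_nclosed (U := U).
split.
- have [n [g [_ hg]]] := sub_fin_gen U.
  exists n, g; split=> // x _; have [c ->] := hg x Logic.I.
  by exists (fun i => val (c i)).
- exact: sub_fin_gen.
exists (fun x : vsp K (smod U) => nM (val (x : smod U))).
  by apply/bmod_canonical; exists C; exact: bmod_sub.
pose D (x : vsp K (smod U)) : vsp K (smod U) := val d *: (x : smod U).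
exists (weights D setT); split=> // x _.
have [c hc _] := expands_ex hA hM hW (val (x : smod U)).
have cU' l : c l \in U := component_closed hA hM l cU (valP (x : smod U)) hc.
pose c' l : vsp K (smod U) := exist _ (c l) (cU' l) : smod U.
have wc l : weight_space D setT l (c' l).
  split=> //; exists N => k Nk; rewrite iter_shift; apply: (val_inj : injective (val : smod U -> M)).
  exact: (nil_ge (ex_nil hc l) Nk).
have wt l : c l != 0 -> weights D setT l.
  by move=> cl0; exists (c' l).
exists c'; split=> // e e0; have [s0 hs0] := ex_nsum hc e0.
exists [fset l in s0 | `[< weights D setT l >]]%fset.
  by move=> l /=; rewrite !inE => /andP[_ /asboolP].
move=> s ss sI.
have -> : nM (val (x - \sum_(l <- s) c' l : smod U)) = nM (val (x : smod U) - \sum_(l <- s) c l).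
  by rewrite raddfB raddf_sum.
have -> : \sum_(l <- s) c l = \sum_(l <- (s0 `|` s)%fset) c l.
  apply: big_fset_incl => [|l ls0 ls]; first exact: fsubsetUr.
  apply/eqP; apply: contraNT ls => cl0.
  move: ls0; rewrite in_fsetU => /orP[ls0|//]; apply: ss.
  by rewrite /= !inE ls0 /=; apply/asboolP/wt.
by apply: hs0; exact: fsubsetUl.
Qed.
End Mod.
End CatO.

(** * Highest weight vectors and finite length *)

Lemma poly_roots (K : fieldType) (P : {poly K}) : P != 0 ->
  exists s : seq K, forall x, root P x -> x \in s.
Proof.
move=> P0; pose Q k := `[< exists s, [/\ uniq s, all (root P) s & size s = k] >].
have exQ : exists k, Q k by exists 0%N; apply/asboolP; exists [::].
have bQ k : Q k -> (k <= size P)%N.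
  by move=> /asboolP[s [us rs <-]]; apply: ltnW; exact: max_poly_roots.
case: (ex_maxnP exQ bQ) => k /asboolP[s [us rs sk]] kmax.
exists s => x rx; apply: contraT => xs.
suff /kmax : Q k.+1 by rewrite ltnn.
by apply/asboolP; exists (x :: s); rewrite /= xs us rx rs sk.
Qed.

(** The first [r + 1] powers of [h] are linearly dependent. *)
Lemma annihilator (K : fieldType) (S : algType K) (h : S) r (g : 'I_r -> S) :
  (forall i : nat, exists c : 'I_r -> K, h ^+ i = \sum_j c j *: g j) ->
  exists2 P : {poly K}, P != 0 & horner_alg h P = 0.
Proof.
move=> hg.
have /choice[a ha] : forall i : 'I_r.+1, exists c : 'I_r -> K, h ^+ i = \sum_j c j *: g j.
  by move=> i; exact: hg.
pose A := \matrix_(i < r.+1, j < r) a i j.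
have [u uA u0] : exists2 u : 'rV_r.+1, (u <= kermx A)%MS & u != 0.
  apply/rowV0Pn; rewrite -mxrank_eq0 mxrank_ker subn_eq0 -ltnNge ltnS.
  exact: rank_leq_col.
exists (rVpoly u).
  by apply: contra_neq u0 => e; rewrite -[u]rVpolyK e linear0.
have -> : rVpoly u = \sum_(i < r.+1) u 0 i *: 'X^i.
  by rewrite /rVpoly poly_def; apply: eq_bigr => i _; rewrite valK.
rewrite rmorph_sum /=.
under eq_bigr do rewrite -mul_polyC rmorphM rmorphXn /= horner_algC horner_algX
  mulr_algl ha scaler_sumr.
rewrite exchange_big big1 // => j _ /=.
have /sub_kermxP/rowP/(_ j) := uA; rewrite !mxE => uj.
under eq_bigr do rewrite scalerA.
have e : \sum_i u 0 i * a i j = 0.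
  by rewrite -[RHS]uj; apply: eq_bigr => i _; rewrite !mxE.
by rewrite -scaler_suml e scale0r.
Qed.

Section FinSpan.
Context (K : fieldType) (V : lmodType K).

Definition fin_span (P : set V) : Prop :=
  exists n (e : 'I_n -> V), P `<=` span e.

Lemma fin_span_finType (T : finType) (e : T -> V) (P : set V) :
  (forall x, P x -> exists c : T -> K, x = \sum_i c i *: e i) -> fin_span P.
Proof.
move=> hP; exists #|T|, (fun i => e (enum_val i)) => x /hP[c ->].
exists (fun i => c (enum_val i)).
by rewrite (reindex _ (onW_bij _ (@enum_val_bij T))).
Qed.

Lemma fin_span_nat (P : set V) : fin_span P -> exists n (s : nat -> V),
  forall N x, (n <= N)%N -> P x -> exists c : nat -> K, x = \sum_(j < N) c j *: s j.
Proof.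
move=> [n [e he]]; exists n, (fun j => if insub j is Some i then e i else 0).
move=> N x nN /he[c ->]; exists (fun j => if insub j is Some i then c i else 0).
rewrite -(subnKC nN) big_split_ord /= [X in _ = _ + X]big1 ?addr0.
  by apply: eq_bigr => i _; rewrite !valK.
by move=> i _; rewrite insubF ?scaler0 // ltnNge leq_addr.
Qed.

Lemma fin_span_sum (T : finType) (P : T -> set V) : (forall i, fin_span (P i)) ->
  fin_span [set x | exists2 y : T -> V, x = \sum_i y i & forall i, P i (y i)].
Proof.
move=> hP; have /choice[n hn] i := fin_span_nat (hP i).
have /choice[s hs] := hn; pose N := (\max_i n i)%N.
apply: (@fin_span_finType (T * 'I_N)%type (fun p : T * 'I_N => s p.1 p.2)).
move=> x [y -> hy].
have /choice[c hc] i : exists c : nat -> K, y i = \sum_(j < N) c j *: s i j.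
  by apply: hs => //; exact: leq_bigmax.
exists (fun p : T * 'I_N => c p.1 p.2).
rewrite -(pair_bigA _ (fun i (j : 'I_N) => c i j *: s i j)) /=.
by apply: eq_bigr => i _.
Qed.
End FinSpan.

Section Lattice.
Context (S : nzRingType) (M : lmodType S).

(** Above a submodule, choose among the strictly larger submodules one of
   least measure; the measure bounds the number of steps. *)
Lemma composition_series (h : submod M -> nat) D : (forall U, h U <= D)%N ->
  (forall U U' : submod M, (forall x, x \in U -> x \in U') ->
     (exists2 x, x \in U' & x \notin U) -> (h U < h U')%N) ->
  forall U0 : submod M, exists n (F : nat -> submod M),
  [/\ F 0%N = U0, forall x, x \in F n,
     forall i, (i < n)%N -> forall x, x \in F i -> x \in F i.+1,
     forall i, (i < n)%N -> exists2 x, x \in F i.+1 & x \notin F i &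
     forall i, (i < n)%N -> forall P : submod M, (forall x, x \in F i -> x \in P) ->
       (forall x, x \in P -> x \in F i.+1) ->
       (forall x, x \in P -> x \in F i) \/ (forall x, x \in F i.+1 -> x \in P)].
Proof.
move=> hD hlt U0; have [k] := ubnP (D - h U0)%N; elim: k U0 => // k IH U0 hk.
have [full|nfull] := pselect (forall x, x \in U0).
  by exists 0%N, (fun=> U0); split.
pose Q j := `[< exists U : submod M, [/\ forall x, x \in U0 -> x \in U,
  exists2 x, x \in U & x \notin U0 & h U = j] >].
have exQ : exists j, Q j.
  have [x hx] : exists x, x \notin U0.
    apply: contrapT => hno; apply: nfull => x; apply: contrapT => hx; apply: hno.
    by exists x; exact/negP.
  pose top : submod M := @mksub _ _ setT Logic.I (fun _ _ _ _ => Logic.I) (fun _ _ _ => Logic.I).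
  exists (h top); apply/asboolP; exists top; split=> //.
    by move=> y _; apply/mksubP.
  by exists x => //; apply/mksubP.
case: (ex_minnP exQ) => j /asboolP[U1 [U01 U1n hU1]] jmin.
have lt01 := hlt _ _ U01 U1n.
have [|n [F [F0 Fn Finc Fstr Fmin]]] := IH U1.
  have := hD U1; lia.
exists n.+1, (fun i => if i is i'.+1 then F i' else U0); split=> //.
- by case=> [|i] //=; rewrite ?F0 //; exact: Finc.
- by case=> [|i] //=; rewrite ?F0 //; exact: Fstr.
case=> [|i] //=; rewrite ?F0; last exact: Fmin.
move=> _ P U0P PU1; have [hP|hP] := pselect (forall x, x \in P -> x \in U0); first by left.
right=> x xU1; apply: contraT => xP.
have hPn : exists2 x, x \in P & x \notin U0.
  apply: contrapT => hno; apply: hP => y yP; apply: contrapT => yU; apply: hno.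
  by exists y => //; exact/negP.
have : (h P < h U1)%N by apply: hlt => //; exists x.
rewrite hU1 ltnNge jmin //; apply/asboolP; exists P; split=> //.
Qed.
End Lattice.

Section Highest.
Context (RT : realType) (K : fieldType) (v : K -> RT) (w : K) (hp : pvalued v w).
Context (cR : algType K) (nR : cR -> RT) (hcR : is_banach_alg v nR).
Context (R : subalg cR) (gr : int -> submod (salg R)).
Context (A B H : subalg (salg R)) (d : salg R) (cA cB : subalg cR).
Context (htri : banach_tridec v nR gr A B H d cA cB).
Let halg := btd_alg htri.
Let An := Apart gr A.
Let hA : weight_graded v w nR (val d) [set` cA] An := cA_galg hp hcR htri.

Lemma Bneg_ad b : Bneg gr B b -> exists k : nat,
  val d * val b = val b * val d + - (k.+1%:R) *: val b.
Proof.
move=> [bB [[n|n] n0 bn]] //; exists n.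
have := (atd_gr halg (Negz n) b).1 bn => /(congr1 val) /= h.
rewrite NegzE mulrNz in h.
by apply/eqP; rewrite addrC -subr_eq; apply/eqP.
Qed.

Lemma d0_poly (d0 : salg R) : d0 \in H ->
  exists2 P : {poly K}, P != 0 & horner_alg (val d0) P = 0.
Proof.
move=> d0H; have [r [g [_ hg]]] := atd_Hfin halg.
apply: (annihilator (g := fun i => val (val (g i)))) => i.
pose h0 : salg H := exist _ d0 d0H.
have [//|c hc] := hg (h0 ^+ i); exists c; rewrite -val2_sum -hc.
by rewrite -[d0]/(val h0) !rmorphXn.
Qed.

Section HMod.
Context (M : lmodType cR) (nM : M -> RT) (C : RT) (hM : banach_mod v nR nM C).
Context (T : finType) (lam : T -> K) (m : T -> M) (N : nat).
Context (hW : weight_gens (val d) [set` cA] lam m N).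
Context (cl : forall U : submod M, nclosed nM [set` U]).

(** Modulo [U], the vector [y] is killed by the left ideal generated by the
   negative part of [B], so that [d] and [d0] act alike on it. *)
Lemma d0_act (d0 : salg R) (U : submod M) mu y : LBneg gr B (d - d0) ->
  (val d - mu%:A) *: y \in U -> (forall b, Bneg gr B b -> val b *: y \in U) ->
  val d0 *: y - mu%:A *: y \in U.
Proof.
move=> hd0 dy by0; pose P : set (salg R)^o := [set t | val (t : salg R) *: y \in U].
have [U0 UD UZ] := submod_set U.
have P0 : P 0 by rewrite /P /= scale0r.
have PD s t : P s -> P t -> P (s + t) by move=> hs ht; rewrite /P /= scalerDl; exact: UD.
have PZ a s : P s -> P (a *: s).
  by move=> hs; rewrite /P /= -scalerA; exact: UZ.
have /mksubP h := hd0 (mksub P0 PD PZ) (fun b hb => (mksubP P0 PD PZ b).2 (by0 b hb)).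
have -> : val d0 *: y - mu%:A *: y = (val d - mu%:A) *: y - val (d - d0) *: y.
  by rewrite -!scalerBl /= opprB [in RHS]addrC addrA subrK.
exact: rpredB.
Qed.

Lemma poly_act (a : cR) (U : submod M) mu y (P : {poly K}) :
  a *: y - mu%:A *: y \in U -> horner_alg a P *: y - (P.[mu])%:A *: y \in U.
Proof.
move=> hy; elim/poly_ind: P => [|P k IH].
  by rewrite raddf0 horner0 !scale0r subr0 rpred0.
rewrite !hornerE rmorphD rmorphM /= horner_algX horner_algC.
have -> : (horner_alg a P * a + k%:A) *: y - (P.[mu] * mu + k)%:A *: y =
   horner_alg a P *: (a *: y - mu%:A *: y) + mu%:A *: (horner_alg a P *: y - P.[mu]%:A *: y).
  rewrite !scalerDl scalerBr scalerBr !scalerA mulr_algr mulr_algl.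
  rewrite mulr_algl scalerA [mu * _]mulrC addrA subrK opprD addrACA subrr addr0.
  by [].
by rewrite rpredD ?rpredZ.
Qed.

(** The components of [y] of weight other than [mu] lie in [U], so that its
   component of weight [mu] is nonzero. *)
Lemma good_wset (U : submod M) y mu : y \notin U -> shift (val d) mu N *: y = 0 ->
  wset lam mu.
Proof.
move=> yU ymu; have [c hc _] := expands_ex hA hM hW y.
apply: contrapT => hmu; move/negP: yU; apply.
apply: (expands_in (cl (U := U)) hc) => l.
have [->|lmu] := eqVneq l mu.
  have [->|/(ex_supp hc)//] := eqVneq (c mu) 0; exact: rpred0.
apply: (expands_shift hA hM (k := N) (cl (U := U)) hc _ lmu).
by rewrite ymu rpred0.
Qed.

(** If [mu - k = lam i + n], then [k + n] depends only on [i]. *)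
Lemma wset_bounded mu : exists b : nat, forall k : nat, wset lam (mu - k%:R) -> (k <= b)%N.
Proof.
have /choice[b hb] (i : T) : exists b : nat, forall k n : nat,
    mu - k%:R = lam i + n%:R -> (k <= b)%N.
  have [[[k0 n0] /= e0]|hno] := pselect (exists p : nat * nat, mu - p.1%:R = lam i + p.2%:R).
    exists (k0 + n0)%N => k n e.
    suff /(pv_natrI hp) : (k + n)%:R = (k0 + n0)%:R :> K by lia.
    rewrite !natrD; apply: (addrI (lam i)).
    move/(congr1 (fun t => t + k%:R)): e; rewrite subrK addrAC => e.
    move/(congr1 (fun t => t + k0%:R)): e0; rewrite subrK addrAC => e0.
    by rewrite [LHS]addrA -e e0 addrA.
  by exists 0%N => k n e; case: hno; exists (k, n).
exists (\max_i b i)%N => k [i [n e]].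
by apply: leq_trans (hb i k n e) _; exact: (leq_bigmax i).
Qed.

(** A vector of [U2] outside [U1] of lowest possible weight is killed modulo
   [U1] by the negative part of [B], which lowers weights; the last of its
   images under powers of [d - mu] outside [U1] is an eigenvector modulo
   [U1]. *)
Lemma highest_vector (U1 U2 : submod M) x : x \in U2 -> x \notin U1 ->
  exists mu y, [/\ y \in U2, y \notin U1, (val d - mu%:A) *: y \in U1 &
    forall b, Bneg gr B b -> val b *: y \in U1].
Proof.
move=> xU2 xU1; have [c hc _] := expands_ex hA hM hW x.
have cU2 l : c l \in U2 := component_closed hA hM l (cl (U := U2)) xU2 hc.
have [l0 cl0] : exists l, c l \notin U1.
  apply: contrapT => hno; move/negP: xU1; apply.
  apply: (expands_in (cl (U := U1)) hc) => l; apply: contrapT => h; apply: hno.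
  by exists l; exact/negP.
pose good (mu : K) : Prop := exists y, [/\ y \in U2, y \notin U1 & shift (val d) mu N *: y = 0].
pose Q k := `[< good (l0 - k%:R) >].
have exQ : exists k, Q k.
  exists 0%N; apply/asboolP; exists (c l0); rewrite subr0; split=> //.
  exact: (ex_nil hc).
have [b0 hb0] := wset_bounded l0.
have bQ k : Q k -> (k <= b0)%N.
  by move=> /asboolP[y [_ yU1 hy]]; apply: hb0; exact: good_wset yU1 hy.
case: (ex_maxnP exQ bQ) => k /asboolP[y [yU2 yU1 hy]] kmax.
set mu := l0 - k%:R in hy.
have byU b : Bneg gr B b -> val b *: y \in U1.
  move=> hb; have [j hj] := Bneg_ad hb.
  apply: contraT => byU; suff /kmax : Q (k + j.+1)%N by lia.
  apply/asboolP; exists (val b *: y); split=> //; first exact: rpredZ.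
  rewrite natrD opprD addrA -/mu scalerA (shift_ad _ _ hj) -scalerA hy.
  exact: scaler0.
pose Q' j := shift (val d) mu j *: y \in U1.
have exQ' : exists j, Q' j by exists N; rewrite /Q' hy rpred0.
case: (ex_minnP exQ') => j Q'j jmin.
case: j Q'j jmin => [|j] Q'j jmin.
  by move: Q'j; rewrite /Q' /shift expr0 scale1r (negbTE yU1).
exists mu, (shift (val d) mu j *: y); split.
- exact: rpredZ.
- by apply/negP => /jmin; rewrite ltnn.
- by rewrite scalerA -exprS.
move=> b hb; have [i hi] := Bneg_ad hb.
by rewrite scalerA -(shift_ad _ _ hi) -scalerA; apply: rpredZ; exact: byU.
Qed.

(** For given [l] and [i], at most one [n] satisfies [l = lam i + n]. *)
Lemma wspace_fin_span l : fin_span (wspace An lam m l : set (vsp K M)).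
Proof.
pose P (i : T) : set (vsp K M) := [set y | exists2 u : cR, y = (u *: m i : M) &
  u != 0 -> exists2 n : nat, l = lam i + n%:R & An n u].
have hP i : fin_span (P i).
  have [[n ln]|hno] := pselect (exists n : nat, l = lam i + n%:R); last first.
    exists 0%N, (fun=> 0) => y [u -> hu]; exists (fun=> 0).
    rewrite big_ord0; have [->|/hu[n ln _]] := eqVneq u 0; first by rewrite scale0r.
    by case: hno; exists n.
  have [r [g [_ hg]]] := atd_Afin halg n%:Z.
  exists r, (fun j => (val (g j) *: m i : M)) => y [u -> hu].
  have [->|/hu[n' ln']] := eqVneq u 0.
    exists (fun=> 0); rewrite scale0r big1 // => j _; exact: scale0r.
  have -> : n' = n by apply: (pv_natrI hp); apply: (addrI (lam i)); rewrite -ln' -ln.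
  move=> [a [aA an ->]]; have [c ->] := hg a (conj aA an).
  exists c; rewrite subalg_sum scaler_suml; apply: eq_bigr => j _.
  by rewrite subalg_valZ -mulr_algl -scalerA.
have [n [e he]] := fin_span_sum hP; exists n, e => y [u -> hu].
apply: he; exists (fun i => (u i *: m i : M)) => // i.
by exists (u i) => //; exact: (hu i).
Qed.

(** On a highest weight vector of [U2] modulo [U1], [d] acts like an element
   of the finite-dimensional algebra [H], so that its weight is among the
   roots of a fixed polynomial. The component of that weight lies outside
   [U1], as the other ones lie in [U1]; hence the weight spaces of those
   roots together separate submodules. *)
Lemma separating_span : exists n (e : 'I_n -> vsp K M),
  forall U1 U2 : submod M, (forall x, x \in U1 -> x \in U2) ->
    (exists2 x, x \in U2 & x \notin U1) ->
    exists2 z, span e z & z \in U2 /\ z \notin U1.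
Proof.
have [d0 [d0H hd0]] := d_decomp htri.
have [P P0 hP] := d0_poly d0H.
have [s hs] := poly_roots P0.
have := fin_span_sum (fun l : seq_sub s => wspace_fin_span (val l)).
case=> n [e he]; exists n, e => U1 U2 U12 [x xU2 xU1].
have [mu [y [yU2 yU1 dy byU]]] := highest_vector xU2 xU1.
have mus : mu \in s.
  apply: hs; have := poly_act P (d0_act hd0 dy byU).
  rewrite hP scale0r sub0r rpredN /root => h; apply: contraT => Pmu.
  move: yU1; suff -> : y \in U1 by [].
  have -> : y = (P.[mu]^-1)%:A *: ((P.[mu])%:A *: y).
    by rewrite scalerA mulr_algl scalerA mulVf // !scale1r.
  exact: rpredZ.
have [c hc wc] := expands_ex hA hM hW y.
have shiftU : shift (val d) mu 1 *: y \in U1 by rewrite /shift expr1.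
have cU l := expands_shift hA hM (cl (U := U1)) hc shiftU (l := l).
exists (c mu); last split.
- apply: he; exists (fun l : seq_sub s => if val l == mu then c mu else 0 : vsp K M).
    rewrite (bigD1 (SeqSub mus)) //= eqxx big1 ?addr0 // => l lmu.
    rewrite ifN //; apply: contra lmu => /eqP h; apply/eqP/val_inj; exact: h.
  move=> l; case: eqP => [->|_]; first exact: wc.
  by exists (fun=> 0) => [|i]; rewrite ?eqxx // big1 // => i _; rewrite scale0r.
- exact: (component_closed hA hM mu (cl (U := U2)) yU2 hc).
apply/negP => cmu; move/negP: yU1; apply; apply: (expands_in (cl (U := U1)) hc) => l.
by have [->|/cU] := eqVneq l mu.
Qed.

Lemma module_series (U0 : submod M) : exists n (F : nat -> submod M),
  [/\ F 0%N = U0, forall x, x \in F n,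
     forall i, (i < n)%N -> forall x, x \in F i -> x \in F i.+1,
     forall i, (i < n)%N -> exists2 x, x \in F i.+1 & x \notin F i &
     forall i, (i < n)%N -> forall P : submod M, (forall x, x \in F i -> x \in P) ->
       (forall x, x \in P -> x \in F i.+1) ->
       (forall x, x \in P -> x \in F i) \/ (forall x, x \in F i.+1 -> x \in P)].
Proof.
have [n [e he]] := separating_span; have [h [hn hlt]] := dim_fun e.
have sub (U : submod M) : subspace ([set x | x \in U] : set (vsp K M)).
  split=> [|k x y xU yU]; first exact: rpred0.
  by apply: (rpredD (S := U)) => //; exact: (rpredZ k%:A xU).
pose hU (U : submod M) := h ([set x | x \in U] : set (vsp K M)).
have hUn U : (hU U <= n)%N by exact: hn.
apply: (composition_series hUn) => U U' UU' hx.
apply: hlt => //; have [z ze [zU' zU]] := he U U' UU' hx.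
by exists z => //; split=> //; exact/negP.
Qed.
End HMod.
End Highest.

(** * Quotient norms *)

Section Quot.
Context (RT : realType) (S : nzRingType) (M : lmodType S) (nM : M -> RT).
Context (uM : ultranorm nM) (N : submod M).
Local Notation Q := (quotmod N).
Local Notation qn := (quot_norm nM : quotmod N -> RT).

Lemma quotW_ex (q : Q) : exists x, \pi_Q x = q.
Proof. by exists (repr q); rewrite reprK. Qed.

Lemma qn_has_inf (q : Q) : has_inf [set nM x | x in [set x | \pi_Q x = q]].
Proof.
split; first by have [x xq] := quotW_ex q; exists (nM x), x.
by exists 0 => _ [x _ <-]; exact: (un_ge0 uM).
Qed.

Lemma qn_le x : qn (\pi_Q x) <= nM x.
Proof. by apply: ge_inf; [exact: (qn_has_inf _).2|exists x]. Qed.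

Lemma qn_lt q e : qn q < e -> exists2 x, \pi_Q x = q & nM x < e.
Proof.
rewrite -subr_gt0 => e0; have [_ [x xq <-]] := inf_adherent e0 (qn_has_inf q).
by rewrite -/(qn q) addrC subrK; exists x.
Qed.

Lemma qn_lb q c t : 0 <= c -> (forall x, \pi_Q x = q -> t <= c * nM x) -> t <= c * qn q.
Proof.
rewrite le_eqVlt => /predU1P[<-|c0] h.
  by have [x xq] := quotW_ex q; have := h x xq; rewrite !mul0r.
rewrite mulrC -ler_pdivrMr //; apply: lb_le_inf; first exact: (qn_has_inf q).1.
by move=> _ [x xq <-]; rewrite ler_pdivrMr // mulrC; exact: h.
Qed.

Lemma quotmod_pi0 : \pi_Q 0 = 0.
Proof. by apply: (addrI (\pi_Q 0)); rewrite -quotmod_piD !addr0. Qed.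
Lemma quotmod_piN x : \pi_Q (- x) = - \pi_Q x.
Proof. by apply: (addrI (\pi_Q x)); rewrite -quotmod_piD !subrr quotmod_pi0. Qed.
Lemma quotmod_piB x y : \pi_Q (x - y) = \pi_Q x - \pi_Q y.
Proof. by rewrite quotmod_piD quotmod_piN. Qed.
Lemma quotmod_pi_scale a x : \pi_Q (a *: x) = a *: \pi_Q x.
Proof. by rewrite -quotmod_piZ. Qed.
Lemma quotmod_pi_eq0 x : \pi_Q x = 0 <-> x \in N.
Proof. by rewrite -quotmod_pi0 quotmod_piP subr0. Qed.
Lemma quotmod_pi_sum (I : Type) (r : seq I) (P : pred I) (F : I -> M) :
  \pi_Q (\sum_(i <- r | P i) F i) = \sum_(i <- r | P i) \pi_Q (F i).
Proof.
elim/big_rec2: _ => [|i _ x _ <-]; first exact: quotmod_pi0.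
by rewrite quotmod_piD.
Qed.

Context (cN : nclosed nM [set` N]).

Lemma quot_ultra : ultranorm qn.
Proof.
split.
- by move=> q; rewrite -[qn q]mul1r; apply: qn_lb => // x _; rewrite mul1r (un_ge0 uM).
- move=> q; split=> [q0|->]; last first.
    apply/eqP; rewrite eq_le -{1}quotmod_pi0 (le_trans (qn_le _)) ?(un0 uM) //=.
    by rewrite -[qn 0]mul1r; apply: qn_lb => // x _; rewrite mul1r (un_ge0 uM).
  have [x xq] := quotW_ex q; rewrite -xq; apply/quotmod_pi_eq0.
  apply: cN => e e0; have [|y yq ye] := @qn_lt q e; first by rewrite q0.
  exists (x - y); last by rewrite opprB addrC subrK.
  by apply/quotmod_piP; rewrite xq yq.
- have h q : qn (- q) <= qn q.
    rewrite -[qn q]mul1r; apply: qn_lb => // x <-; rewrite -quotmod_piN mul1r.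
    by apply: le_trans (qn_le _) _; rewrite (un_opp uM).
  by move=> q; apply/eqP; rewrite eq_le h /=; have := h (- q); rewrite opprK.
move=> p q; rewrite leNgt gt_max; apply/negP => /andP[/qn_lt[x xp hx] /qn_lt[y yq hy]].
have := qn_le (x + y); rewrite quotmod_piD xp yq => h.
by have := unD_lt uM hx hy; rewrite ltNge h.
Qed.

(** The steps of a subsequence that converges fast enough can be lifted to
   elements that form a convergent series. *)
Lemma quot_complete : complete nM -> complete qn.
Proof.
move=> cM u hu; have uQ := quot_ultra.
have h0 k : 0 < (2^-1 : RT) ^+ k by rewrite exprn_gt0 // invr_gt0.
have /choice[N0 hN0] k := hu _ (h0 k).
pose kk j := (\max_(i < j.+1) N0 i)%N.
have kkS j : (kk j <= kk j.+1)%N.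
  by rewrite /kk [leqRHS]big_ord_recr /= leq_maxl.
have kkN j : (N0 j <= kk j)%N by exact: (leq_bigmax (ord_max : 'I_j.+1)).
have /choice[dl hdl] j : exists x, \pi_Q x = u (kk j.+1) - u (kk j) /\ nM x < 2^-1 ^+ j.
  have [|x xq hx] := @qn_lt (u (kk j.+1) - u (kk j)) (2^-1 ^+ j); last by exists x.
  by apply: hN0; [exact: leq_trans (kkN j) (kkS j)|exact: kkN].
pose x j := repr (u (kk 0%N)) + \sum_(i < j) dl i.
have xS j : x j.+1 - x j = dl j.
  by rewrite /x big_ord_recr /= addrA [LHS]addrC addKr.
have px j : \pi_Q (x j) = u (kk j).
  elim: j => [|j IH]; first by rewrite /x big_ord0 addr0 reprK.
  by rewrite -(subrK (x j) (x j.+1)) quotmod_piD IH xS (hdl j).1 subrK.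
have [l hl] : exists l, tends nM x l.
  apply: (complete_steps uM cM) => e e0.
  have [J hJ] := geo_small_mul (ler01 : 0 <= 1 :> RT) e0.
  exists J => k Jk; rewrite xS; apply: lt_trans (hdl k).2 _.
  by have := hJ k Jk; rewrite mul1r.
exists (\pi_Q l) => e e0.
have [J1 hJ1] := geo_small_mul (ler01 : 0 <= 1 :> RT) e0.
have [J2 hJ2] := hl e e0; pose j := maxn J1 J2.
exists (kk j) => n jn.
rewrite -(subrK (u (kk j)) (u n)) -addrA; apply: (unD_lt uQ).
  apply: lt_trans (hN0 j n (kk j) (leq_trans (kkN j) jn) (kkN j)) _.
  by have := hJ1 j (leq_maxl _ _); rewrite mul1r.
rewrite -px -quotmod_piB; apply: le_lt_trans (qn_le _) _.
by apply: hJ2; exact: leq_maxr.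
Qed.
End Quot.

Lemma quot_scale (RT : realType) (K : fieldType) (v : K -> RT) (hv : is_absv v)
    (S : algType K) (M : lmodType S) (nM : M -> RT) (uM : ultranorm nM) (N : submod M) :
  nclosed nM [set` N] -> (forall (k : K) m, nM (k%:A *: m) = v k * nM m) ->
  forall (k : K) (q : quotmod N), quot_norm nM (k%:A *: q) = v k * quot_norm nM q.
Proof.
move=> cN hs; have h (k : K) (q : quotmod N) : quot_norm nM (k%:A *: q) <= v k * quot_norm nM q.
  apply: (qn_lb uM); first exact: (av_ge0 hv).
  by move=> x <-; rewrite -quotmod_pi_scale -hs; exact: (qn_le uM).
move=> k q; have [->|k0] := eqVneq k 0.
  by rewrite !scale0r (un0 (quot_ultra uM cN)) (av0 hv) mul0r.
apply/eqP; rewrite eq_le h /= mulrC -ler_pdivlMr ?(av_neq0 hv) // mulrC -(avV hv).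
apply: le_trans (h _ _); rewrite scalerA mulr_algl scalerA mulVf //.
by rewrite !scale1r.
Qed.

Lemma bmod_quot (RT : realType) (K : fieldType) (v : K -> RT) (hv : is_absv v)
    (cR : algType K) (nR : cR -> RT) (uR : ultranorm nR) (M : lmodType cR)
    (nM : M -> RT) C (U : submod M) : banach_mod v nR nM C -> nclosed nM [set` U] ->
  banach_mod v nR (quot_norm nM : quotmod U -> RT) C.
Proof.
move=> hM cU; have uM := bm_ultra hM; split.
- exact: quot_ultra.
- exact: (quot_complete uM cU (bm_complete hM)).
- exact: (quot_scale hv uM cU (bm_scale hM)).
- exact: (bm_C0 hM).
move=> r q; apply: (qn_lb uM).
  by rewrite mulr_ge0 ?(ltW (bm_C0 hM)) ?(un_ge0 uR).
move=> x <-; rewrite -quotmod_pi_scale; apply: le_trans (qn_le uM U (r *: x)) _.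
exact: (bm_C hM).
Qed.

(** * Simple [H]-modules of highest weight vectors *)

Lemma scaleAK (K : fieldType) (S : algType K) (M : lmodType S) (c : K) (y : M) :
  c != 0 -> (c^-1)%:A *: (c%:A *: y) = y.
Proof. by move=> c0; rewrite scalerA mulr_algl scalerA mulVf // !scale1r. Qed.

Section HighestPart.
Context (RT : realType) (K : fieldType) (v : K -> RT) (w : K) (hp : pvalued v w).
Context (cR : algType K) (nR : cR -> RT) (hcR : is_banach_alg v nR).
Context (R : subalg cR) (gr : int -> submod (salg R)).
Context (A B H : subalg (salg R)) (d : salg R) (cA cB : subalg cR).
Context (htri : banach_tridec v nR gr A B H d cA cB).
Let halg := btd_alg htri.

Definition H_val : {rmorphism salg H -> cR} :=
  (val : {rmorphism salg R -> cR}) \o (val : {rmorphism salg H -> salg R}).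

Local Notation valH := H_val.

Context (L : lmodType cR) (mu : K).
Local Notation LH := (restrict valH L).

Definition highest_vec : set L := [set z | val d *: z = mu%:A *: z /\
  forall b, Bneg gr B b -> val b *: z = 0].

(** [B] is the sum of its negative part and the scalars. *)
Lemma hwv_B b z : highest_vec z -> b \in B -> exists k : K, val b *: z = k%:A *: z.
Proof.
move=> [_ hz] bB; have [s [c [hc ->]]] := atd_gradB halg bB.
rewrite raddf_sum scaler_suml; elim/big_rec: _ => [|n y _ [k ->]].
  by exists 0; rewrite !scale0r.
have [cn cB'] := hc n; have [n0|n0|n0] := ltgtP n 0.
- exists k; rewrite hz ?add0r //; split=> //; by exists n.
- by exists k; rewrite (atd_Bneg halg n0 cB' cn) scale0r add0r.
have /(atd_B0 halg)[k' ->] : (c n \in B) && (c n \in gr 0) by rewrite cB' -n0.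
by exists (k' + k); rewrite !scalerDl.
Qed.

Lemma H_comm (h : salg R) : h \in H -> val d * val h = val h * val d.
Proof.
move=> /(atd_H0 halg)/(atd_gr halg); rewrite mulr0z scale0r => /(congr1 val) /= e.
by apply/eqP; rewrite -subr_eq0; apply/eqP.
Qed.

(** As [B H = H B], the vector [b * h * z] lies in [H z], on which [d] acts
   by [mu] since [H] has degree 0; but [b] lowers the weight. *)
Lemma hwv_H (h : salg R) z : h \in H -> highest_vec z -> highest_vec (val h *: z).
Proof.
move=> hH hz; have [dz bz] := hz.
have dh (h' : salg R) : h' \in H -> val d *: (val h' *: z) = mu%:A *: (val h' *: z).
  move=> hH'; rewrite scalerA (H_comm hH') -scalerA dz !scalerA.
  by rewrite mulr_algl mulr_algr.
split; first exact: dh.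
move=> b hb; have [k hk] := Bneg_ad htri hb.
have [h' h'H bh] : exists2 h', h' \in H & val b *: (val h *: z) = val h' *: z.
  have : prod_span [set` B] [set` H] (b * h) by apply: prod_span1 => //=; case: hb.
  rewrite (atd_BH halg) => -[n [u [t [ut bhE]]]].
  have /choice[c hc] i : exists k : K, val (t i) *: z = k%:A *: z.
    by apply: hwv_B => //; case: (ut i).
  exists (\sum_i c i *: u i); first by apply: rpred_sum => i _; apply: rpredZ; case: (ut i).
  rewrite scalerA -[val b * val h]/(val (b * h)) bhE !raddf_sum !scaler_suml.
  apply: eq_bigr => i _.
  transitivity ((val (u i) * val (t i)) *: z); first by [].
  transitivity ((c i *: val (u i)) *: z); last by [].
  by rewrite -scalerA hc scalerA mulr_algr.
have e1 : val d *: (val b *: (val h *: z)) = mu%:A *: (val b *: (val h *: z)).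
  by rewrite bh; exact: dh.
set y := val b *: (val h *: z) in bh e1 *.
have e2 : val d *: y = mu%:A *: y - (k.+1%:R)%:A *: y.
  have comm : val b *: (mu%:A *: (val h *: z)) = mu%:A *: y.
    by rewrite /y [LHS]scalerA [RHS]scalerA mulr_algr mulr_algl.
  rewrite [LHS]scalerA hk scalerDl -[X in X + _ = _]scalerA (dh h hH) comm.
  by congr (_ + _); rewrite scaleNr scaleNr -[_ *: val b]mulr_algl -scalerA.
have ky : (k.+1%:R : K)%:A *: y = 0.
  by apply: oppr_inj; apply: (addrI (mu%:A *: y)); rewrite -e2 e1 oppr0 addr0.
have k0 : (k.+1%:R : K) != 0 by apply/eqP => /(pv_char0 hp).
by rewrite -[y](scaleAK _ k0) ky scaler0.
Qed.

Context (x0 : L) (x0n : x0 != 0) (hx0 : highest_vec x0).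

(** Among the nonzero [H]-submodules of the finite-dimensional [H x0], take
   one of least dimension. *)
Lemma highest_simple : exists W : submod LH,
  [/\ exists2 y, y \in W & y != 0, forall y, y \in W -> highest_vec y &
      forall P : submod LH, (forall y, y \in P -> y \in W) ->
        (exists2 y, y \in P & y != 0) -> forall y, y \in W -> y \in P].
Proof.
have [r [g [_ hg]]] := atd_Hfin halg.
pose e i : vsp K L := (valH (g i) *: x0 : L).
have [h [_ hlt]] := dim_fun e.
have espan y : span e (valH y *: x0 : L).
  have [//|c yc] := hg y; exists c; rewrite {1}yc /H_val /= val2_sum scaler_suml.
  by apply: eq_bigr => i _; rewrite -mulr_algl -scalerA.
have hsub (U : submod LH) : subspace ([set x | x \in U] : set (vsp K L)).
  split=> [|k x y xU yU]; first exact: rpred0.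
  by apply: (rpredD (S := U)) => //; exact: (rpredZ (k%:A : salg H) xU).
pose good (U : submod LH) := [/\ exists2 y, y \in U & y != 0,
  forall y, y \in U -> highest_vec y & forall y, y \in U -> span e y].
pose Q j := `[< exists U : submod LH, good U /\ h [set x | x \in U] = j >].
have exQ : exists j, Q j.
  pose P : set LH := [set y | exists t, y = valH t *: x0].
  have P0 : P 0 by exists 0; rewrite raddf0 scale0r.
  have PD x y : P x -> P y -> P (x + y).
    by move=> [a ->] [b ->]; exists (a + b); rewrite raddfD scalerDl.
  have PZ a x : P x -> P (a *: x).
    by move=> [b ->]; exists (a * b); rewrite rmorphM -scalerA.
  exists (h [set x | x \in mksub P0 PD PZ]); apply/asboolP; exists (mksub P0 PD PZ).
  split=> //; split.
  - by exists x0 => //; apply/mksubP; exists 1; rewrite rmorph1 scale1r.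
  - move=> y /mksubP[t ->]; apply: hwv_H => //; exact: valP.
  by move=> y /mksubP[t ->].
case: (ex_minnP exQ) => j /asboolP[W [[Wn WE We] hW]] jmin.
exists W; split=> // P PW Pn y yW; apply: contraT => yP.
have : Q (h [set x | x \in P]).
  by apply/asboolP; exists P; split=> //; split=> // z /PW; [exact: WE|exact: We].
move/jmin; rewrite -hW leqNgt hlt //.
by exists y; [exact: We|split=> //; exact/negP].
Qed.
End HighestPart.

(** * The inflation of a simple [H]-module *)

Lemma restrict_sub_banach (RT : realType) (K : fieldType) (v : K -> RT)
    (hv : is_absv v) (cR : algType K) (nR : cR -> RT) (L : lmodType cR)
    (nL : L -> RT) (C : RT) (hL : banach_mod v nR nL C)
    (S : algType K) (phi : {rmorphism S -> cR}) (phiK : forall k : K, phi k%:A = k%:A)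
    (P : submod (restrict phi L)) : nclosed nL [set` P] ->
  is_banach v ((fun x : smod P => nL (val x)) : vsp K (smod P) -> RT).
Proof.
move=> cP; apply/(banach_vsp hv); split.
- exact: (@sub_ultra _ _ (restrict phi L) nL (bm_ultra hL) P).
- exact: (@sub_complete _ _ (restrict phi L) nL (bm_ultra hL) (bm_complete hL) P cP).
by move=> k x; rewrite -(bm_scale hL) -phiK.
Qed.

Lemma subalg_scalar (K : fieldType) (R : algType K) (S : subalg R) (k : K) :
  val (k%:A : salg S) = k%:A.
Proof. by []. Qed.

Section Inflation.
Context (RT : realType) (K : fieldType) (v : K -> RT) (w : K) (hp : pvalued v w).
Context (cR : algType K) (nR : cR -> RT) (hcR : is_banach_alg v nR).
Context (R : subalg cR) (gr : int -> submod (salg R)).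
Context (A B H : subalg (salg R)) (d : salg R) (cA cB : subalg cR).
Context (htri : banach_tridec v nR gr A B H d cA cB).
Context (cB_noeth : noetherian (salg cB)).
Context (cBH : subalg cR) (hcBH : is_cBH nR B H cBH).
Let hv := pv_abs hp.
Let uR := banach_ultra hv hcR.1.
Let halg := btd_alg htri.
Local Notation valH := (@H_val K cR R H).

Lemma valH_scalar (k : K) : valH k%:A = k%:A.
Proof.
transitivity (val (k%:A : salg R)); last exact: subalg_scalar.
by congr (val _); exact: subalg_scalar.
Qed.

Context (L : lmodType cR) (nL : L -> RT) (C : RT) (hL : banach_mod v nR nL C) (mu : K).
Let uL := bm_ultra hL.
Local Notation LH := (restrict valH L).
Local Notation LX := (restrict (val : {rmorphism salg cBH -> cR}) L).
Context (W : submod LH).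
Context (Wn : exists2 y, y \in W & y != 0).
Context (WE : forall y, y \in W -> highest_vec gr B d mu y).
Context (Wmin : forall P : submod LH, (forall y, y \in P -> y \in W) ->
  (exists2 y, y \in P & y != 0) -> forall y, y \in W -> y \in P).

Lemma W_basis : exists q (f : 'I_q -> vsp K L), lin_indep f /\
  forall y, y \in W <-> span f y.
Proof.
have [y0 y0W y0n] := Wn; have [W0 WD WZ] := submod_set W.
have [r [g [_ hg]]] := atd_Hfin halg.
pose e i : vsp K L := (valH (g i) *: y0 : L).
have [q [f [fI fe fs]]] := basis_extract e.
exists q, f; split=> // y; split=> [yW|[c ->]].
  apply: fs; pose P : set LH := [set y | exists t : salg H, y = valH t *: y0].
  have P0 : P 0 by exists 0; rewrite raddf0 scale0r.
  have PD x z : P x -> P z -> P (x + z).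
    by move=> [a ->] [b ->]; exists (a + b); rewrite raddfD scalerDl.
  have PZ a x : P x -> P (a *: x).
    by move=> [b ->]; exists (a * b); rewrite rmorphM -scalerA.
  have /mksubP[t ->] : y \in mksub P0 PD PZ.
    apply: Wmin yW; first by move=> _ /mksubP[t ->]; exact: (WZ t).
    by exists y0 => //; apply/mksubP; exists 1; rewrite rmorph1 scale1r.
  have [//|c yc] := hg t; exists c; rewrite {1}yc /H_val /= val2_sum scaler_suml.
  by apply: eq_bigr => i _; rewrite -mulr_algl -scalerA.
apply: (submod_sum (N := W)) => i _; apply: (WZ (c i)%:A).
by have [j ->] := fe i; exact: (WZ (g j)).
Qed.

Context (q : nat) (f : 'I_q -> vsp K L) (fI : lin_indep f).
Context (fW : forall y, y \in W <-> span f y).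

Lemma W_nclosed : nclosed nL [set` W].
Proof.
have -> : [set` W] = span f by apply/seteqP; split=> y /fW.
exact: (@span_closed _ _ v hv (pv_complete hp) (vsp K L) nL uL (bm_scale hL) q f fI).
Qed.

Lemma W_BH y t : y \in W -> im (prod_span [set` B] [set` H]) t -> t *: y \in W.
Proof.
move=> yW [_ [n [b [h [bh ->]]]] <-]; have [W0 WD WZ] := submod_set W.
rewrite raddf_sum scaler_suml; apply: (submod_sum (N := W)) => i _.
have [biB hiH] := bh i.
have hy : valH (exist _ (h i) hiH) *: y \in W by exact: (WZ (exist _ (h i) hiH) y yW).
have [k hk] := hwv_B htri (WE hy) biB.
have -> : val (b i * h i) *: y = val (b i) *: (valH (exist _ (h i) hiH) *: y).
  by rewrite scalerA.
by rewrite hk; exact: (WZ k%:A).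
Qed.

(** [W] is stable under [B H], and closed because it is finite-dimensional. *)
Lemma W_cBH s y : s \in cBH -> y \in W -> s *: y \in W.
Proof.
move=> sBH yW; apply: W_nclosed => e e0.
have hs : nclosure nR (im (prod_span [set` B] [set` H])) s.
  by have : [set` cBH] s by []; rewrite hcBH.
have b0 : 0 < C * (nL y + 1) by rewrite mulr_gt0 ?(bm_C0 hL) // ltr_wpDl ?(un_ge0 uL).
have [t ht st] := hs _ (divr_gt0 e0 b0).
exists (t *: y); first exact: W_BH.
rewrite -scalerBl; apply: le_lt_trans (bm_C hL _ _) _.
move: st; rewrite ltr_pdivlMr //; apply: le_lt_trans.
have := mulr_ge0 (ltW (bm_C0 hL)) (un_ge0 uR (s - t)); lra.
Qed.

Fact WX_closed : submod_closed (sm_pred W : {pred LX}).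
Proof.
have [W0 WD WZ] := submod_set W.
split=> // a x y xW yW; apply: WD => //; apply: W_cBH => //; exact: valP.
Qed.
Definition WX : submod LX := Submod WX_closed.
Definition toX (y : smod W) : smod WX := exist _ (val y) (valP y).
Definition toW (y : smod WX) : smod W := exist _ (val y) (valP y).
Definition nW (y : smod W) : RT := nL (val y : L).
Definition nX (y : smod WX) : RT := nL (val y : L).

Lemma toWK y : toX (toW y) = y. Proof. exact: val_inj. Qed.
Lemma toXK y : toW (toX y) = y. Proof. exact: val_inj. Qed.

Lemma nW_banach : is_banach v (nW : vsp K (smod W) -> RT).
Proof. exact: (restrict_sub_banach hv hL valH_scalar W_nclosed). Qed.

Lemma nX_banach : is_banach v (nX : vsp K (smod WX) -> RT).
Proof. exact: (restrict_sub_banach hv hL (@subalg_scalar _ _ cBH) (P := WX) W_nclosed). Qed.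

Local Notation J := (cBHpos gr B H cBH).
Local Notation HX := (H_cBH hp hcR hcBH).

(** The elements that kill [WX] form a two-sided ideal, which contains the
   generators. *)
Lemma cBHpos_kill s (y : smod WX) : s \in J -> s *: y = 0.
Proof.
move=> sJ.
pose P : set (salg cBH)^o := [set s | forall y : smod WX, (s : salg cBH) *: y = 0].
have P0 : P 0 by move=> z; rewrite scale0r.
have PD s1 s2 : P s1 -> P s2 -> P (s1 + s2).
  by move=> h1 h2 z; rewrite scalerDl h1 h2 addr0.
have PZ a s1 : P s1 -> P (a *: s1).
  by move=> h1 z; rewrite -scalerA h1 scaler0.
have inP t := mksubP P0 PD PZ t.
have /inP : s \in mksub P0 PD PZ; last by apply.
have /asboolP := sJ; apply.
  move=> s1 s2 /inP h1; apply/inP => z.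
  exact: etrans (esym (scalerA s1 s2 z)) (h1 (s2 *: z)).
move=> s1 [t [n [b [h [bh ->]]]] ts1]; apply/inP => z; apply: val_inj.
rewrite smod_valZ; change (val s1 *: (val z : L) = 0).
rewrite -ts1 raddf_sum scaler_suml; apply: big1 => i _.
have [bi hi] := bh i.
have hz : highest_vec gr B d mu (val (h i) *: (val z : L)).
  by apply: (hwv_H hp htri hi); apply: WE; exact: (valP z).
exact: etrans (esym (scalerA _ _ _)) (hz.2 _ bi).
Qed.

Lemma toX_H (h : salg H) y : toX (h *: y) = HX h *: toX y.
Proof. exact: val_inj. Qed.

(** By [infl_pi], the choice of a representative of [p] does not matter. *)
Definition infl (p : quotmod J) (y : smod W) : smod WX := (repr p : salg cBH) *: toX y.

Lemma infl_pi (s : salg cBH) y : infl (\pi_(quotmod J) s) y = s *: toX y.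
Proof.
apply/eqP; rewrite -subr_eq0 /infl -scalerBl; apply/eqP; apply: cBHpos_kill.
by apply/quotmod_piP; rewrite reprK.
Qed.

Lemma ract_pi (s : salg cBH) (h : salg H) :
  cBHquot_ract (\pi_(quotmod J) s) h = \pi_(quotmod J) (s * HX h).
Proof.
rewrite /cBHquot_ract; set s' := repr _.
have -> : insubd 0 (val (s' : salg cBH) * val (val h)) = s' * HX h :> salg cBH.
  have hin : val (s' : salg cBH) * val (val h) \in cBH.
    exact: (valP ((s' : salg cBH) * HX h)).
  apply: val_inj; rewrite insubdK //.
apply/quotmod_piP; rewrite -mulrBl; apply: cBHpos_mulr.
by apply/quotmod_piP; rewrite reprK.
Qed.

Lemma infl_quot (p : quotmod J) (y : smod W) : exists h : salg H,
  p = \pi_(quotmod J) (HX h) /\ infl p y = toX (h *: y).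
Proof.
have [h hh] := cBH_split hp hcR htri cB_noeth hcBH (repr p).
have ph : p = \pi_(quotmod J) (HX h).
  by rewrite -[p in LHS]reprK; apply/quotmod_piP.
by exists h; split=> //; rewrite ph infl_pi toX_H.
Qed.

Lemma infl_add (s : salg cBH) (p1 p2 : quotmod J) y :
  infl (s *: p1 + p2) y = s *: infl p1 y + infl p2 y.
Proof.
elim/quotW: p1 => s1; elim/quotW: p2 => s2.
rewrite -quotmod_pi_scale -quotmod_piD !infl_pi scalerDl.
by congr (_ + _); exact/esym/scalerA.
Qed.

Lemma toX_add (k : K) y1 y2 : toX (k%:A *: y1 + y2) = k%:A *: toX y1 + toX y2.
Proof.
by apply: val_inj; congr (_ + _).
Qed.

Lemma toW_add (k : K) x1 x2 : toW (k%:A *: x1 + x2) = k%:A *: toW x1 + toW x2.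
Proof. by apply: val_inj; congr (_ + _). Qed.

Lemma scalar_comm (S : algType K) (M : lmodType S) (s : S) (k : K) (x y : M) :
  s *: (k%:A *: x + y) = k%:A *: (s *: x) + s *: y.
Proof. by rewrite scalerDr !scalerA mulr_algr mulr_algl. Qed.

Lemma infl_addr p (k : K) y1 y2 :
  infl p (k%:A *: y1 + y2) = k%:A *: infl p y1 + infl p y2.
Proof. by rewrite /infl toX_add scalar_comm. Qed.

Lemma ucBH : ultranorm (fun x : (salg cBH)^o => nR (val x)).
Proof.
split; first by move=> x; exact: (un_ge0 uR).
- move=> x; split=> [/(un_eq0 uR) h|->]; first exact: val_inj.
  exact: (un0 uR).
- by move=> x; exact: (un_opp uR).
by move=> x y; exact: (un_add uR).
Qed.

Lemma infl_bound p y :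
  nX (infl p y) <= C * quot_norm (fun x : (salg cBH)^o => nR (val x)) p * nW y.
Proof.
have C0 := ltW (bm_C0 hL); have nW0 : 0 <= nW y by exact: (un_ge0 uL).
rewrite mulrAC; apply: (qn_lb ucBH); first exact: mulr_ge0.
move=> s <-; rewrite infl_pi mulrAC; exact: (bm_C hL).
Qed.

Lemma infl_balanced p (h : salg H) y : infl (cBHquot_ract p h) y = infl p (h *: y).
Proof.
elim/quotW: p => s; rewrite ract_pi !infl_pi toX_H.
exact/esym/scalerA.
Qed.

(** Every class of [cBH] modulo its ideal is that of an element of [H], so
   that a balanced map is determined by its restriction to the class of 1
   and [W]. *)
Lemma inflation : is_inflation v nR gr B (smod W) (nX : vsp K (smod WX) -> RT).
Proof.
exists nW, infl; split; [exact: nW_banach|exact: nX_banach| |]; last first.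
  by move=> s p y; have := infl_add s p 0 y; rewrite addr0 => ->; rewrite -[0]quotmod_pi0 infl_pi scale0r addr0.
split.
- split.
  + move=> y k p1 p2; exact: (infl_add k%:A p1 p2 y).
  + move=> p k y1 y2; exact: (infl_addr p k y1 y2).
  + exists C => p y; exact: infl_bound.
- move=> p h y; exact: infl_balanced.
move=> V nV hV b [b1 b2 [Cb hCb]] bal.
pose one : quotmod J := \pi_(quotmod J) (1 : salg cBH).
have one_h (h : salg H) : cBHquot_ract one h = \pi_(quotmod J) (HX h).
  by rewrite ract_pi mul1r.
have toWX (y : smod W) : infl one y = toX y by rewrite infl_pi scale1r.
exists (fun x => b one (toW x)); split.
  split; first split.
  - move=> k x1 x2.
    exact: etrans (congr1 (b one) (toW_add k x1 x2)) (b2 one k (toW x1) (toW x2)).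
  - exists (Cb * quot_norm (fun x : (salg cBH)^o => nR (val x)) one) => x.
    exact: hCb.
  move=> p y; have [h [ph ->]] := infl_quot p y.
  by rewrite toXK -(bal one h y) one_h -ph.
move=> g [_ hg]; apply/funext => x.
by rewrite -(toWK x) -toWX hg toWX toXK.
Qed.
End Inflation.

(** * Construction of the Verma module *)

Section FinPower.
Context (RT : realType) (K : fieldType) (v : K -> RT) (hv : is_absv v).
Context (cR : algType K) (nR : cR -> RT) (hcR : is_banach_alg v nR).
Context (C : RT) (C0 : 0 < C) (hC : forall x y, nR (x * y) <= C * nR x * nR y).
Let uR := banach_ultra hv hcR.1.
Context (q : nat).
Local Notation F := {ffun 'I_q -> cR^o}.

Definition nF (u : F) : RT := \big[Num.max/0]_i nR (u i).

Lemma nF_ge i (u : F) : nR (u i) <= nF u.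
Proof. by rewrite /nF (bigD1 i) //= le_max lexx. Qed.
Lemma nF_ge0 (u : F) : 0 <= nF u.
Proof.
by rewrite /nF; elim/big_rec: _ => // i x _ x0; rewrite le_max x0 orbT.
Qed.
Lemma nF_le (u : F) e : 0 <= e -> (forall i, nR (u i) <= e) -> nF u <= e.
Proof.
by move=> e0 h; rewrite /nF; elim/big_rec: _ => // i x _ xe; rewrite ge_max h.
Qed.
Lemma nF_lt (u : F) e : 0 < e -> (forall i, nR (u i) < e) -> nF u < e.
Proof.
by move=> e0 h; rewrite /nF; elim/big_rec: _ => // i x _ xe; rewrite gt_max h.
Qed.

Lemma nF_bmod : banach_mod v nR nF C.
Proof.
have nX (k : K) (u : F) : nF (k%:A *: u) <= v k * nF u.
  apply: nF_le => [|i]; first by rewrite mulr_ge0 ?(av_ge0 hv) ?nF_ge0.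
  rewrite ffunE /GRing.scale /= mulr_algl (bn_scale hcR.1).
  by rewrite ler_wpM2l ?(av_ge0 hv) ?nF_ge.
have uF0 u : nF u = 0 -> u = 0.
  move=> u0; apply/ffunP => i; rewrite ffunE; apply/(un_eq0 uR)/eqP.
  by rewrite eq_le (un_ge0 uR) andbT -u0 nF_ge.
have F0 : nF 0 = 0.
  apply/eqP; rewrite eq_le nF_ge0 andbT; apply: nF_le => // i.
  by rewrite ffunE (un0 uR).
split=> //.
- split; [exact: nF_ge0| |by move=> u; apply: eq_bigr => i _; rewrite ffunE (un_opp uR)|].
    by move=> u; split=> [/uF0//|->].
  move=> x y; apply: nF_le => [|i]; first by rewrite le_max nF_ge0.
  rewrite ffunE; apply: le_trans (un_add uR _ _) _.
  by rewrite ge_max !le_max !nF_ge orbT.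
- move=> u hu; have /choice[l hl] i : exists l, tends nR (fun k => u k i) l.
    apply: (complete_steps uR (bn_complete hcR.1)) => e e0; have [N hN] := hu e e0.
    exists N => k Nk; apply: le_lt_trans (hN k.+1 k (leqW Nk) Nk).
    by have := nF_ge i (u k.+1 - u k); rewrite !ffunE.
  exists [ffun i => l i] => e e0; have /choice[N hN] i := hl i e e0.
  exists (\max_i N i)%N => k Nk; apply: nF_lt => // i; rewrite !ffunE.
  by apply: hN; apply: leq_trans Nk; exact: leq_bigmax.
- move=> k u; apply/eqP; rewrite eq_le nX /=.
  have [->|k0] := eqVneq k 0; first by rewrite (av0 hv) mul0r nF_ge0.
  rewrite -{1}[u](scaleAK _ k0) mulrC -ler_pdivlMr ?(av_neq0 hv) // mulrC -(avV hv).
  exact: nX.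
move=> r u; apply: nF_le => [|i].
  by rewrite !mulr_ge0 ?(ltW C0) ?(un_ge0 uR) ?nF_ge0.
rewrite ffunE; apply: le_trans (hC _ _) _.
by rewrite ler_wpM2l ?nF_ge ?mulr_ge0 ?(ltW C0) ?(un_ge0 uR).
Qed.
End FinPower.

Lemma mk_linear (A : nzRingType) (M N : lmodType A) (g : M -> N) : linear g ->
  exists f : {linear M -> N}, forall x, f x = g x.
Proof.
move=> hg; pose F : {linear M -> N} := HB.pack g (GRing.isLinear.Build A M N *:%R g hg).
by exists F.
Qed.

Section Bilinear.
Context (RT : realType) (K : fieldType) (v : K -> RT) (hv : is_absv v).
Context (cR : algType K) (nR : cR -> RT) (uR : ultranorm nR).
Context (CR : RT) (hCR : forall x y, nR (x * y) <= CR * nR x * nR y).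
Context (Y : lmodType K) (nY : Y -> RT) (uY : ultranorm nY).
Lemma bil_add (V : lmodType K) (nV : V -> RT) (b : cR -> Y -> V) :
  bounded_bilinear nR nY nV b ->
  [/\ forall r r' y, b (r + r') y = b r y + b r' y,
      forall (k : K) r y, b (k *: r) y = k *: b r y,
      forall r y y', b r (y + y') = b r y + b r y' &
      forall (k : K) r y, b r (k *: y) = k *: b r y].
Proof.
move=> [b1 b2 _].
have b0 y : b 0 y = 0.
  by apply: (addrI (b 0 y)); have := b1 y 1 0 0; rewrite !scale1r !addr0 => <-.
have b0' r : b r 0 = 0.
  by apply: (addrI (b r 0)); have := b2 r 1 0 0; rewrite !scale1r !addr0 => <-.
split=> [r r' y|k r y|r y y'|k r y].
- by rewrite -[r in LHS]scale1r b1 scale1r.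
- by rewrite -[_ *: r]addr0 b1 b0 addr0.
- by rewrite -[y in LHS]scale1r b2 scale1r.
by rewrite -[_ *: y]addr0 b2 b0' addr0.
Qed.

Lemma bil_sub (V : lmodType K) (nV : V -> RT) (b : cR -> Y -> V) :
  bounded_bilinear nR nY nV b -> forall r r' y, b (r - r') y = b r y - b r' y.
Proof.
move=> /bil_add[bD bZ _ _] r r' y.
by rewrite bD -[- r']scaleN1r bZ scaleN1r.
Qed.

Lemma bil_comp (V : lmodType K) (nV : V -> RT) (b : cR -> Y -> V) r0 :
  is_banach v nV -> bounded_bilinear nR nY nV b ->
  bounded_bilinear nR nY nV (fun r y => b (r0 * r) y).
Proof.
move=> hV hb; have [b1 b2 [C hC]] := hb; have uV := banach_ultra hv hV; split.
- by move=> y k r r'; rewrite mulrDr -scalerAr b1.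
- by move=> r k y y'; rewrite b2.
exists (Num.max C 0 * CR * nR r0) => r y; apply: le_trans (hC _ _) _.
have C1 : 0 <= Num.max C 0 by rewrite le_max lexx orbT.
apply: (@le_trans _ _ (Num.max C 0 * nR (r0 * r) * nY y)).
  rewrite ler_wpM2r ?(un_ge0 uY) // ler_wpM2r ?(un_ge0 uR) // le_max lexx //.
apply: ler_wpM2r; first exact: un_ge0.
have -> : Num.max C 0 * CR * nR r0 * nR r = Num.max C 0 * (CR * nR r0 * nR r) by ring.
exact: ler_wpM2l.
Qed.

End Bilinear.

Section Verma.
Context (RT : realType) (K : fieldType) (v : K -> RT) (hv : is_absv v).
Context (cR : algType K) (nR : cR -> RT) (hcR : is_banach_alg v nR).
Context (CR : RT) (CR0 : 0 < CR) (hCR : forall x y, nR (x * y) <= CR * nR x * nR y).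
Let uR := banach_ultra hv hcR.1.
Context (S : Type) (ringval : S -> cR) (X : lmodType K) (act : S -> X -> X) (nX : X -> RT).
Context (hX : is_banach v nX) (q : nat) (x : 'I_q -> X).
Context (co : 'I_q -> X -> K).
Context (coL : forall i, linear (co i : X -> K^o)).
Context (coE : forall y : X, y = \sum_i co i y *: x i).
Context (Ck : RT) (Ck0 : 0 <= Ck) (coC : forall i y, v (co i y) <= Ck * nX y).
Let uX := banach_ultra hv hX.
Local Notation F := {ffun 'I_q -> cR^o}.

Definition balanced (V : Type) (b : cR -> X -> V) : Prop :=
  forall r s y, b (r * ringval s) y = b r (act s y).

(** The relations of the completed tensor product, written as a quotient of
   the free module on the basis [x] of [X]: the vectors that all bounded
   balanced maps to Banach spaces kill. They include the relations
   expressing [act] in coordinates. *)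
Definition vrel : set F := [set u | forall (V : lmodType K) (nV : V -> RT),
  is_banach v nV -> forall b : cR -> X -> V, bounded_bilinear nR nX nV b ->
  balanced b -> \sum_i b (u i) (x i) = 0].

Lemma vrel0 : vrel 0.
Proof.
move=> V nV hV b hb bal; have [_ bZ _ _] := bil_add hb.
by apply: big1 => i _; rewrite ffunE; have := bZ 0 0 (x i); rewrite !scale0r.
Qed.
Lemma vrelD u u' : vrel u -> vrel u' -> vrel (u + u').
Proof.
move=> h h' V nV hV b hb bal; have [bD _ _ _] := bil_add hb.
under eq_bigr do rewrite ffunE bD.
by rewrite big_split /= (h V nV) ?(h' V nV) ?addr0.
Qed.
Lemma vrelZ r u : vrel u -> vrel (r *: u).
Proof.
move=> h V nV hV b hb bal; under eq_bigr do rewrite ffunE.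
apply: (h V nV hV (fun r' y => b (r * r') y)); first exact: (bil_comp hv uR hCR uX).
by move=> r' s y; rewrite mulrA bal.
Qed.
Definition vker : submod F := mksub vrel0 vrelD vrelZ.
Lemma vkerP u : u \in vker <-> vrel u. Proof. exact: mksubP. Qed.

(** Each of the conditions defining the relations is closed, as the maps are
   bounded. *)
Lemma vker_nclosed : nclosed (nF nR (q := q)) [set` vker].
Proof.
move=> u hu; apply/vkerP => V nV hV b hb bal; have uV := banach_ultra hv hV.
have [bD bZ _ _] := bil_add hb; have [_ _ [C hC]] := hb.
apply: (un_small0 uV) => e e0.
pose G := Num.max C 0 * \sum_i nX (x i) + 1.
have S0 : 0 <= \sum_i nX (x i) by apply: sumr_ge0 => i _; exact: un_ge0.
have C0 : 0 <= Num.max C 0 by rewrite le_max lexx orbT.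
have G0 : 0 < G by rewrite ltr_wpDl // mulr_ge0.
have [u' /vkerP u'N uu'] := hu (e / G) (divr_gt0 e0 G0).
have -> : \sum_i b (u i) (x i) = \sum_i b ((u - u') i) (x i).
  transitivity (\sum_i b (u i) (x i) - \sum_i b (u' i) (x i)).
    by rewrite (u'N V nV hV b hb bal) subr0.
  rewrite -sumrB; apply: eq_bigr => i _.
  by rewrite !ffunE; exact: (esym (bil_sub hb _ _ _)).
apply: (un_sum_lt uV) => // i _; apply: le_lt_trans (hC _ _) _.
move: uu'; rewrite ltr_pdivlMr //; apply: le_lt_trans.
have h1 := nF_ge nR i (u - u'); have h2 := nF_ge0 nR (u - u').
have h3 : 0 <= nR ((u - u') i) by exact: un_ge0.
have h4 : nX (x i) <= \sum_i nX (x i).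
  by rewrite (bigD1 i) //= lerDl; apply: sumr_ge0 => j _; exact: un_ge0.
have h5 : 0 <= nX (x i) by exact: un_ge0.
apply: (@le_trans _ _ (Num.max C 0 * nR ((u - u') i) * nX (x i))).
  by rewrite ler_wpM2r // ler_wpM2r // le_max lexx.
have h8 := ler_pM h3 (mulr_ge0 C0 h5) h1 (ler_wpM2l C0 h4).
by rewrite /G; lra.
Qed.

Definition verma : lmodType cR := quotmod vker.
Definition nverma : verma -> RT := quot_norm (nF nR (q := q)).

Lemma verma_bmod : banach_mod v nR nverma CR.
Proof. exact: (bmod_quot hv uR (nF_bmod hv hcR CR0 hCR q) vker_nclosed). Qed.

Definition vmap (r : cR) (y : X) : verma :=
  \pi_(quotmod vker) [ffun i => co i y *: r].

Lemma coD i y y' : co i (y + y') = co i y + co i y'.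
Proof. by rewrite -[y in LHS]scale1r coL scale1r. Qed.
Lemma co0 i : co i 0 = 0.
Proof. by apply: (addrI (co i 0)); rewrite -coD !addr0. Qed.
Lemma coZ i (k : K) y : co i (k *: y) = k * co i y.
Proof. by rewrite -[_ *: y]addr0 coL co0 addr0. Qed.

Lemma vmap_lin1 y (k : K) r r' : vmap (k *: r + r') y = k%:A *: vmap r y + vmap r' y.
Proof.
rewrite /vmap -quotmod_pi_scale -quotmod_piD; congr (\pi_(quotmod vker) _).
apply/ffunP => i; rewrite !ffunE scalerDr; congr (_ + _).
change (co i y *: (k *: r) = k%:A * (co i y *: r)).
by rewrite mulr_algl !scalerA mulrC.
Qed.
Lemma vmap_lin2 r (k : K) y y' : vmap r (k *: y + y') = k%:A *: vmap r y + vmap r y'.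
Proof.
rewrite /vmap -quotmod_pi_scale -quotmod_piD; congr (\pi_(quotmod vker) _).
apply/ffunP => i; rewrite !ffunE coD coZ scalerDl; congr (_ + _).
change ((k * co i y) *: r = k%:A * (co i y *: r)).
by rewrite mulr_algl scalerA.
Qed.
Lemma vmapM r r' y : vmap (r * r') y = r *: vmap r' y.
Proof.
rewrite /vmap -quotmod_pi_scale; congr (\pi_(quotmod vker) _).
apply/ffunP => i; rewrite !ffunE.
change (co i y *: (r * r') = r * (co i y *: r')).
by rewrite scalerAr.
Qed.

Lemma vmap_bound r y : nverma (vmap r y) <= Ck * nR r * nX y.
Proof.
apply: le_trans (qn_le (bm_ultra (nF_bmod hv hcR CR0 hCR q)) vker _) _.
apply: nF_le => [|i]; first by rewrite !mulr_ge0 ?(un_ge0 uR) ?(un_ge0 uX).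
rewrite ffunE (bn_scale hcR.1) mulrAC ler_wpM2r ?(un_ge0 uR) //.
Qed.

Lemma bilE (V : lmodType K) (nV : V -> RT) (b : cR -> X -> V) r y :
  bounded_bilinear nR nX nV b -> b r y = \sum_i b (co i y *: r) (x i).
Proof.
move=> hb; have [bD bZ bD' bZ'] := bil_add hb.
rewrite {1}(coE y).
have h0 : b r 0 = 0 by have := bZ' 0 r 0; rewrite !scale0r.
rewrite (big_morph (b r) (bD' r) h0); apply: eq_bigr => i _.
by rewrite bZ bZ'.
Qed.

Lemma vmap_balanced : balanced vmap.
Proof.
move=> r s y; apply/quotmod_piP/vkerP => V nV hV b hb bal.
have [bD bZ _ _] := bil_add hb.
have e i : b (([ffun i => co i y *: (r * ringval s)] - [ffun i => co i (act s y) *: r] : F) i) (x i) =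
   b (co i y *: (r * ringval s)) (x i) - b (co i (act s y) *: r) (x i).
  by rewrite !ffunE; exact: (bil_sub hb).
under eq_bigr do rewrite e.
by rewrite sumrB -!(bilE _ _ hb) bal subrr.
Qed.

Lemma vker_sum (u u' : F) : \pi_(quotmod vker) u = \pi_(quotmod vker) u' ->
  forall (V : lmodType K) (nV : V -> RT), is_banach v nV ->
  forall b : cR -> X -> V, bounded_bilinear nR nX nV b -> balanced b ->
  \sum_i b (u i) (x i) = \sum_i b (u' i) (x i).
Proof.
move=> /quotmod_piP/vkerP h V nV hV b hb bal.
apply/eqP; rewrite -subr_eq0 -sumrB; apply/eqP; rewrite -[RHS](h V nV hV b hb bal).
by apply: eq_bigr => i _; rewrite !ffunE; exact: (esym (bil_sub hb _ _ _)).
Qed.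

(** The [i]-th basis vector of the free module represents the tensor of 1
   and [x i]: the difference from its expansion in coordinates is a
   relation. *)
Lemma verma_pi (u : F) : \pi_(quotmod vker) u = \sum_i vmap (u i) (x i).
Proof.
pose sg i : F := [ffun k => if k == i then u i else 0].
have -> : u = \sum_i sg i.
  apply/ffunP => k; rewrite sum_ffunE (bigD1 k) //= ffunE eqxx big1 ?addr0 // => i ik.
  by rewrite ffunE eq_sym (negbTE ik).
have usg i : (\sum_j sg j) i = u i.
  rewrite sum_ffunE (bigD1 i) //= ffunE eqxx big1 ?addr0 // => j ji.
  by rewrite ffunE eq_sym (negbTE ji).
rewrite quotmod_pi_sum; apply: eq_bigr => i _; rewrite usg.
apply/quotmod_piP/vkerP => V nV hV b hb bal.
have [bD bZ _ _] := bil_add hb.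
have b0 y : b 0 y = 0 by have := bZ 0 0 y; rewrite !scale0r.
transitivity (\sum_k b (sg i k) (x k) - \sum_k b (co k (x i) *: u i) (x k)).
  rewrite -sumrB; apply: eq_bigr => k _.
  have -> : (sg i - [ffun k => co k (x i) *: u i]) k = sg i k - co k (x i) *: u i.
    by rewrite !ffunE.
  exact: (bil_sub hb).
rewrite -(bilE _ _ hb) (bigD1 i) //= ffunE eqxx big1 ?addr0 ?subrr // => k ki.
by rewrite ffunE (negbTE ki) b0.
Qed.

(** Bounded balanced maps factor through the quotient by definition of the
   relations, and uniquely since the tensors span by [verma_pi]. *)
Lemma verma_ctensor : is_ctensor v (S := S) (X := cR) (Y := X)
  (T := vsp K verma) nR nX nverma (fun r s => r * ringval s) act vmap.
Proof.
split.
- split; [exact: vmap_lin1|exact: vmap_lin2|].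
  by exists Ck => r y; exact: vmap_bound.
- exact: vmap_balanced.
move=> V nV hV b hb bal; have uV := banach_ultra hv hV.
have [bD bZ _ _] := bil_add hb.
pose g (p : verma) : V := \sum_i b ((repr p : F) i) (x i).
have gpi (u : F) : g (\pi_(quotmod vker) u) = \sum_i b (u i) (x i).
  by apply: (vker_sum _ hV hb bal); rewrite reprK.
have gadd : linear (g : vsp K verma -> V).
  move=> k p p'; rewrite -[p]reprK -[p']reprK.
  have -> : (k *: (\pi_(quotmod vker) (repr p) : vsp K verma) +
     (\pi_(quotmod vker) (repr p') : vsp K verma)) =
     \pi_(quotmod vker) (k%:A *: repr p + repr p').
    by rewrite quotmod_piD quotmod_pi_scale.
  rewrite !gpi scaler_sumr -big_split /=; apply: eq_bigr => i _.
  rewrite -bZ -bD; congr (b _ _); rewrite !ffunE; congr (_ + _).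
  by change (k%:A * (repr p : F) i = k *: (repr p : F) i); rewrite mulr_algl.
exists g; split.
  split; first split=> //.
    have [_ _ [C hC]] := hb; have C0 : 0 <= Num.max C 0 by rewrite le_max lexx orbT.
    have S0 : 0 <= \sum_i nX (x i) by apply: sumr_ge0 => i _; exact: un_ge0.
    exists (Num.max C 0 * \sum_i nX (x i)) => p.
    apply: (qn_lb (bm_ultra (nF_bmod hv hcR CR0 hCR q))); first exact: mulr_ge0.
    move=> u <-; rewrite gpi; have h2 := nF_ge0 nR u.
    apply: (un_sum_le uV) => [|i _]; first by rewrite !mulr_ge0.
    apply: le_trans (hC _ _) _.
    have h1 := nF_ge nR i u; have h3 : 0 <= nR (u i) by exact: un_ge0.
    have h5 : 0 <= nX (x i) by exact: un_ge0.
    have h4 : nX (x i) <= \sum_i nX (x i).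
      by rewrite (bigD1 i) //= lerDl; apply: sumr_ge0 => j _; exact: un_ge0.
    apply: (@le_trans _ _ (Num.max C 0 * nR (u i) * nX (x i))).
      by rewrite ler_wpM2r // ler_wpM2r // le_max lexx.
    have h8 := ler_pM h3 (mulr_ge0 C0 h5) h1 (ler_wpM2l C0 h4).
    by lra.
  by move=> r y; rewrite /vmap gpi (bilE _ _ hb); apply: eq_bigr => i _; rewrite ffunE.
move=> g' [[g'L _] hg']; apply/funext => p.
have g'D (p1 p2 : verma) : g' (p1 + p2) = g' p1 + g' p2.
  by have := g'L 1 p1 p2; rewrite !scale1r.
have g'0 : g' 0 = 0 by apply: (addrI (g' 0)); rewrite -g'D !addr0.
rewrite -[p]reprK gpi verma_pi (big_morph g' g'D g'0).
by apply: eq_bigr => i _; rewrite hg'.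
Qed.

(** The map from [cR] times [X] sending [(r, y)] to [r *: phi y] is
   balanced. *)
Lemma verma_map (L : lmodType cR) (nL : L -> RT) (C : RT) (hL : banach_mod v nR nL C)
    (phi : X -> L) : (forall (k : K) y y', phi (k *: y + y') = k%:A *: phi y + phi y') ->
  (forall s y, phi (act s y) = ringval s *: phi y) -> (forall y, nL (phi y) <= nX y) ->
  exists g : {linear verma -> L}, forall r y, g (vmap r y) = r *: phi y.
Proof.
move=> phiL phiS phiN; have uL := bm_ultra hL.
pose b (r : cR) (y : X) : vsp K L := (r *: phi y : L).
have hV : is_banach v (nL : vsp K L -> RT).
  by apply/(banach_vsp hv); split; [exact: uL|exact: (bm_complete hL)|exact: (bm_scale hL)].
have hb : bounded_bilinear nR nX (nL : vsp K L -> RT) b.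
  split.
  - move=> y k r r'; change ((k *: r + r') *: phi y = k%:A *: (r *: phi y) + r' *: phi y).
    by rewrite scalerDl scalerA mulr_algl.
  - move=> r k y y'; exact: etrans (congr1 (fun t => r *: t) (phiL k y y')) (scalar_comm _ _ _ _).
  exists C => r y; apply: le_trans (bm_C hL _ _) _.
  by apply: ler_wpM2l (phiN y); rewrite mulr_ge0 ?(ltW (bm_C0 hL)) ?(un_ge0 uR).
have bal : balanced b.
  by move=> r s y; rewrite /b phiS scalerA.
pose g (p : verma) : L := \sum_i b ((repr p : F) i) (x i).
have gpi (u : F) : g (\pi_(quotmod vker) u) = \sum_i b (u i) (x i).
  by apply: (vker_sum _ hV hb bal); rewrite reprK.
have gL : linear (g : verma -> L).
  move=> a p p'; rewrite -[p]reprK -[p']reprK -quotmod_pi_scale -quotmod_piD !gpi.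
  rewrite scaler_sumr -big_split /=; apply: eq_bigr => i _.
  by rewrite /b !ffunE scalerDl -scalerA.
have [f hf] := mk_linear gL; exists f => r y; rewrite hf /vmap gpi.
rewrite -[RHS]/(b r y) (bilE _ _ hb); apply: eq_bigr => i _.
by rewrite ffunE.
Qed.
End Verma.

(** The properties of the Verma module that do not depend on its
   construction as a quotient. *)
Record verma_model (RT : realType) (K : fieldType) (v : K -> RT) (cR : algType K)
    (nR : cR -> RT) (cS : subalg cR) (X : lmodType (salg cS)) (nX : vsp K X -> RT)
    (q : nat) (x : 'I_q -> X) (D : lmodType cR) (nD : D -> RT) (C : RT)
    (t : cR -> vsp K X -> D) : Prop := {
  vm_bmod : banach_mod v nR nD C;
  vm_tensor : is_ctensor v (S := salg cS) (X := cR) (Y := vsp K X) (T := vsp K D)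
    nR nX nD (fun r s => r * val s) (fun s y => s *: (y : X)) t;
  vm_lin1 : forall y (k : K) r r', t (k *: r + r') y = k%:A *: t r y + t r' y;
  vm_lin2 : forall r (k : K) (y y' : X),
    t r (k%:A *: y + y') = k%:A *: t r y + t r y';
  vm_bal : forall r (s : salg cS) (y : X), t (r * val s) y = t r (s *: y);
  vm_bound : exists C', 0 <= C' /\ forall r (y : X), nD (t r y) <= C' * nR r * nX y;
  vm_act : forall r r' y, t (r * r') y = r *: t r' y;
  vm_span : forall p, exists u : 'I_q -> cR, p = \sum_i t (u i) (x i);
  vm_map : forall (L : lmodType cR) (nL : L -> RT) (C' : RT), banach_mod v nR nL C' ->
    forall phi : X -> L,
    (forall (k : K) y y', phi (k%:A *: y + y') = k%:A *: phi y + phi y') ->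
    (forall s y, phi (s *: y) = val s *: phi y) -> (forall y, nL (phi y) <= nX y) ->
    exists g : {linear D -> L}, forall r y, g (t r y) = r *: phi y }.

Lemma verma_model_exists (RT : realType) (K : fieldType) (v : K -> RT)
    (hv : is_absv v) (cR : algType K) (nR : cR -> RT) (hcR : is_banach_alg v nR)
    (CR : RT) (CR0 : 0 < CR) (hCR : forall x y, nR (x * y) <= CR * nR x * nR y)
    (cS : subalg cR) (X : lmodType (salg cS)) (nX : vsp K X -> RT)
    (hX : is_banach v nX) (q : nat) (x : 'I_q -> X) (co : 'I_q -> vsp K X -> K) Ck :
  (forall i, linear (co i : vsp K X -> K^o)) ->
  (forall y : X, y = \sum_i (co i y)%:A *: x i) ->
  0 <= Ck -> (forall i y, v (co i y) <= Ck * nX y) ->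
  exists (D : lmodType cR) (nD : D -> RT) (t : cR -> vsp K X -> D),
    verma_model v nR nX x nD CR t.
Proof.
move=> coL coE Ck0 coC.
pose act (s : salg cS) (y : vsp K X) : vsp K X := s *: (y : X).
pose rv (s : salg cS) : cR := val s.
exists (@verma _ _ v hv _ nR hcR CR hCR _ rv (vsp K X) act nX hX q x),
  (@nverma _ _ v hv _ nR hcR CR hCR _ rv (vsp K X) act nX hX q x),
  (@vmap _ _ v hv _ nR hcR CR hCR _ rv (vsp K X) act nX hX q x co).
split.
- exact: verma_bmod.
- exact: (@verma_ctensor _ _ v hv _ nR hcR CR CR0 hCR _ rv (vsp K X) act nX hX q x co coL coE Ck Ck0 coC).
- by move=> y k r r'; exact: vmap_lin1.
- by move=> r k y y'; apply: vmap_lin2 coL _ _ _ _.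
- move=> r s y; exact: (@vmap_balanced _ _ v hv _ nR hcR CR hCR _ rv (vsp K X) act nX hX q x co coE).
- by exists Ck; split=> // r y; exact: vmap_bound.
- by move=> r r' y; exact: vmapM.
- move=> p; exists (repr p : {ffun 'I_q -> cR^o}).
  by rewrite -[p in LHS]reprK; apply: verma_pi.
move=> L nL C' hL phi h1 h2 h3.
apply: (@verma_map _ _ v hv _ nR hcR CR hCR _ rv (vsp K X) act nX hX q x co coE L nL C' hL phi) => //.
Qed.

(** * The Verma module over the completion of [A] *)

Lemma bounded_linear_sum (RT : realType) (K : fieldType) (V V' : lmodType K)
    (n : V -> RT) (n' : V' -> RT) (un : ultranorm n) (un' : ultranorm n') (I : finType)
    (f : I -> V -> V') : (forall i, bounded_linear n n' (f i)) ->
  bounded_linear n n' (fun y => \sum_i f i y).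
Proof.
move=> hf; split.
  move=> k y y'; rewrite scaler_sumr -big_split /=; apply: eq_bigr => i _.
  by have [fL _] := hf i; rewrite fL.
have /choice[C hC] i : exists C, forall y, n' (f i y) <= C * n y.
  by have [_ [C hC]] := hf i; exists C.
exists (\sum_i Num.max (C i) 0) => y.
have C0 i : 0 <= Num.max (C i) 0 by rewrite le_max lexx orbT.
have n0 := un_ge0 un y.
apply: (un_sum_le un') => [|i _]; first by rewrite mulr_ge0 // sumr_ge0.
apply: le_trans (hC i y) _; rewrite ler_wpM2r //.
apply: (@le_trans _ _ (Num.max (C i) 0)); first by rewrite le_max lexx.
by rewrite (bigD1 i) //= lerDl sumr_ge0.
Qed.

Section VermaProps.
Context (RT : realType) (K : fieldType) (v : K -> RT) (w : K) (hp : pvalued v w).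
Context (cR : algType K) (nR : cR -> RT) (hcR : is_banach_alg v nR).
Context (R : subalg cR) (gr : int -> submod (salg R)).
Context (A B H : subalg (salg R)) (d : salg R) (cA cB : subalg cR).
Context (htri : banach_tridec v nR gr A B H d cA cB).
Context (cBH : subalg cR) (hcBH : is_cBH nR B H cBH).
Let hv := pv_abs hp.
Let uR := banach_ultra hv hcR.1.
Context (CR : RT) (CR0 : 0 < CR) (hCR : forall x y, nR (x * y) <= CR * nR x * nR y).

Context (X : lmodType (salg cBH)) (nX : vsp K X -> RT) (hX : is_banach v nX).
Context (q : nat) (x : 'I_q -> X) (co : 'I_q -> vsp K X -> K).
Context (coL : forall i, linear (co i : vsp K X -> K^o)).
Context (coE : forall y : X, y = \sum_i (co i y)%:A *: x i).
Context (Ck : RT) (Ck0 : 0 <= Ck) (coC : forall i y, v (co i y) <= Ck * nX y).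
Context (CX : RT) (CX0 : 0 <= CX).
Context (hCX : forall (s : salg cBH) (y : X), nX (s *: y) <= CX * nR (val s) * nX y).
Let uX : ultranorm (nX : X -> RT) := banach_ultra hv hX.
Context (D : lmodType cR) (nD : D -> RT) (t : cR -> vsp K X -> D).
Context (hD : verma_model v nR nX x nD CR t).
Let uD := bm_ultra (vm_bmod hD).

Local Notation HX := (H_cBH hp hcR hcBH).
Local Notation BX := (cB_cBH hp hcR htri hcBH).

Lemma t_lin1 y (k : K) r r' : t (k *: r + r') y = k%:A *: t r y + t r' y.
Proof. exact: (vm_lin1 hD). Qed.
Lemma t_lin2 r (k : K) (y y' : X) : t r (k%:A *: y + y') = k%:A *: t r y + t r y'.
Proof. exact: (vm_lin2 hD). Qed.
Lemma t_bal r (s : salg cBH) (y : X) : t (r * val s) y = t r (s *: y).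
Proof. exact: (vm_bal hD). Qed.
Lemma t_bound : exists C, 0 <= C /\ forall r (y : X), nD (t r y) <= C * nR r * nX y.
Proof. exact: (vm_bound hD). Qed.
Lemma t_add2 r (y y' : X) : t r (y + y') = t r y + t r y'.
Proof. by have := t_lin2 r 1 y y'; rewrite !scale1r. Qed.
Lemma t_zero2 r : t r 0 = 0.
Proof. by apply: (addrI (t r 0)); rewrite -t_add2 !addr0. Qed.
Lemma t_scal2 r (k : K) (y : X) : t r (k%:A *: y) = k%:A *: t r y.
Proof. by have := t_lin2 r k y 0; rewrite !addr0 t_zero2 addr0. Qed.
Lemma t_act r y : t r y = r *: t 1 y.
Proof. by rewrite -[r in LHS]mulr1 (vm_act hD). Qed.

Lemma t_expand r (y : X) : t r y = \sum_j ((co j y)%:A * r) *: t 1 (x j).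
Proof.
rewrite {1}(coE y) (big_morph (t r) (t_add2 r) (t_zero2 r)).
apply: eq_bigr => j _; rewrite t_scal2 t_act scalerA.
by [].
Qed.

Definition HBact (y : X) (h : salg H) (b : salg cB) : X := (HX h * BX b) *: y.

Lemma HBact1 y (k : K) h h' b : HBact y (k *: h + h') b = k%:A *: HBact y h b + HBact y h' b.
Proof.
have e : HX (k *: h + h') = k%:A * HX h + HX h'.
  by apply: val_inj; rewrite mulr_algl.
by rewrite /HBact e mulrDl scalerDl -mulrA -scalerA.
Qed.
Lemma HBact2 y (k : K) h b b' : HBact y h (k *: b + b') = k%:A *: HBact y h b + HBact y h b'.
Proof.
have e : BX (k *: b + b') = k%:A * BX b + BX b'.
  by apply: val_inj; rewrite mulr_algl.
have e2 : HX h * (k%:A * BX b) = k%:A * (HX h * BX b) by rewrite !mulr_algl scalerAr.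
rewrite /HBact e mulrDr scalerDl e2; congr (_ + _).
exact: esym (scalerA _ _ _).
Qed.
Lemma HBact_bound y : exists2 C, 0 <= C & forall h b,
  nX (HBact y h b) <= C * nR (val (val h)) * nR (val b).
Proof.
exists (CX * CR * nX y) => [|h b].
  by rewrite !mulr_ge0 ?(ltW CR0) ?(un_ge0 uX).
apply: le_trans (hCX _ _) _.
have -> : CX * CR * nX y * nR (val (val h)) * nR (val b) =
  CX * (CR * nR (val (val h)) * nR (val b)) * nX y by ring.
by rewrite ler_wpM2r ?(un_ge0 uX) // ler_wpM2l //; exact: hCR.
Qed.

Lemma coD2 j (k : K) (y y' : X) : co j (k%:A *: y + y') = k * co j y + co j y'.
Proof. exact: coL. Qed.

Let bcA : is_banach_alg v (fun a : salg cA => nR (val a)).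
Proof. exact: (closed_subalg_banach hp hcR (closure_banach hp hcR (btd_cA htri))). Qed.

(** The universal property of the decomposition of [cR], applied to the
   coordinates of [h * b *: y]. *)
Lemma coord_map (y : X) j : exists F : cR -> salg cA,
  bounded_linear nR (fun a : salg cA => nR (val a)) F /\
  forall (a : salg cA) (h : salg H) (b : salg cB),
    F (val a * val (val h) * val b) = co j (HBact y h b) *: a.
Proof.
have [_ hT] := btd_tensor htri; have [C C0 hC] := HBact_bound y.
have [|F [hF _]] := hT _ _ bcA.1 (fun a h b => co j (HBact y h b) *: a); last by exists F.
split; first split.
- by move=> h b k a a'; rewrite scalerDr !scalerA mulrC.
- by move=> a b k h h'; rewrite HBact1 coD2 scalerDl scalerA.
- by move=> a h k b b'; rewrite HBact2 coD2 scalerDl scalerA.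
exists (Ck * C) => a h b; rewrite (bn_scale bcA.1).
have -> : Ck * C * nR (val a) * nR (val (val h)) * nR (val b) =
  Ck * (C * nR (val (val h)) * nR (val b)) * nR (val a) by ring.
rewrite ler_wpM2r ?(un_ge0 uR) //; apply: le_trans (coC _ _) _.
by rewrite ler_wpM2l.
Qed.

(** Both sides are bounded linear in [r] and agree on the products [a * h *
   b], as [h * b] acts on [y] inside [X]; the uniqueness in the universal
   property of the decomposition of [cR] concludes. *)
Lemma verma_gen1 r (y : X) : exists a : 'I_q -> cR, (forall i, a i \in cA) /\
  t r y = \sum_i a i *: t 1 (x i).
Proof.
have /choice[F hF] := coord_map y.
exists (fun j => val (F j r)); split=> [j|]; first exact: valP.
have hVD : is_banach v (nD : vsp K D -> RT).
  apply/(banach_vsp hv); split; [exact: uD|exact: (bm_complete (vm_bmod hD))|].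
  exact: (bm_scale (vm_bmod hD)).
have [_ hT] := btd_tensor htri; have [C C0 hC] := HBact_bound y.
have [Ct [Ct0 hCt]] := t_bound.
pose bb (a : salg cA) (h : salg H) (b : salg cB) : vsp K D := t (val a) (HBact y h b).
have tri : bounded_trilinear (fun a : salg cA => nR (val a))
    (fun h : salg H => nR (val (val h))) (fun b : salg cB => nR (val b))
    (nD : vsp K D -> RT) bb.
  split; first split.
  - by move=> h b k a a'; exact: t_lin1.
  - move=> a b k h h'; rewrite /bb HBact1; exact: t_lin2.
  - move=> a h k b b'; rewrite /bb HBact2; exact: t_lin2.
  exists (Ct * C) => a h b; apply: le_trans (hCt _ _) _.
  have -> : Ct * C * nR (val a) * nR (val (val h)) * nR (val b) =
    Ct * nR (val a) * (C * nR (val (val h)) * nR (val b)) by ring.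
  by rewrite ler_wpM2l // mulr_ge0 ?(un_ge0 uR).
have [G [_ Gu]] := hT _ _ hVD _ tri.
have G1 : G = (fun r => t r y : vsp K D).
  apply: Gu; split; first split.
  - by move=> k r1 r2; exact: t_lin1.
  - exists (Ct * nX y) => r1; apply: le_trans (hCt _ _) _.
    by rewrite mulrAC.
  move=> a h b; rewrite -mulrA.
  exact: (t_bal (val a) (HX h * BX b) y).
have G2 : G = (fun r => \sum_j (val (F j r) *: t 1 (x j) : D) : vsp K D).
  apply: Gu; split.
    apply: (bounded_linear_sum uR (uD : @ultranorm _ (vsp K D) nD)) => j.
    have [[FL [CF hCF]] _] := hF j; split.
      move=> k r1 r2; rewrite FL.
      change ((k *: val (F j r1) + val (F j r2)) *: t 1 (x j) =
        k%:A *: (val (F j r1) *: t 1 (x j)) + val (F j r2) *: t 1 (x j)).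
      by rewrite scalerDl -[_ *: val (F j r1)]mulr_algl -scalerA.
    exists (CR * CF * nD (t 1 (x j))) => r1.
    apply: le_trans (bm_C (vm_bmod hD) _ _) _.
    have -> : CR * CF * nD (t 1 (x j)) * nR r1 = CR * (CF * nR r1) * nD (t 1 (x j)) by ring.
    by rewrite ler_wpM2r ?(un_ge0 uD) // ler_wpM2l ?(ltW CR0).
  move=> a h b; rewrite /bb t_expand; apply: eq_bigr => j _.
  have [_ ->] := hF j.
  exact: (congr1 (fun c => c *: t 1 (x j)) (esym (mulr_algl (co j (HBact y h b)) (val a)))).
have := congr1 (fun f : cR -> vsp K D => f r) G1; rewrite G2.
by move=> <-.
Qed.

Lemma verma_gen p : exists a : 'I_q -> cR, (forall i, a i \in cA) /\
  p = \sum_i a i *: t 1 (x i).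
Proof.
have [u ->] := vm_span hD p.
have /choice[a ha] i := verma_gen1 (u i) (x i).
exists (fun j => \sum_i a i j); split=> [j|].
  by apply: rpred_sum => i _; case: (ha i).
under eq_bigr do rewrite (ha _).2.
by rewrite exchange_big; apply: eq_bigr => j _; rewrite scaler_suml.
Qed.

Context (mu : K).
Context (Bkill : forall (s : salg cBH) b, Bneg gr B b -> val s = val b ->
  forall y : X, s *: y = 0).
Context (d0_mu : forall d0 : salg H, LBneg gr B (d - val d0) ->
  forall y : X, HX d0 *: y = mu%:A *: y).

(** [d] is congruent to an element of [H] modulo the left ideal generated by
   the negative part of [B], which kills the tensors of 1 and elements of
   [X]. *)
Lemma verma_weight (y : X) : val d *: t 1 y = mu%:A *: t 1 y.
Proof.
have [d0 [d0H hd0]] := d_decomp htri.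
pose P : set (salg R)^o := [set r | t (val (r : salg R)) y = 0].
have t_add1 r r' : t (r + r') y = t r y + t r' y.
  by have := t_lin1 y 1 r r'; rewrite !scale1r.
have P0 : P 0 by apply: (addrI (t 0 y)); rewrite -t_add1 !addr0.
have PD r r' : P r -> P r' -> P (r + r').
  by move=> hr hr'; rewrite /P /= t_add1 hr hr' addr0.
have PZ a r : P r -> P (a *: r).
  by move=> hr; rewrite /P /= (vm_act hD) hr scaler0.
have /(mksubP P0 PD PZ) hd : (d - d0 : (salg R)^o) \in mksub P0 PD PZ.
  apply: hd0 => b hb; apply/(mksubP P0 PD PZ).
  have bBH : val b \in cBH by apply: (B_sub_cBH hp hcR hcBH); case: hb.
  have := t_bal 1 (exist _ (val b) bBH) y; rewrite mul1r /= => h.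
  rewrite /P /= h (Bkill hb (s := exist _ (val b) bBH)) //; exact: t_zero2.
rewrite -t_act -t_scal2 -(d0_mu (d0 := exist _ d0 d0H) hd0) -t_bal mul1r /=.
have -> : val d = val (d - d0) + val d0 by rewrite -subalg_valD subrK.
rewrite t_add1; move: hd; rewrite /P /= => ->.
by rewrite add0r.
Qed.

Lemma verma_wgen : weight_gens (val d) [set` cA] (fun _ : 'I_q => mu) (fun i => t 1 (x i)) 1.
Proof.
split=> [i|p]; last by have [a ha] := verma_gen p; exists a.
by rewrite /shift expr1 scalerBl verma_weight subrr.
Qed.

Lemma verma_fin_gen :
  fin_gen [set: restrict (val : {rmorphism salg cA -> cR}) D].
Proof.
exists q, (fun i => t 1 (x i)); split=> // p _.
have [a [ha ->]] := verma_gen p.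
by exists (fun i => exist _ (a i) (ha i)).
Qed.
End VermaProps.

(** * The unique simple quotient *)

Section UniqueQuotient.
Context (RT : realType) (K : fieldType) (v : K -> RT) (w : K) (hp : pvalued v w).
Context (cR : algType K) (nR : cR -> RT) (hcR : is_banach_alg v nR).
Context (R : subalg cR) (gr : int -> submod (salg R)).
Context (A B H : subalg (salg R)) (d : salg R) (cA cB : subalg cR).
Context (htri : banach_tridec v nR gr A B H d cA cB).
Let halg := btd_alg htri.
Let hA : weight_graded v w nR (val d) [set` cA] (Apart gr A) := cA_galg hp hcR htri.
Context (D : lmodType cR) (nD : D -> RT) (C : RT) (hD : banach_mod v nR nD C).
Context (cl : forall U : submod D, nclosed nD [set` U]).
Context (q : nat) (g : 'I_q -> D) (mu : K).
Context (hW : weight_gens (val d) [set` cA] (fun _ : 'I_q => mu) g 1).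

(** In the Verma module, the tensors of 1 and elements of [X]. *)
Definition top_part : set D := [set y | exists k : 'I_q -> K, y = \sum_i (k i)%:A *: g i].

Context (top_proper : forall U : submod D, (exists y, y \notin U) ->
  forall y, top_part y -> y \in U -> y = 0).

(** A homogeneous element of [cA] that preserves the weight has degree 0,
   hence is a scalar. *)
Lemma wspace_top y : wspace (Apart gr A) (fun _ : 'I_q => mu) g mu y -> top_part y.
Proof.
move=> [u -> hu].
have /choice[k hk] i : exists k : K, u i = k%:A.
  have [->|/hu[n mun]] := eqVneq (u i) 0; first by exists 0; rewrite scale0r.
  have -> : n = 0%N.
    by apply: (pv_char0 hp); apply: (addrI mu); rewrite -mun addr0.
  move=> [a [aA a0 ->]].
  have /(atd_A0 halg)[k ->] : (a \in A) && (a \in gr 0) by rewrite aA a0.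
  by exists k.
by exists k; apply: eq_bigr => i _; rewrite hk.
Qed.

(** A submodule contains the components of its elements, and those of weight
   [mu] are in the top. *)
Lemma proper_top (U : submod D) y c : (exists z, z \notin U) -> y \in U ->
  expands (val d) nD (fun _ : 'I_q => mu) 1 y c -> c mu = 0.
Proof.
move=> Up yU yc; have [c' yc' wc'] := expands_ex hA hD hW y.
rewrite (expands_uniq hA hD yc yc'); apply: (top_proper Up); first exact/wspace_top/wc'.
exact: (component_closed hA hD mu (cl (U := U)) yU yc').
Qed.

Fact ker_submod_closed (L : lmodType cR) (f : {linear D -> L}) :
  submod_closed [pred p | f p == 0].
Proof.
split=> [|a p p']; rewrite !inE ?linear0 ?eqxx // => /eqP hp1 /eqP hp2.
by rewrite linearP hp1 hp2 scaler0 addr0.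
Qed.
Definition ker_submod (L : lmodType cR) (f : {linear D -> L}) : submod D :=
  Submod (ker_submod_closed f).
Lemma ker_submodP (L : lmodType cR) (f : {linear D -> L}) p : p \in ker_submod f <-> f p = 0.
Proof. by split=> /eqP. Qed.

Lemma ker_submod_proper (L : lmodType cR) (f : {linear D -> L}) : simple_mod L ->
  (forall y, exists p, f p = y) -> exists p, p \notin ker_submod f.
Proof.
move=> [[y y0] _] fs; have [p py] := fs y; exists p; apply/negP => /ker_submodP.
by rewrite py => h; rewrite h eqxx in y0.
Qed.

(** Suppose that [f1] does not vanish on the kernel of [f2]. Then [f1] maps
   this kernel onto [L1], so that the top vector [y0] is the sum of an
   element of the kernel of [f2] and one of the kernel of [f1]. Neither has
   a component of weight [mu], by [proper_top], whereas [y0] is of weight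
   [mu]. *)
Lemma kernel_sub (L1 L2 : lmodType cR) (f1 : {linear D -> L1}) (f2 : {linear D -> L2}) y0 :
  top_part y0 -> y0 != 0 -> simple_mod L1 -> simple_mod L2 ->
  (forall y, exists p, f1 p = y) -> (forall y, exists p, f2 p = y) ->
  forall p, f2 p = 0 -> f1 p = 0.
Proof.
move=> y0t y0n s1 s2 f1s f2s p p2; apply: contrapT => p1.
pose P : set L1 := [set z | exists2 p, f2 p = 0 & f1 p = z].
have P0 : P 0 by exists 0; rewrite linear0.
have PD y y' : P y -> P y' -> P (y + y').
  move=> [a a2 <-] [b b2 <-]; exists (a + b); last by rewrite linearD.
  by rewrite linearD a2 b2 addr0.
have PZ a y : P y -> P (a *: y).
  by move=> [b b2 <-]; exists (a *: b); rewrite linearZ //= b2 scaler0.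
have inP y := mksubP P0 PD PZ y.
have [z0|zall] := s1.2 (mksub P0 PD PZ).
  by apply: p1; apply: z0; apply/inP; exists p.
have /inP[p' p'2 p'1] := zall (f1 y0).
have k2 : p' \in ker_submod f2 by apply/ker_submodP.
have k1 : y0 - p' \in ker_submod f1 by apply/ker_submodP; rewrite linearB /= p'1 subrr.
have [c2 e2 _] := expands_ex hA hD hW p'.
have [c1 e1 _] := expands_ex hA hD hW (y0 - p').
have e0 := expandsD hD e1 e2; rewrite subrK in e0.
have c1mu := proper_top (ker_submod_proper s1 f1s) k1 e1.
have c2mu := proper_top (ker_submod_proper s2 f2s) k2 e2.
have Z := zero_submod_nclosed hD.
move/eqP: y0n; apply; apply/zero_submodP.
apply: (expands_in Z e0) => l; apply/zero_submodP.
have [->|lmu] := eqVneq l mu; first by rewrite c1mu c2mu addr0.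
apply/zero_submodP; apply: (expands_shift hA hD (mu := mu) (k := 1) Z e0 _ lmu).
apply/zero_submodP; have [k ->] := y0t; rewrite /shift expr1 scaler_sumr big1 // => i _.
have := wg_nil hW i; rewrite /shift expr1 => h.
rewrite scalerA.
have -> : (val d - mu%:A) * (k i)%:A = (k i)%:A * (val d - mu%:A).
  by rewrite mulr_algr mulr_algl.
by rewrite -scalerA h scaler0.
Qed.
End UniqueQuotient.

Section HeadModel.
Context (RT : realType) (K : fieldType) (v : K -> RT) (w : K) (hp : pvalued v w).
Context (cR : algType K) (nR : cR -> RT) (hcR : is_banach_alg v nR).
Context (R : subalg cR) (gr : int -> submod (salg R)).
Context (A B H : subalg (salg R)) (d : salg R) (cA cB : subalg cR).
Context (htri : banach_tridec v nR gr A B H d cA cB).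
Context (cA_noeth : noetherian (salg cA)).
Context (cBH : subalg cR) (hcBH : is_cBH nR B H cBH).
Let hv := pv_abs hp.
Context (L : lmodType cR) (nL : L -> RT) (C : RT) (hL : banach_mod v nR nL C) (mu : K).
Context (Ls : simple_mod L).
Context (W : lmodType (salg H)) (X : lmodType (salg cBH)) (nX : vsp K X -> RT).
Context (hX : is_banach v nX) (hI : is_inflation v nR gr B W nX) (Xs : simple_mod X).
Context (j : X -> L).
Context (jD : forall y y', j (y + y') = j y + j y') (jS : forall s y, j (s *: y) = val s *: j y).
Context (jN : forall y, nX y = nL (j y)) (j_inj : forall y, j y = 0 -> y = 0).
Context (jh : forall y, highest_vec gr B d mu (j y)).
Context (q : nat) (f : 'I_q -> vsp K L) (fI : lin_indep f).
Context (jf : forall y, span f (j y)) (x : 'I_q -> X) (jx : forall i, j (x i) = f i).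

Lemma jZ (k : K) y : j (k%:A *: y) = k%:A *: j y.
Proof. by rewrite jS subalg_scalar. Qed.

Lemma jI y y' : j y = j y' -> y = y'.
Proof.
move=> e; apply/eqP; rewrite -subr_eq0; apply/eqP/j_inj.
by apply: (addIr (j y')); rewrite -jD subrK add0r.
Qed.

(** Coordinates on the finite-dimensional space [X] are bounded. *)
Lemma head_coord : exists (co : 'I_q -> vsp K X -> K) (Ck : RT),
  [/\ forall i, linear (co i : vsp K X -> K^o),
      forall y : X, y = \sum_i (co i y)%:A *: x i,
      0 <= Ck & forall i y, v (co i y) <= Ck * nX y].
Proof.
have /choice[c hc] (y : X) : exists c : 'I_q -> K,
    (j y : vsp K L) = \sum_i c i *: f i by exact: jf.
have [Ck [Ck0 hCk]] := @coord_bound _ _ v hv (pv_complete hp) (vsp K L) nL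
  (bm_ultra hL) (bm_scale hL) _ f fI.
exists (fun i y => c y i), Ck; split=> //.
- move=> i k y y'; apply/eqP; rewrite -subr_eq0; apply/eqP; move: i.
  have e : (j (k%:A *: (y : X) + y' : X) : vsp K L) =
      k *: (j (y : X) : vsp K L) + (j (y' : X) : vsp K L) by rewrite jD jZ.
  apply: fI; under eq_bigr do rewrite scalerBl scalerDl -scalerA.
  rewrite sumrB big_split /= -scaler_sumr -!hc.
  by apply/eqP; rewrite subr_eq0; apply/eqP; exact: e.
- move=> y; apply: jI; have j0 : j 0 = 0 by rewrite -[0](scale0r (0 : X)) jS scale0r.
  rewrite (big_morph j jD j0) (hc y); apply: eq_bigr => i _.
  by rewrite jZ jx.
by move=> i y; rewrite jN (hc y); exact: hCk.
Qed.

(** The embedding of [X] in [L] extends to a surjection from the Verma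
   module. A proper submodule of the Verma module meets its top in a proper
   submodule of [X], which is zero since [X] is simple; hence [kernel_sub]
   applies in both directions to any two simple quotients. *)
Lemma simple_head_model : is_simple_head v nR gr B cBH W L.
Proof.
have [co [Ck [coL coE Ck0 coC]]] := head_coord.
have CX0 := ltW (bm_C0 hL).
have hCX (s : salg cBH) (y : X) : nX (s *: y) <= C * nR (val s) * nX y.
  by rewrite !jN jS; exact: (bm_C hL).
have Bkill (s : salg cBH) b : Bneg gr B b -> val s = val b -> forall y : X, s *: y = 0.
  by move=> hb sb y; apply: j_inj; rewrite jS sb; have [_ h] := jh y; exact: h.
have d0_mu (d0 : salg H) : LBneg gr B (d - val d0) ->
    forall y : X, H_cBH hp hcR hcBH d0 *: y = mu%:A *: y.
  move=> hd0 y; apply: jI; rewrite jS jZ; have [dy by0] := jh y.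
  have dy0 : (val d - mu%:A) *: j y \in zero_submod L.
    by apply/zero_submodP; rewrite scalerBl dy subrr.
  have by1 b : Bneg gr B b -> val b *: j y \in zero_submod L.
    by move=> hb; apply/zero_submodP; exact: by0.
  have /zero_submodP/eqP := d0_act hd0 dy0 by1.
  by rewrite subr_eq0 => /eqP.
have jL (k : K) y y' : j (k%:A *: y + y') = k%:A *: j y + j y' by rewrite jD jZ.
have jN' y : nL (j y) <= nX y by rewrite jN.
have [CR CR0 hCR] := mul_bound hp hcR.
have [D [nD [t hD]]] := verma_model_exists hv hcR CR0 hCR hX coL coE Ck0 coC.
have wg := verma_wgen htri CR0 hCR hX coL coE Ck0 coC CX0 hCX hD Bkill d0_mu.
have fg := verma_fin_gen hp hcR htri hcBH CR0 hCR hX coL coE Ck0 coC CX0 hCX hD.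
have gen := verma_gen hp hcR htri hcBH CR0 hCR hX coL coE Ck0 coC CX0 hCX hD.
have cAc := closure_banach hp hcR (btd_cA htri).
have cl U := sub_nclosed hp hcR cAc cA_noeth.1 (vm_bmod hD) fg (U := U).
have tadd := t_add2 hD; have t0 := t_zero2 hD; have tZ := t_scal2 hD.
have t1S (s : salg cBH) (y : X) : t 1 (s *: y) = val s *: t 1 y.
  by rewrite -(vm_bal hD) mul1r -(vm_act hD) mulr1.
have top_t y : top_part (fun i => t 1 (x i)) y -> exists z, y = t 1 z.
  move=> [k ->]; exists (\sum_i (k i)%:A *: x i).
  rewrite (big_morph (t 1) (tadd 1) (t0 1)); apply: eq_bigr => i _.
  by rewrite tZ.
have top_proper (U : submod D) : (exists y, y \notin U) ->
    forall y, top_part (fun i => t 1 (x i)) y -> y \in U -> y = 0.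
  move=> [p pU] _ /top_t[z ->] zU; apply: contrapT => z0.
  have [U0 UD UZ] := submod_set U.
  pose P : set X := [set y | t 1 y \in U].
  have P0 : P 0 by rewrite /P /= t0.
  have PD y y' : P y -> P y' -> P (y + y') by move=> h h'; rewrite /P /= tadd; exact: UD.
  have PZ s y : P y -> P (s *: y) by move=> h; rewrite /P /= t1S; exact: UZ.
  have inP y := mksubP P0 PD PZ y.
  have [Pz|Pall] := Xs.2 (mksub P0 PD PZ).
    by apply: z0; rewrite (Pz z) ?t0 //; apply/inP.
  move/negP: pU; apply; have [a [_ ->]] := gen p.
  by apply: (submod_sum (N := U)) => i _; apply: UZ; apply/inP.
have [g hg] := vm_map hD hL jL jS jN'.
have [[y0 y0n] _] := Xs.
have j0 : j y0 != 0 by apply: contra y0n => /eqP/j_inj ->.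
have gs y : exists p, g p = y.
  pose P : set L := [set z | exists p, g p = z].
  have P0 : P 0 by exists 0; rewrite linear0.
  have PD z z' : P z -> P z' -> P (z + z').
    by move=> [a <-] [b <-]; exists (a + b); rewrite linearD.
  have PZ r z : P z -> P (r *: z) by move=> [a <-]; exists (r *: a); rewrite linearZ.
  have inP z := mksubP P0 PD PZ z.
  have [Pz|Pall] := Ls.2 (mksub P0 PD PZ); last exact/inP.
  have : j y0 = 0.
    by apply: Pz; apply/inP; exists (t 1 y0); rewrite hg scale1r.
  by move=> h; rewrite h eqxx in j0.
have y0t : top_part (fun i => t 1 (x i)) (t 1 y0).
  exists (fun i => co i y0); rewrite (t_expand coE hD); apply: eq_bigr => i _.
  by rewrite mulr1.
have ty0 : t 1 y0 != 0.
  by apply: contra j0 => /eqP h; rewrite -[j y0]scale1r -hg h linear0.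
have ker := kernel_sub hp hcR htri (vm_bmod hD) cl wg top_proper y0t ty0.
exists D; split; last split=> //.
  exists X, nX, nD, t; split=> //.
  - have hb := vm_bmod hD; apply/(banach_vsp hv).
    by split; [exact: bm_ultra hb|exact: bm_complete hb|exact: bm_scale hb].
  - exact: vm_tensor hD.
  - exact: vm_act hD.
exists g; split=> // L' f' s' f's p; split; exact: ker.
Qed.
End HeadModel.

Lemma smod_simple (S : nzRingType) (M : lmodType S) (W : submod M) :
  (exists2 y, y \in W & y != 0) ->
  (forall P : submod M, (forall y, y \in P -> y \in W) ->
     (exists2 y, y \in P & y != 0) -> forall y, y \in W -> y \in P) ->
  simple_mod (smod W).
Proof.
move=> Wn Wmin; split=> [|N].
  have [y yW y0] := Wn; exists (exist _ y yW : smod W).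
  by apply: contra y0 => /eqP/(congr1 (val : smod W -> M)) /= ->.
have [N0 ND NZ] := submod_set N.
pose P : set M := [set y | exists2 z : smod W, z \in N & val z = y].
have P0 : P 0 by exists 0.
have PD y y' : P y -> P y' -> P (y + y').
  by move=> [a aN <-] [b bN <-]; exists (a + b); first exact: ND.
have PZ a y : P y -> P (a *: y).
  by move=> [b bN <-]; exists (a *: b); first exact: NZ.
have inP y := mksubP P0 PD PZ y.
have [hN|hN] := pselect (exists2 z, z \in N & z != 0); last first.
  left=> z zN; apply/eqP; apply: contrapT => z0; apply: hN; exists z => //; exact/negP.
right=> z; have /inP[z' z'N /val_inj <-//] : val z \in mksub P0 PD PZ.
apply: Wmin (valP z); first by move=> _ /inP[a _ <-]; exact: valP.
have [a aN a0] := hN; exists (val a); first by apply/inP; exists a.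
by apply: contra a0 => /eqP h; apply/eqP/val_inj.
Qed.

Section Head.
Context (RT : realType) (K : fieldType) (v : K -> RT) (w : K) (hp : pvalued v w).
Context (cR : algType K) (nR : cR -> RT) (hcR : is_banach_alg v nR).
Context (R : subalg cR) (gr : int -> submod (salg R)).
Context (A B H : subalg (salg R)) (d : salg R) (cA cB : subalg cR).
Context (htri : banach_tridec v nR gr A B H d cA cB).
Context (cA_noeth : noetherian (salg cA)).
Context (cBH : subalg cR) (hcBH : is_cBH nR B H cBH).
Local Notation valH := (@H_val K cR R H).

Context (L : lmodType cR) (nL : L -> RT) (C : RT) (hL : banach_mod v nR nL C) (mu : K).
Context (Ls : simple_mod L).
Local Notation LH := (restrict valH L).
Local Notation LX := (restrict (val : {rmorphism salg cBH -> cR}) L).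
Context (W : submod LH) (Wx : submod LX) (WxW : forall y, (y \in Wx) = (y \in W)).
Context (Wn : exists2 y, y \in W & y != 0).
Context (WE : forall y, y \in W -> highest_vec gr B d mu y).
Context (Wmin : forall P : submod LH, (forall y, y \in P -> y \in W) ->
  (exists2 y, y \in P & y != 0) -> forall y, y \in W -> y \in P).
Context (q : nat) (f : 'I_q -> vsp K L) (fI : lin_indep f).
Context (fW : forall y, y \in W <-> span f y).
Let nXs (y : smod Wx) : RT := nL (val y : L).
Context (hX : is_banach v (nXs : vsp K (smod Wx) -> RT)).
Context (hI : is_inflation v nR gr B (smod W) (nXs : vsp K (smod Wx) -> RT)).

(** A [cBH]-submodule of [W] is an [H]-submodule. *)
Lemma Wx_simple : simple_mod (smod Wx).
Proof.
apply: smod_simple => [|P PW Pn y].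
  by have [y yW y0] := Wn; exists y; rewrite // WxW.
have [P0 PD PZ] := submod_set P.
have PZ' (a : salg H) z : z \in P -> (a *: (z : LH)) \in P.
  exact: (PZ (H_cBH hp hcR hcBH a) z).
have inP z := mksubP (P := [set z : LH | z \in P]) P0 PD PZ' z.
rewrite WxW => yW; apply/inP; apply: Wmin yW.
  by move=> z /inP/PW; rewrite WxW.
by have [z zP z0] := Pn; exists z => //; apply/inP.
Qed.

Lemma span_mem i : f i \in Wx.
Proof.
rewrite WxW; apply/fW; exists (fun j => (j == i)%:R).
rewrite (bigD1 i) //= eqxx scale1r big1 ?addr0 //.
by move=> j ji; rewrite (negbTE ji) scale0r.
Qed.

Lemma Wx_hwv (y : smod Wx) : highest_vec gr B d mu (val y).
Proof. by apply: WE; rewrite -WxW; exact: (valP y). Qed.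

Lemma simple_head : is_simple_head v nR gr B cBH (smod W) L.
Proof.
pose j (y : smod Wx) : L := val y.
have jD y y' : j (y + y') = j y + j y' by [].
have jS (s : salg cBH) y : j (s *: y) = val s *: j y by [].
have jN y : nXs y = nL (j y) by [].
have j_inj y : j y = 0 -> y = 0 by move=> y0; exact: val_inj.
have jf y : span f (j y) by apply/fW; rewrite -WxW; exact: valP.
pose x i : smod Wx := exist _ (f i) (span_mem i).
have jx i : j (x i) = f i by [].
exact: (simple_head_model hp hcR htri cA_noeth hcBH hL Ls hX hI Wx_simple jD jS jN
  j_inj Wx_hwv fI jf jx).
Qed.
End Head.

(** * Composition factors *)

Section Factor.
Context (RT : realType) (K : fieldType) (v : K -> RT) (w : K) (hp : pvalued v w).
Context (cR : algType K) (nR : cR -> RT) (hcR : is_banach_alg v nR).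
Context (R : subalg cR) (gr : int -> submod (salg R)).
Context (A B H : subalg (salg R)) (d : salg R) (cA cB : subalg cR).
Context (htri : banach_tridec v nR gr A B H d cA cB).
Context (cA_noeth : noetherian (salg cA)) (cB_noeth : noetherian (salg cB)).
Context (cBH : subalg cR) (hcBH : is_cBH nR B H cBH).
Let hv := pv_abs hp.
Let uR := banach_ultra hv hcR.1.

(** A minimal [H]-module of highest weight vectors in [L] is simple, and is
   its own inflation. *)
Lemma simple_is_head (L : lmodType cR) (nL : L -> RT) (C : RT) (hL : banach_mod v nR nL C)
    (mu : K) (x0 : L) : simple_mod L -> x0 != 0 -> highest_vec gr B d mu x0 ->
  exists W : lmodType (salg H), simple_mod W /\ is_simple_head v nR gr B cBH W L.
Proof.
move=> Ls x0n hx0; have [W [Wn WE Wmin]] := highest_simple hp htri x0n hx0.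
have [q [f [fI fW]]] := W_basis htri Wn Wmin.
exists (smod W); split; first exact: (smod_simple Wn Wmin).
apply: (@simple_head RT K v w hp cR nR hcR R gr A B H d cA cB htri cA_noeth cBH hcBH
  L nL C hL mu Ls W (WX hp hcR htri hcBH hL WE fI fW) (fun=> erefl) Wn WE Wmin q f fI fW).
  exact: nX_banach.
exact: inflation.
Qed.

Context (M : lmodType cR) (nM : M -> RT) (C : RT) (hM : banach_mod v nR nM C).
Context (cl : forall U : submod M, nclosed nM [set` U]).

Lemma subquot_bmod (N N' : submod M) : exists nL : subquot N N' -> RT, banach_mod v nR nL C.
Proof.
have hN' := bmod_sub hM (cl (U := N')).
exists (quot_norm (fun x : smod N' => nM (val x))).
apply: (bmod_quot hv uR hN') => x hx; apply: cl => e e0.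
by have [y yN xy] := hx e e0; exists (val y).
Qed.

Lemma subquot_eq0 (N N' : submod M) (z : smod N') :
  (\pi_(quotmod (Submod (in_sub_closed N N'))) z = 0) <-> val z \in N.
Proof. exact: quotmod_pi_eq0. Qed.

Lemma subquot_simple (N N' : submod M) : (forall x, x \in N -> x \in N') ->
  (exists2 x, x \in N' & x \notin N) ->
  (forall P : submod M, (forall x, x \in N -> x \in P) ->
     (forall x, x \in P -> x \in N') ->
     (forall x, x \in P -> x \in N) \/ (forall x, x \in N' -> x \in P)) ->
  simple_mod (subquot N N').
Proof.
move=> NN' [x xN' xN] hmin.
pose pi_ (z : smod N') : subquot N N' := \pi_(quotmod (Submod (in_sub_closed N N'))) z.
split=> [|Q].
  exists (pi_ (exist _ x xN')); apply/eqP => /subquot_eq0 /= h.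
  by rewrite h in xN.
have [Q0 QD QZ] := submod_set Q.
pose P : set M := [set y | exists2 z : smod N', pi_ z \in Q & val z = y].
have P0 : P 0 by exists 0; rewrite // /pi_ quotmod_pi0.
have PD y y' : P y -> P y' -> P (y + y').
  move=> [a aQ <-] [b bQ <-]; exists (a + b) => //.
  by rewrite /pi_ quotmod_piD; exact: QD.
have PZ r y : P y -> P (r *: y).
  move=> [a aQ <-]; exists (r *: a) => //.
  by rewrite /pi_ quotmod_pi_scale; exact: QZ.
have inP y := mksubP P0 PD PZ y.
have [||h|h] := hmin (mksub P0 PD PZ).
- move=> y yN; apply/inP; exists (exist _ y (NN' y yN)) => //.
  have -> : pi_ (exist _ y (NN' y yN)) = 0 by apply/subquot_eq0.
  exact: Q0.
- by move=> y /inP[z _ <-]; exact: valP.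
- left; elim/quotW => z zQ; apply/subquot_eq0; apply: h; apply/inP.
  by exists z.
right; elim/quotW => z; have /inP[z' z'Q /val_inj e] : val z \in mksub P0 PD PZ.
  by apply: h; exact: valP.
by rewrite -e.
Qed.
End Factor.

Theorem proposition3p1p25 (RT : realType) (p : nat) (p_prime : prime p)
    (Qp K : fieldType) (vp : Qp -> RT) (v : K -> RT)
    (iota : {rmorphism Qp -> K}) (hK : is_cdv_ext p vp v iota)
    (cR : algType K) (nR : cR -> RT)
    (hcR : is_banach_alg v nR) (cR_noeth : noetherian cR)
    (R : subalg cR) (gr : int -> submod (salg R))
    (A B H : subalg (salg R)) (d : salg R)
    (cA cB : subalg cR)
    (htri : banach_tridec v nR gr A B H d cA cB)
    (cA_noeth : noetherian (salg cA)) (cB_noeth : noetherian (salg cB))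
    (cBH : subalg cR) (hcBH : is_cBH nR B H cBH)
    (M : lmodType cR) (hM : in_catO v nR d cA M) :
  exists (n : nat) (F : nat -> submod M),
    [/\ forall x, x \in F 0%N <-> x = 0,
        forall x, x \in F n,
        forall i, (i < n)%N -> forall x, x \in F i -> x \in F i.+1,
        forall i, (i <= n)%N -> in_catO v nR d cA (smod (F i))
      & forall i, (i < n)%N -> exists W : lmodType (salg H),
          simple_mod W /\
          is_simple_head v nR gr B cBH W (subquot (F i) (F i.+1))].
Proof.
have [w hp] := cdv_pvalued p_prime hK.
have [_ fgM [nM nMc wdM]] := hM.
have [C bM] := (bmod_canonical hp hcR nM).1 nMc.
have hA := cA_galg hp hcR htri.
have cAc := closure_banach hp hcR (btd_cA htri).
have [T [lam [m [N hW]]]] := weight_generated hp hcR cAc bM fgM wdM.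
have cl U := sub_nclosed hp hcR cAc cA_noeth.1 bM fgM (U := U).
have [n [F [F0 Fn Finc Fstr Fmin]]] := module_series hp hcR htri bM hW cl (zero_submod M).
exists n, F; split=> //.
- by move=> x; rewrite F0; exact: zero_submodP.
- move=> i _; exact: (sub_catO hp hcR hA cAc cA_noeth.1 bM fgM hW).
move=> i lt_in; have [x xF' xF] := Fstr i lt_in.
(* Modulo [F i], this is a highest weight vector of the factor. *)
have [mu [y [yF' yF dy byF]]] := highest_vector hp hcR htri bM hW cl xF' xF.
have [nL hL] := subquot_bmod hp hcR bM cl (F i) (F i.+1).
pose y0 : smod (F i.+1) := exist _ y yF'.
apply: (simple_is_head hp hcR htri cA_noeth cB_noeth hcBH hL (mu := mu)
  (x0 := \pi_(quotmod (Submod (in_sub_closed (F i) (F i.+1)))) y0)).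
- by apply: subquot_simple; [exact: Finc|exact: Fstr|exact: Fmin].
- by apply/eqP => /subquot_eq0 /= h; rewrite h in yF.
split.
  apply/eqP; rewrite -subr_eq0 -!quotmod_pi_scale -quotmod_piB; apply/eqP.
  by apply/subquot_eq0; rewrite /= -scalerBl.
move=> b hb; rewrite -quotmod_pi_scale; apply/subquot_eq0.
exact: byF.
Qed.
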